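(* Let $\psi(x,z)$ be the normalized Baker--Akhiezer function for $R$ with multiplicities $m_\alpha\in\mathbb Z_{\ge0}$, and let $\mathfrak R^\vee$ be the ring of all polynomials $f(z)=\sum_{\nu\in P^\vee}f_\nu q^{2(\nu,z)}$ (finite sums) such that for each $\alpha\in R$ and $s=1,\dots,m_\alpha$ one has $f(z+\frac12s\alpha)=f(z-\frac12s\alpha)$ whenever $q^{2(\alpha^\vee,z)}=1$. For each $f\in\mathfrak R^\vee$ there exists a difference operator $D_f$ in $x$ on the lattice $P^\vee$, i.e. a finite sum $D_f=\sum_{\nu\in P^\vee}d_\nu(x)T_x^\nu$, such that $D_f\psi=f(z)\psi$. All these operators commute. For a (quasi)minuscule coweight $\pi$ of $R$ and $f=\mathfrak m_\pi(z)=\sum_{\tau\in W\pi}q^{2(\tau,z)}$ the corresponding operator $D_f$ coincides with the Macdonald operator $D^\pi$ with $t_\alpha=q^{-m_\alpha}$.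
   Context: $V=\mathbb R^n$ is a Euclidean space with scalar product $(\cdot,\cdot)$, extended complex-bilinearly to $V\otimes\mathbb C$; variables $x,z$ range over $V\otimes\mathbb C$. $R\subset V$ is a reduced irreducible root system of rank $n$, $R_+$ positive roots, $W$ the Weyl group, $\alpha^\vee=2\alpha/(\alpha,\alpha)$, $P^\vee=\{\pi\in V:(\pi,\alpha)\in\mathbb Z\ \forall\alpha\in R\}$. $q\in\mathbb C^\times$ is not a root of unity, $\log q$ is fixed, $q^a=e^{a\log q}$, $[a]=q^a-q^{-a}$, $(T_x^vf)(x)=f(x+v)$. $m_\alpha$ are $W$-invariant, $\rho=\frac12\sum_{\alpha\in R_+}m_\alpha\alpha$, $\rho^\vee=\frac12\sum_{\alpha\in R_+}m_\alpha\alpha^\vee$. A coweight $\pi\in P^\vee$ is minuscule if $-1\le(\pi,\alpha)\le1$ for all $\alpha\in R$, quasiminuscule if $\pi\in R^\vee$ and $-1\le(\pi,\alpha)\le1$ for all $\alpha\in R\setminus\{\pm\pi^\vee\}$, $\pi^\vee=2\pi/(\pi,\pi)$; (quasi)minuscule means nonzero and one of these. The Macdonald operator with $t_\alpha=q^{-m_\alpha}$ is $$D^\pi=\sum_{\tau\in W\pi}a_\tau(T_x^\tau-1)+\sum_{\tau\in W\pi}q^{2(\rho,\tau)},\quad a_\tau(x)=\prod_{\alpha\in R,(\alpha,\tau)>0}\frac{[(\alpha,x)-m_\alpha]}{[(\alpha,x)]}\prod_{\alpha\in R,(\alpha,\tau)=2}\frac{[(\alpha,x)-m_\alpha+1]}{[(\alpha,x)+1]}.$$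 With $\mathcal N=\{\rho^\vee-\sum_{\alpha\in R_+}l_\alpha\alpha^\vee:0\le l_\alpha\le m_\alpha\}$, the normalized Baker--Akhiezer function is the unique function $\psi(x,z)=q^{2(x,z)}\sum_{\nu\in\mathcal N\cap P^\vee}\psi_\nu(x)q^{2(\nu,z)}$ such that $\psi(x,z+\frac12s\alpha)=\psi(x,z-\frac12s\alpha)$ whenever $q^{2(\alpha^\vee,z)}=1$, for all $\alpha\in R$, $s=1,\dots,m_\alpha$, and $\psi_{\rho^\vee}(x)=\prod_{\alpha\in R_+}\prod_{j=1}^{m_\alpha}[j-(\alpha,x)]$. *)

(* Defs.v *)
From HB Require Import structures.
From mathcomp Require Import all_boot all_order all_algebra finmap.
From mathcomp Require Import all_classical all_reals all_analysis.
From mathcomp Require Import complex.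

Set Implicit Arguments.
Unset Strict Implicit.
Unset Printing Implicit Defensive.

Import Order.TTheory GRing.Theory Num.Theory.

Local Open Scope classical_set_scope.
Local Open Scope ring_scope.
Local Open Scope complex_scope.

(* V = R^n is 'rV[R]_n and its complexification is 'rV[R[i]]_n.               *)

Definition dot {K : pzRingType} {n : nat} (u v : 'rV[K]_n) : K :=
  \sum_i u 0 i * v 0 i.

Definition cplx {R : realType} {n : nat} (v : 'rV[R]_n) : 'rV[R[i]]_n :=
  map_mx (real_complex R) v.

Definition expC {R : realType} (w : R[i]) : R[i] :=
  let: a +i* b := w in (expR a)%:C * (cos b +i* sin b).

(* Powers of q depend on the choice lq of log q: qpow lq a is q^a and         *)
(* qbr lq a is [a].                                                           *)
Definition qpow {R : realType} (lq a : R[i]) : R[i] := expC (a * lq).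

Definition qbr {R : realType} (lq a : R[i]) : R[i] :=
  qpow lq a - qpow lq (- a).

(** Root systems *)

(* The coroot of a root; the same formula takes a coroot back to its root. *)
Definition checkv {R : realType} {n : nat} (a : 'rV[R]_n) : 'rV[R]_n :=
  (2 / dot a a) *: a.

Definition reflv {R : realType} {n : nat} (a v : 'rV[R]_n) : 'rV[R]_n :=
  v - dot (checkv a) v *: a.

(* Root system of rank n, i.e. spanning R^n. *)
Record root_system {R : realType} {n : nat} (Phi : {fset 'rV[R]_n}) : Prop := {
  root_neq0 : 0 \notin Phi;
  root_span : forall v : 'rV[R]_n,
    exists c : 'rV[R]_n -> R, v = \sum_(a <- Phi) c a *: a;
  root_refl : {in Phi &, forall a b, reflv a b \in Phi};
  root_int : {in Phi &, forall a b, dot (checkv a) b \is a Num.int}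
}.

Definition reduced {R : realType} {n : nat} (Phi : {fset 'rV[R]_n}) : Prop :=
  forall (a : 'rV[R]_n) (c : R),
    a \in Phi -> c *: a \in Phi -> c = 1 \/ c = -1.

(* No splitting into two nonempty mutually orthogonal parts. *)
Definition irreducible {R : realType} {n : nat} (Phi : {fset 'rV[R]_n}) : Prop :=
  Phi != fset0 /\
  forall A : pred 'rV[R]_n,
    {in Phi &, forall a b, A a -> ~~ A b -> dot a b = 0} ->
    {in Phi, forall a, A a} \/ {in Phi, forall a, ~~ A a}.

Definition positive_system {R : realType} {n : nat}
    (Phi Pos : {fset 'rV[R]_n}) : Prop :=
  exists v : 'rV[R]_n, {in Phi, forall a, dot a v != 0} /\
    (forall a, (a \in Pos) = (a \in Phi) && (0 < dot a v)).

Definition W_invariant {R : realType} {n : nat} (Phi : {fset 'rV[R]_n})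
    (m : 'rV[R]_n -> nat) : Prop :=
  {in Phi &, forall a b, m (reflv a b) = m b}.

(* Elements of W are the finite products of reflections in roots. *)
Definition W_orbit {R : realType} {n : nat} (Phi : {fset 'rV[R]_n})
    (p : 'rV[R]_n) : set 'rV[R]_n :=
  [set foldr reflv p s | s in [set s : seq 'rV[R]_n | {subset s <= Phi}]].

Definition coweight {R : realType} {n : nat} (Phi : {fset 'rV[R]_n}) :
    set 'rV[R]_n :=
  [set p | {in Phi, forall a, dot p a \is a Num.int}].

Definition root_lattice {R : realType} {n : nat} (Phi : {fset 'rV[R]_n}) :
    set 'rV[R]_n :=
  [set l | exists k : 'rV[R]_n -> int, l = \sum_(a <- Phi) a *~ k a].

Definition rho {R : realType} {n : nat} (Pos : {fset 'rV[R]_n})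
    (m : 'rV[R]_n -> nat) : 'rV[R]_n :=
  2^-1 *: \sum_(a <- Pos) (m a)%:R *: a.

Definition rhov {R : realType} {n : nat} (Pos : {fset 'rV[R]_n})
    (m : 'rV[R]_n -> nat) : 'rV[R]_n :=
  2^-1 *: \sum_(a <- Pos) (m a)%:R *: checkv a.

(* The polytope N: the coefficients l are real. *)
Definition polytope {R : realType} {n : nat} (Pos : {fset 'rV[R]_n})
    (m : 'rV[R]_n -> nat) : set 'rV[R]_n :=
  [set rhov Pos m - \sum_(a <- Pos) l a *: checkv a |
    l in [set l : 'rV[R]_n -> R | {in Pos, forall a, 0 <= l a <= (m a)%:R}]].

Definition minuscule {R : realType} {n : nat} (Phi : {fset 'rV[R]_n})
    (p : 'rV[R]_n) : Prop :=
  coweight Phi p /\ {in Phi, forall a, -1 <= dot p a <= 1}.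

Definition quasiminuscule {R : realType} {n : nat} (Phi : {fset 'rV[R]_n})
    (p : 'rV[R]_n) : Prop :=
  (exists2 a, a \in Phi & p = checkv a) /\
  {in Phi, forall a, a <> checkv p -> a <> - checkv p -> -1 <= dot p a <= 1}.

Definition minuscule_or_quasi {R : realType} {n : nat} (Phi : {fset 'rV[R]_n})
    (p : 'rV[R]_n) : Prop :=
  p <> 0 /\ (minuscule Phi p \/ quasiminuscule Phi p).

(** Quasi-invariants and the Baker-Akhiezer function *)

Definition quasi_invariant {R : realType} {n : nat} (lq : R[i])
    (Phi : {fset 'rV[R]_n}) (m : 'rV[R]_n -> nat)
    (F : 'rV[R[i]]_n -> R[i]) : Prop :=
  forall (a : 'rV[R]_n) (s : nat) (z : 'rV[R[i]]_n),
    a \in Phi -> (1 <= s <= m a)%N ->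
    qpow lq (2 * dot (cplx (checkv a)) z) = 1 ->
    F (z + (s%:R / 2) *: cplx a) = F (z - (s%:R / 2) *: cplx a).

Definition qi_ring {R : realType} {n : nat} (lq : R[i])
    (Phi : {fset 'rV[R]_n}) (m : 'rV[R]_n -> nat)
    (f : 'rV[R[i]]_n -> R[i]) : Prop :=
  (exists (s : seq 'rV[R]_n) (c : 'rV[R]_n -> R[i]),
    (forall nu, nu \in s -> coweight Phi nu) /\
    forall z, f z = \sum_(nu <- s) c nu * qpow lq (2 * dot (cplx nu) z)) /\
  quasi_invariant lq Phi m f.

Definition orbit_sum {R : realType} {n : nat} (lq : R[i])
    (Phi : {fset 'rV[R]_n}) (p : 'rV[R]_n) (z : 'rV[R[i]]_n) : R[i] :=
  \sum_(t \in W_orbit Phi p) qpow lq (2 * dot (cplx t) z).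

(* No regularity in x is imposed on the coefficients psi_nu: the conditions   *)
(* pin them down for generic x only, and they may be arbitrary elsewhere.     *)
Definition normalized_BA {R : realType} {n : nat} (lq : R[i])
    (Phi Pos : {fset 'rV[R]_n}) (m : 'rV[R]_n -> nat)
    (psi : 'rV[R[i]]_n -> 'rV[R[i]]_n -> R[i]) : Prop :=
  exists psi_ : 'rV[R]_n -> 'rV[R[i]]_n -> R[i],
  [/\ forall x z, psi x z = qpow lq (2 * dot x z) *
        \sum_(nu \in polytope Pos m `&` coweight Phi)
           psi_ nu x * qpow lq (2 * dot (cplx nu) z),
      forall x, quasi_invariant lq Phi m (psi x) &
      forall x, psi_ (rhov Pos m) x =
        \prod_(a <- Pos) \prod_(1 <= j < (m a).+1)
           qbr lq (j%:R - dot (cplx a) x)].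

(** Difference operators in x *)

(* Laurent polynomials in the q^(a,x), a in Phi. *)
Definition trig_poly {R : realType} {n : nat} (lq : R[i])
    (Phi : {fset 'rV[R]_n}) (p : 'rV[R[i]]_n -> R[i]) : Prop :=
  exists (s : seq 'rV[R]_n) (c : 'rV[R]_n -> R[i]),
    (forall l, l \in s -> root_lattice Phi l) /\
    forall x, p x = \sum_(l <- s) c l * qpow lq (dot (cplx l) x).

(* P holds off the zero set of a nonzero Laurent polynomial in the q^(a,x). *)
Definition generically {R : realType} {n : nat} (lq : R[i])
    (Phi : {fset 'rV[R]_n}) (P : 'rV[R[i]]_n -> Prop) : Prop :=
  exists p : 'rV[R[i]]_n -> R[i],
    [/\ trig_poly lq Phi p, exists x, p x != 0 & forall x, p x != 0 -> P x].

(* Rational functions in the q^(a,x), as total functions whose values on the  *)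
(* zero set of the denominator are irrelevant.                                *)
Definition trig_rational {R : realType} {n : nat} (lq : R[i])
    (Phi : {fset 'rV[R]_n}) (d : 'rV[R[i]]_n -> R[i]) : Prop :=
  exists p r : 'rV[R[i]]_n -> R[i],
    [/\ trig_poly lq Phi p, trig_poly lq Phi r, exists x, r x != 0 &
        forall x, r x != 0 -> d x = p x / r x].

Definition difference_operator {R : realType} {n : nat} (lq : R[i])
    (Phi : {fset 'rV[R]_n})
    (D : ('rV[R[i]]_n -> R[i]) -> ('rV[R[i]]_n -> R[i])) : Prop :=
  exists (s : seq 'rV[R]_n) (d : 'rV[R]_n -> 'rV[R[i]]_n -> R[i]),
    [/\ forall nu, nu \in s -> coweight Phi nu,
        forall nu, nu \in s -> trig_rational lq Phi (d nu) &
        forall F x, D F x = \sum_(nu <- s) d nu x * F (x + cplx nu)].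

(* Equality of difference operators whose coefficients may have poles. As F   *)
(* is arbitrary and the exceptional set does not depend on it, this is        *)
(* equality of all coefficients as rational functions.                        *)
Definition operator_eq {R : realType} {n : nat} (lq : R[i])
    (Phi : {fset 'rV[R]_n})
    (D E : ('rV[R[i]]_n -> R[i]) -> ('rV[R[i]]_n -> R[i])) : Prop :=
  generically lq Phi (fun x => forall F, D F x = E F x).

(* D is an operator D_f: a difference operator with D psi = f(z) psi. *)
Definition eigenoperator {R : realType} {n : nat} (lq : R[i])
    (Phi : {fset 'rV[R]_n}) (psi : 'rV[R[i]]_n -> 'rV[R[i]]_n -> R[i])
    (f : 'rV[R[i]]_n -> R[i])
    (D : ('rV[R[i]]_n -> R[i]) -> ('rV[R[i]]_n -> R[i])) : Prop :=
  difference_operator lq Phi D /\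
  generically lq Phi (fun x => forall z, D (psi^~ z) x = f z * psi x z).

Definition macdonald_coef {R : realType} {n : nat} (lq : R[i])
    (Phi : {fset 'rV[R]_n}) (m : 'rV[R]_n -> nat)
    (t : 'rV[R]_n) (x : 'rV[R[i]]_n) : R[i] :=
  (\prod_(a <- Phi | 0 < dot a t)
     (qbr lq (dot (cplx a) x - (m a)%:R) / qbr lq (dot (cplx a) x))) *
  (\prod_(a <- Phi | dot a t == 2)
     (qbr lq (dot (cplx a) x - (m a)%:R + 1) / qbr lq (dot (cplx a) x + 1))).

Definition macdonald {R : realType} {n : nat} (lq : R[i])
    (Phi Pos : {fset 'rV[R]_n}) (m : 'rV[R]_n -> nat) (p : 'rV[R]_n)
    (F : 'rV[R[i]]_n -> R[i]) (x : 'rV[R[i]]_n) : R[i] :=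
  \sum_(t \in W_orbit Phi p)
     macdonald_coef lq Phi m t x * (F (x + cplx t) - F x) +
  (\sum_(t \in W_orbit Phi p) qpow lq (2 * (dot (rho Pos m) t)%:C)) * F x.

(* Main.v *)
(* Quasi-invariance in z amounts to linear equations for the coefficients of    *)
(* psi along the strings l + Z a^vee; for generic x they force every nonempty   *)
(* string of the support to have length at least m_a. Following a path of       *)
(* chambers, one finds that a support with this property reaches in every       *)
(* direction as far as some translate of N. Hence a solution supported in N is  *)
(* determined by one vertex coefficient. The shifts psi(x + nu, z) therefore    *)
(* span enough to expand f psi, with unique coefficients; this gives D_f, and   *)
(* by uniqueness the D_f commute.                                               *)
(* For f = m_pi the functions D^pi psi and f psi have the same extreme          *)
(* coefficients, so D^pi psi = (f + g) psi with g independent of z. Now         *)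
(* h(x) = psi(x, rho) is constant in x: by quasi-invariance psi(x, w rho) does  *)
(* not depend on w, and on a line x + t y it is a polynomial in q^t when w rho  *)
(* is chosen in the chamber of y, a polynomial in q^-t when it is chosen        *)
(* in the chamber of -y. As h <> 0 and D^pi 1 = f(rho), evaluating at           *)
(* z = rho yields g = 0.                                                        *)
Require Import Defs.
From HB Require Import structures.
From mathcomp Require Import all_boot all_order all_algebra finmap.
From mathcomp Require Import all_classical all_reals all_analysis.
From mathcomp Require Import complex.
From mathcomp Require Import perm.
From mathcomp Require Import ring lra zify.

Set Implicit Arguments.
Unset Strict Implicit.
Unset Printing Implicit Defensive.

Import Order.TTheory GRing.Theory Num.Theory.

Local Open Scope classical_set_scope.
Local Open Scope ring_scope.
Local Open Scope complex_scope.

(** * Exponentials *)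

(** Quasi-invariance is turned into linear algebra on strings. Two exponentials [q^(2(l,z))] agree
    on the set [q^(2(a^vee,z)) = 1] exactly when their weights lie on one [a]-string
    ([character_separation]), so the condition on psi splits into the string equations [wave_eqs].
    In the nodes [u + u^-1] these are moment equations, and the Vandermonde argument makes every
    string of the support long ([wave_spread]). The convexity lemma [spread_bound] converts long
    strings into a statement about the convex hull of the support, whence [wave_vanish]: a solution
    supported in N plus a hull vanishes as soon as it vanishes at the vertices [rho^vee + nu].
    Together with [triangular_system], which inverts the matrix of these vertex coefficients, this
    yields [eigenoperator_exists] and [operator_unique]; commutation follows from the latter.

    For the Macdonald operator the vertex coefficients must be known. [rank1_solution] solves the
    equations along an edge of N and [chamber_formula] carries the normalization from vertex to
    vertex; [macdonald_top] says that the [a_tau] transport these values correctly. By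
    [hull_lattice] the relevant weights in the hull of a (quasi)minuscule orbit and 0 are the orbit
    and 0 themselves, so a single coefficient stays undetermined and is absorbed by a term [g psi]
    ([macdonald_proportional]).

    The number [g] is computed at [z = rho]. On a generic line the coefficients of psi have no poles
    except at [w = q^t = 0] ([line_regular]); their leading parts there solve a limit system whose
    solutions are multiples of an explicit product ([line_limit], [limit_sum_neq0]). Hence psi at
    [z = rho] is a polynomial in [w] with nonzero constant term ([psi_ray]), and by Weyl symmetry
    also in [w^-1], hence constant ([psi_shift_coweight]). *)

Section Exponential.
Context {R : realType}.
Implicit Types (a b w : R[i]).

Lemma expCD a b : expC (a + b) = expC a * expC b.
Proof.
case: a => a1 a2; case: b => b1 b2.
by rewrite /expC /= expRD cosD sinD; simpc; congr (_ +i* _); ring.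
Qed.

Lemma expC0 : expC (0 : R[i]) = 1.
Proof. by rewrite /expC /= expR0 cos0 sin0; simpc. Qed.

Lemma expC_surj w : w != 0 -> exists a, expC a = w.
Proof.
case: w => a b w0; pose r := Num.sqrt (a ^+ 2 + b ^+ 2).
have s_gt0 : 0 < a ^+ 2 + b ^+ 2.
  rewrite lt_def paddr_eq0 ?sqr_ge0 // !sqrf_eq0 addr_ge0 ?sqr_ge0 // andbT.
  by move: w0; rewrite eq_complex.
have r_gt0 : 0 < r by rewrite sqrtr_gt0.
have rE : r ^+ 2 = a ^+ 2 + b ^+ 2 by rewrite sqr_sqrtr // ltW.
pose c := a / r; pose s := b / r.
have cs1 : c ^+ 2 + s ^+ 2 = 1.
  by rewrite !expr_div_n -mulrDl -rE divff // expf_neq0 ?gt_eqF.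
have c_bd : -1 <= c <= 1.
  by rewrite -ler_norml -(@ler_pXn2r _ 2) ?nnegrE // expr1n real_normK ?num_real //
     -cs1 lerDl sqr_ge0.
have sE : sin (acos c) = `|s|.
  by rewrite sin_acos // -cs1 addrAC subrr add0r sqrtr_sqr.
have arE : expR (ln r) * c = a by rewrite lnK ?posrE // mulrC divfK ?gt_eqF.
have brE : expR (ln r) * s = b by rewrite lnK ?posrE // mulrC divfK ?gt_eqF.
have cc := acosK c_bd; have [s0|s0] := leP 0 s.
  exists (ln r +i* acos c); rewrite /expC cc sE ger0_norm //.
  by simpc; rewrite arE brE.
exists (ln r +i* - acos c); rewrite /expC cosN sinN cc sE ltr0_norm // opprK.
by simpc; rewrite arE brE.
Qed.

Lemma expC_ipi : expC (0 +i* (pi : R)) = -1.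
Proof. by rewrite /expC /= expR0 cospi sinpi; simpc. Qed.

End Exponential.

(** * The scalar product *)

Section Dot.
Context {K : comPzRingType} {n : nat}.
Implicit Types (u v w : 'rV[K]_n) (c : K).

Lemma dotC u v : dot u v = dot v u.
Proof. by apply: eq_bigr => i _; rewrite mulrC. Qed.

Lemma dotDl u v w : dot (u + v) w = dot u w + dot v w.
Proof. by rewrite -big_split; apply: eq_bigr => i _; rewrite mxE mulrDl. Qed.

Lemma dotZl c u v : dot (c *: u) v = c * dot u v.
Proof. by rewrite mulr_sumr; apply: eq_bigr => i _; rewrite mxE mulrA. Qed.

Lemma dotNl u v : dot (- u) v = - dot u v.
Proof. by rewrite -scaleN1r dotZl mulN1r. Qed.

Lemma dotBl u v w : dot (u - v) w = dot u w - dot v w.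
Proof. by rewrite dotDl dotNl. Qed.

Lemma dot0l u : dot 0 u = 0.
Proof. by rewrite -(scale0r u) dotZl mul0r. Qed.

Lemma dotDr u v w : dot w (u + v) = dot w u + dot w v.
Proof. by rewrite ![dot w _]dotC dotDl. Qed.

Lemma dotZr c u v : dot u (c *: v) = c * dot u v.
Proof. by rewrite ![dot u _]dotC dotZl. Qed.

Lemma dotNr u v : dot u (- v) = - dot u v.
Proof. by rewrite ![dot u _]dotC dotNl. Qed.

Lemma dotBr u v w : dot w (u - v) = dot w u - dot w v.
Proof. by rewrite dotDr dotNr. Qed.

Lemma dot0r u : dot u 0 = 0.
Proof. by rewrite dotC dot0l. Qed.

Lemma dotMnl u v k : dot (u *+ k) v = dot u v *+ k.
Proof. by elim: k => [|k IH]; rewrite ?mulr0n ?dot0l // !mulrS dotDl IH. Qed.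

Lemma dotMzl u v (k : int) : dot (u *~ k) v = dot u v *~ k.
Proof. by case: k => k; rewrite ?NegzE ?mulrNz ?dotNl -!pmulrn dotMnl. Qed.

Lemma dotMzr u v (k : int) : dot u (v *~ k) = dot u v *~ k.
Proof. by rewrite dotC dotMzl dotC. Qed.

Lemma dot_suml I (s : seq I) (P : pred I) (F : I -> 'rV[K]_n) v :
  dot (\sum_(i <- s | P i) F i) v = \sum_(i <- s | P i) dot (F i) v.
Proof. by apply: (big_morph (fun u => dot u v)) => [x y|]; rewrite ?dotDl ?dot0l. Qed.

End Dot.

Section DotReal.
Context {R : realType} {n : nat}.
Implicit Types (u v w : 'rV[R]_n) (c : R) (x : 'rV[R[i]]_n).

Lemma dot_ge0 u : 0 <= dot u u.
Proof. by apply: sumr_ge0 => i _; rewrite -expr2 sqr_ge0. Qed.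

Lemma dot_eq0 u : (dot u u == 0) = (u == 0).
Proof.
apply/eqP/eqP => [h|->]; last by rewrite dot0l.
apply/rowP => i; rewrite mxE; apply/eqP.
have := psumr_eq0P (fun j _ => eq_ind _ (fun y => 0 <= y) (sqr_ge0 (u 0 j)) _ (expr2 _)) h (i := i) isT.
by move=> /eqP; rewrite mulf_eq0 orbb.
Qed.

Lemma dot_gt0 u : (0 < dot u u) = (u != 0).
Proof. by rewrite lt_def dot_ge0 dot_eq0 andbT. Qed.

Lemma dot_sqr_lt u v : v != 0 -> (forall c, u != c *: v) -> dot u v ^+ 2 < dot u u * dot v v.
Proof.
(* The scalar is that of the orthogonal projection of [u] to the line of [v]; what remains of [u]
   has positive norm. *)
rewrite -dot_gt0 => vv /(_ (dot u v / dot v v)).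
rewrite -subr_eq0 -dot_gt0 !(dotBl, dotBr, dotZl, dotZr) (dotC v u) => h.
rewrite -subr_gt0; have := mulr_gt0 vv h; congr (_ < _).
by field; exact: lt0r_neq0.
Qed.

Lemma cplxD u v : cplx (u + v) = cplx u + cplx v.
Proof. by rewrite /cplx map_mxD. Qed.

Lemma cplxZ c u : cplx (c *: u) = c%:C *: cplx u.
Proof. by rewrite /cplx map_mxZ. Qed.

Lemma cplxN u : cplx (- u) = - cplx u.
Proof. by rewrite /cplx map_mxN. Qed.

Lemma cplxB u v : cplx (u - v) = cplx u - cplx v.
Proof. by rewrite /cplx map_mxB. Qed.

Lemma cplx0 : cplx 0 = 0 :> 'rV[R[i]]_n.
Proof. by rewrite /cplx map_mx0. Qed.

Lemma cplxMz u (k : int) : cplx (u *~ k) = cplx u *~ k.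
Proof.
have cplxMn k' : cplx (u *+ k') = cplx u *+ k'.
  by elim: k' => [|k' IH]; rewrite ?mulr0n ?cplx0 // !mulrS cplxD IH.
by case: k => k; rewrite ?NegzE ?mulrNz ?cplxN -!pmulrn cplxMn.
Qed.

Lemma dot_cplx u v : dot (cplx u) (cplx v) = (dot u v)%:C.
Proof. by rewrite rmorph_sum /=; apply: eq_bigr => i _; rewrite !mxE rmorphM. Qed.

Lemma large_nat (I : eqType) (L : seq I) (C d : I -> R) :
  exists N0 : nat, forall N : nat, (N0 <= N)%N ->
    forall l, l \in L -> 0 < d l -> C l < N%:R * d l.
Proof.
elim: L => [|l L [N0 IH]]; first by exists 0%N.
exists (maxn N0 (Num.bound (`|C l| / d l))) => N.
rewrite geq_max => /andP[N0N N1N] l'; rewrite inE => /orP[/eqP->|] dl.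
  have : `|C l| / d l < N%:R.
    apply: (lt_le_trans (archi_boundP _)); last by rewrite ler_nat.
    by rewrite divr_ge0 // ltW.
  by rewrite ltr_pdivrMr //; apply: le_lt_trans; exact: ler_norm.
exact: IH.
Qed.

(** For large [N] the vector [u] decides the sign wherever it is nonzero; in [generic_comb] the
    vector [v] takes over on the hyperplanes containing [u]. *)
Lemma large_comb (L : seq 'rV[R]_n) u v : exists N0 : nat, forall N : nat, (N0 <= N)%N ->
  forall l, l \in L -> 0 < dot l u -> 0 < dot l (N%:R *: u + v).
Proof.
have [N0 h] := large_nat L (fun l => - dot l v) (dot^~ u).
exists N0 => N N0N l lL lu; rewrite dotDr dotZr; have := h N N0N l lL lu; lra.
Qed.

Lemma generic_comb (L : seq 'rV[R]_n) u v : exists N0 : nat, forall N : nat, (N0 <= N)%N ->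
  forall l, l \in L -> dot l u != 0 \/ dot l v != 0 -> dot l (N%:R *: u + v) != 0.
Proof.
have [N0 h] := large_nat L (fun l => `|dot l v|) (fun l => `|dot l u|).
exists N0 => N N0N l lL; rewrite dotDr dotZr.
have [->|u0 _] := eqVneq (dot l u) 0; first by case=> //; rewrite mulr0 add0r.
have := h N N0N l lL; rewrite normr_gt0 => /(_ u0) lt; apply/eqP => /eqP.
rewrite addr_eq0 => /eqP eq; move: lt.
by rewrite -(normrN (dot l v)) -eq normrM normr_nat ltxx.
Qed.

End DotReal.

Lemma seq_argmax {R : realDomainType} (I : eqType) (s : seq I) (f : I -> R) x0 :
  x0 \in s -> exists2 x, x \in s & forall y, y \in s -> f y <= f x.
Proof.
elim: s x0 => // a s IH x0 _; case: s IH => [|b s] IH.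
  by exists a; rewrite ?mem_head // => y; rewrite inE => /eqP->.
have [x xs xmax] := IH b (mem_head _ _).
have [le|lt] := lerP (f a) (f x).
  exists x; first by rewrite inE xs orbT.
  by move=> y; rewrite inE => /orP[/eqP->|/xmax].
exists a; first exact: mem_head.
move=> y; rewrite inE => /orP[/eqP->//|/xmax h].
exact: le_trans h (ltW lt).
Qed.

(** * Reflections *)

Section Reflections.
Context {R : realType} {n : nat}.
Implicit Types (a b u v w : 'rV[R]_n) (c : R).

Lemma dot_checkv a v : dot (checkv a) v = 2 / dot a a * dot a v.
Proof. by rewrite /checkv dotZl. Qed.

Lemma dot_checkv_self a : a != 0 -> dot (checkv a) a = 2.
Proof. by rewrite -dot_gt0 dot_checkv => a0; rewrite divfK ?gt_eqF. Qed.

Lemma checkv_neq0 a : a != 0 -> checkv a != 0.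
Proof.
move=> a0; apply: contra_eqN (dot_checkv_self a0) => /eqP->.
by rewrite dot0l eq_sym pnatr_eq0.
Qed.

Lemma checkvN a : checkv (- a) = - checkv a.
Proof. by rewrite /checkv dotNl dotNr opprK scalerN. Qed.

Lemma checkvK a : checkv (checkv a) = a.
Proof.
have [->|a0] := eqVneq a 0; first by rewrite /checkv !scaler0.
have aa : dot a a != 0 by rewrite dot_eq0.
rewrite /checkv !(dotZl, dotZr) scalerA [X in X *: _](_ : _ = 1) ?scale1r //.
by field.
Qed.

Lemma dot_checkv_gt0 a v : a != 0 -> (0 < dot (checkv a) v) = (0 < dot a v).
Proof.
by rewrite -dot_gt0 => a0; rewrite dot_checkv pmulr_rgt0 // divr_gt0.
Qed.

Lemma dot_checkv_lt0 a v : a != 0 -> (dot (checkv a) v < 0) = (dot a v < 0).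
Proof.
move=> a0; have := dot_checkv_gt0 (- v) a0.
by rewrite !dotNr !oppr_gt0.
Qed.

Lemma dot_checkv_eq0 a v : a != 0 -> (dot (checkv a) v == 0) = (dot a v == 0).
Proof.
rewrite -dot_eq0 => a0; rewrite dot_checkv mulf_eq0.
by rewrite mulf_eq0 invr_eq0 (negbTE a0) pnatr_eq0.
Qed.

Lemma reflvE a v : reflv a v = v - dot a v *: checkv a.
Proof.
by rewrite /reflv /checkv dotZl scalerA mulrC.
Qed.

Lemma reflvD a u v : reflv a (u + v) = reflv a u + reflv a v.
Proof. by rewrite /reflv dotDr scalerDl opprD addrACA. Qed.

Lemma reflvZ a c v : reflv a (c *: v) = c *: reflv a v.
Proof. by rewrite /reflv dotZr scalerBr scalerA. Qed.

Lemma reflvN a v : reflv a (- v) = - reflv a v.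
Proof. by rewrite -scaleN1r reflvZ scaleN1r. Qed.

Lemma reflv_sum a I (s : seq I) (P : pred I) (F : I -> 'rV[R]_n) :
  reflv a (\sum_(i <- s | P i) F i) = \sum_(i <- s | P i) reflv a (F i).
Proof.
apply: (big_morph (reflv a)) => [u v|]; first exact: reflvD.
by rewrite -(scale0r 0) reflvZ !scale0r.
Qed.

Lemma reflv_self a : a != 0 -> reflv a a = - a.
Proof.
by move=> a0; rewrite /reflv dot_checkv_self // scaler_nat mulr2n opprD addrA subrr add0r.
Qed.

Lemma reflv_adj a u v : dot (reflv a u) v = dot u (reflv a v).
Proof.
rewrite reflvE /reflv dotBl dotBr dotZl dotZr (dotC u a).
by rewrite mulrC.
Qed.

Lemma reflvK a : a != 0 -> involutive (reflv a).
Proof.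
move=> a0 v; rewrite {1}/reflv -reflv_adj /reflv.
rewrite -/(reflv a (checkv a)) (_ : reflv a (checkv a) = - checkv a).
  by rewrite dotNl scaleNr opprK subrK.
by rewrite /checkv reflvZ reflv_self ?scalerN.
Qed.

Lemma reflv_iso a u v : a != 0 -> dot (reflv a u) (reflv a v) = dot u v.
Proof. by move=> a0; rewrite reflv_adj reflvK. Qed.

Lemma reflv_checkv a b : a != 0 -> reflv a (checkv b) = checkv (reflv a b).
Proof. by move=> a0; rewrite /checkv reflvZ reflv_iso. Qed.

End Reflections.

(** * Linear algebra of exponential sums *)

(** Linear independence of characters of the monoid [G], for families in which several indices may
    restrict to the same character: only the total coefficient of each class must vanish. *)
Lemma character_sums (Z : nmodType) (K : idomainType) (I : eqType) (G : set Z)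
    (s : seq I) (c : I -> K) (X : I -> Z -> K) :
  G 0 -> (forall y z, G y -> G z -> G (y + z)) ->
  (forall i, X i 0 = 1) -> (forall i y z, X i (y + z) = X i y * X i z) ->
  (forall z, G z -> \sum_(i <- s) c i * X i z = 0) ->
  forall j, \sum_(i <- s | `[< forall z, G z -> X i z = X j z >]) c i = 0.
Proof.
move=> G0 GD X0 XD; have [k] := ubnP (size s); elim: k s c => // k IH s c.
rewrite ltnS => szs h j; pose eqj i := `[< forall z, G z -> X i z = X j z >].
have [/allP all_eq|/allPn[i0 i0s /asboolP ne]] := boolP (all eqj s).
  rewrite big_seq_cond (eq_bigl (fun i => i \in s)); last first.
    by move=> i; case: (boolP (i \in s)) => //= /all_eq.
  rewrite -big_seq -[RHS](h 0 G0); apply: eq_bigr => i _.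
  by rewrite X0 mulr1.
have [z0 Gz0 ne0] : exists2 z, G z & X i0 z <> X j z.
  by apply: contrapT => no; apply: ne => z Gz; apply: contrapT => ?; apply: no; exists z.
(* The relation at [z0 + z] minus [X i0 z0] times the relation at [z] loses the index [i0], while
   the class of [j] is rescaled by the nonzero number [X j z0 - X i0 z0]. *)
pose c' i := c i * (X i z0 - X i0 z0).
pose s' := [seq i <- s | X i z0 != X i0 z0].
have c'0 (P : pred I) (F : I -> K) :
    \sum_(i <- s' | P i) c' i * F i = \sum_(i <- s | P i) c' i * F i.
  rewrite big_filter_cond [RHS](bigID (fun i => X i z0 == X i0 z0)) /= [X in X + _]big1 ?add0r.
    by apply: eq_bigl => i; rewrite andbC.
  by move=> i /andP[_ /eqP e]; rewrite /c' e subrr mulr0 mul0r.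
have szs' : (size s' < k)%N.
  apply: leq_trans szs; rewrite size_filter -(count_predC (fun i => X i z0 != X i0 z0) s).
  rewrite -[X in (X < _)%N]addn0 ltn_add2l -has_count.
  by apply/hasP; exists i0; rewrite //= eqxx.
have h' z : G z -> \sum_(i <- s') c' i * X i z = 0.
  move=> Gz; rewrite c'0.
  rewrite (eq_bigr (fun i => c i * X i (z0 + z) - X i0 z0 * (c i * X i z))); last first.
    by move=> i _; rewrite /c' XD; ring.
  by rewrite sumrB -mulr_sumr !h // ?mulr0 ?subr0 //; exact: GD.
have := IH s' c' szs' h' j.
rewrite (eq_bigr (fun i => c' i * 1)); last by move=> i _; rewrite mulr1.
rewrite c'0 (eq_bigr (fun i => c i * (X j z0 - X i0 z0))); last first.
  by move=> i /asboolP e; rewrite mulr1 /c' e.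
rewrite -mulr_suml => /eqP; rewrite mulf_eq0 subr_eq0 => /orP[/eqP //|/eqP e].
by case: ne0; rewrite e.
Qed.

(** The moments control the sum of [g i * P.[U i]] for every [P] of degree below [m]; the polynomial
    vanishing at all nodes but one isolates its coefficient. *)
Lemma vandermonde_sums (K : idomainType) (I : eqType) (s : seq I) (g U : I -> K) (m : nat) :
  uniq s -> {in s &, injective U} -> (size s <= m)%N ->
  (forall k, (k < m)%N -> \sum_(i <- s) g i * U i ^+ k = 0) ->
  forall i, i \in s -> g i = 0.
Proof.
move=> us injU szs h i i_s; pose P := \prod_(j <- rem i s) ('X - (U j)%:P).
have szP : (size P <= m)%N.
  rewrite size_prod_XsubC size_rem //; apply: leq_trans szs.
  by case: (s) i_s.
have : \sum_(j <- s) g j * P.[U j] = 0.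
  rewrite (eq_bigr (fun j => \sum_(k < size P) P`_k * (g j * U j ^+ k))); last first.
    by move=> j _; rewrite horner_coef mulr_sumr; apply: eq_bigr => k _; ring.
  rewrite exchange_big big1 //= => k _; rewrite -mulr_sumr h ?mulr0 //.
  exact: leq_trans (ltn_ord k) szP.
rewrite (big_rem i) //= [X in _ + X]big_seq big1 ?addr0.
  move/eqP; rewrite mulf_eq0 => /orP[/eqP //|].
  rewrite horner_prod prodf_seq_eq0 => /hasP[j]; rewrite mem_rem_uniq // inE.
  move=> /andP[ji js]; rewrite /= hornerXsubC subr_eq0 => /eqP e.
  by move: ji; rewrite (injU j i) ?eqxx.
move=> j js; rewrite horner_prod (big_rem j) //= hornerXsubC subrr mul0r mulr0 //.
Qed.

(** The difference [u^l - u^-l] is [u - u^-1] times a Chebyshev polynomial of degree [l - 1] in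
    [u + u^-1], so antisymmetric equations are moment equations in the nodes [u + u^-1]. *)
Lemma symmetric_sums (K : fieldType) (I : eqType) (s : seq I) (c u : I -> K) (m : nat) :
  (forall i, u i != 0) ->
  (forall l, (1 <= l <= m)%N -> \sum_(i <- s) c i * (u i ^+ l - u i ^- l) = 0) ->
  forall k, (k < m)%N -> \sum_(i <- s) (c i * (u i - (u i)^-1)) * (u i + (u i)^-1) ^+ k = 0.
Proof.
move=> u0 h.
have main k : forall l, (l + k <= m)%N ->
    \sum_(i <- s) c i * (u i ^+ l - u i ^- l) * (u i + (u i)^-1) ^+ k = 0.
  elim: k => [|k IH] l lk.
    case: l lk => [|l] lk; first by rewrite big1 // => i _; rewrite expr0 invr1 subrr mulr0 mul0r.
    rewrite addn0 in lk; under eq_bigr do rewrite expr0 mulr1.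
    exact: h.
  case: l lk => [|l] lk; first by rewrite big1 // => i _; rewrite expr0 invr1 subrr mulr0 mul0r.
  rewrite (eq_bigr (fun i => c i * (u i ^+ l.+2 - u i ^- l.+2) * (u i + (u i)^-1) ^+ k
      + c i * (u i ^+ l - u i ^- l) * (u i + (u i)^-1) ^+ k)); last first.
    move=> i _; rewrite !exprS; field; rewrite ?expf_neq0 ?u0 //.
  rewrite big_split /= !IH ?addr0 //; by move: lk; clear; lia.
move=> k km; rewrite -[RHS](main k 1%N) //; exact: eq_bigr.
Qed.

Lemma big_support (V : nmodType) (I : eqType) (P : pred I) (B B' : seq I) (F : I -> V) :
  uniq B -> uniq B' -> (forall i, F i != 0 -> i \in B) -> (forall i, F i != 0 -> i \in B') ->
  \sum_(i <- B | P i) F i = \sum_(i <- B' | P i) F i.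
Proof.
move=> uB uB' hB hB'.
have restr C : \sum_(i <- C | P i) F i = \sum_(i <- [seq i <- C | F i != 0] | P i) F i.
  rewrite big_filter_cond [LHS](bigID (fun i => F i == 0)) /= big1 ?add0r.
    by apply: eq_bigl => i; rewrite andbC.
  by move=> i /andP[_ /eqP].
rewrite restr [RHS]restr; apply: perm_big; apply: uniq_perm; rewrite ?filter_uniq //.
by move=> i; rewrite !mem_filter; case: eqVneq => //= /[dup] /hB -> /hB' ->.
Qed.

(** With one node more than equations, [g i] is inversely proportional to the product of the
    [U i - U l]. The test polynomial vanishes at all nodes except [i] and [j]; without division the
    statement also covers coinciding nodes. *)
Lemma divided_differences (K : idomainType) (I : eqType) (s : seq I) (g U : I -> K) (m : nat) :
  uniq s -> (size s <= m.+1)%N ->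
  (forall k, (k < m)%N -> \sum_(i <- s) g i * U i ^+ k = 0) ->
  forall i j, i \in s -> j \in s ->
  g i * \prod_(l <- s | l != i) (U i - U l) = g j * \prod_(l <- s | l != j) (U j - U l).
Proof.
move=> us szs h i j i_s js; have [->//|ij] := eqVneq i j.
pose r := rem j (rem i s).
have jr : j \in rem i s by rewrite mem_rem_uniq // inE eq_sym ij js.
have pr : perm_eq s (i :: j :: r).
  by apply: (perm_trans (perm_to_rem i_s)); rewrite perm_cons perm_to_rem.
have := perm_uniq pr; rewrite us /= inE (negbTE ij) /= => /esym/and3P[ir jr' ur].
pose P := \prod_(l <- r) ('X - (U l)%:P).
have szP : (size P <= m)%N.
  rewrite size_prod_XsubC; move: szs; rewrite (perm_size pr) /=.
  by rewrite ltnS.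
have E : \sum_(l <- s) g l * P.[U l] = 0.
  rewrite (eq_bigr (fun l => \sum_(k < size P) P`_k * (g l * U l ^+ k))); last first.
    by move=> l _; rewrite horner_coef mulr_sumr; apply: eq_bigr => k _; ring.
  rewrite exchange_big big1 //= => k _; rewrite -mulr_sumr h ?mulr0 //.
  exact: leq_trans (ltn_ord k) szP.
have PE l : P.[U l] = \prod_(k <- r) (U l - U k).
  by rewrite horner_prod; apply: eq_bigr => k _; rewrite hornerXsubC.
have rest : \sum_(l <- r) g l * P.[U l] = 0.
  rewrite big_seq big1 // => l lr; rewrite PE (big_rem l) //= subrr mul0r mulr0 //.
move: E; rewrite (perm_big _ pr) /= big_cons big_cons rest addr0.
move=> /eqP; rewrite addr_eq0 => /eqP E.
have noti k : k \notin r -> forall F : I -> K,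
    \prod_(l <- r | l != k) F l = \prod_(l <- r) F l.
  move=> kr F; rewrite big_seq_cond [RHS]big_seq; apply: eq_bigl => l.
  by case: (boolP (l \in r)) => //= lr; apply: contraNneq kr => <-.
have prE k l : k != l -> perm_eq s (k :: l :: r) -> k \notin r ->
    \prod_(h <- s | h != k) (U k - U h) = (U k - U l) * P.[U k].
  by move=> kl p kr; rewrite (perm_big _ p) !big_cons eqxx /= eq_sym kl noti // PE.
rewrite (prE i j) // (prE j i) //; first by rewrite mulrCA E; ring.
  by rewrite eq_sym.
by apply: (perm_trans pr); rewrite (perm_catCA [:: i] [:: j] r).
Qed.

Lemma prod_skip (K : comPzRingType) (m j : nat) (f : nat -> K) : (j <= m)%N ->
  \prod_(i <- iota 0 m.+1 | i != j) f i =
  (\prod_(i < j) f i) * \prod_(i < m - j) f (j.+1 + i)%N.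
Proof.
move=> jm; rewrite (_ : iota 0 m.+1 = iota 0 j ++ j :: iota j.+1 (m - j)); last first.
  by rewrite -{2}(add0n j) -[j :: _]/(iota j (m - j).+1) -iotaD addnS subnKC.
rewrite big_cat big_cons eqxx /=; congr (_ * _).
  rewrite -(big_mkord xpredT) /index_iota subn0 big_seq_cond [RHS]big_seq.
  by apply: eq_bigl => i; rewrite mem_iota add0n; case: ltngtP.
rewrite -(big_mkord xpredT (fun i => f (j.+1 + i)%N)) /index_iota subn0.
rewrite -[X in iota X _]addn0 iotaDl big_map big_mkcond big_seq [RHS]big_seq.
apply: eq_bigr => i _; rewrite ifT // addSn -addnS; apply/eqP; clear; lia.
Qed.

Lemma pairing_bound {R : realType} {n : nat} (C D : seq 'rV[R]_n) : exists K : nat,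
  forall l b, l \in C -> b \in D -> `|dot l b| <= K%:R.
Proof.
pose F (p : 'rV[R]_n * 'rV[R]_n) := Num.bound `|dot p.1 p.2|.
exists (\max_(p <- [seq (l, b) | l <- C, b <- D]) F p) => l b lC bD.
have h : (l, b) \in [seq (l, b) | l <- C, b <- D] by exact: allpairs_f.
have := @leq_bigmax_seq _ [seq (l, b) | l <- C, b <- D] xpredT F (l, b) h isT.
rewrite -(ler_nat R); apply: le_trans; apply: ltW.
by apply: archi_boundP; rewrite normr_ge0.
Qed.

Section BakerAkhiezerFunction.
Context {R : realType}.
Variables (q lq : R[i]).
Hypothesis q_nonroot : forall k : nat, (0 < k)%N -> q ^+ k != 1.
Hypothesis lq_log : expC lq = q.
Local Notation e := (qpow lq).
Local Notation br := (qbr lq).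

(** * Powers of q and quantum numbers *)

Section QuantumNumbers.
Implicit Types (a b t : R[i]) (k j : int).

Lemma qpowD a b : e (a + b) = e a * e b.
Proof. by rewrite /qpow mulrDl expCD. Qed.

Lemma qpow0 : e 0 = 1.
Proof. by rewrite /qpow mul0r expC0. Qed.

Lemma qpow_neq0 a : e a != 0.
Proof.
apply/eqP => ea0; have := qpowD a (- a).
by rewrite subrr qpow0 ea0 mul0r => /eqP; rewrite oner_eq0.
Qed.

Lemma qpowN a : e (- a) = (e a)^-1.
Proof.
by apply: (mulfI (qpow_neq0 a)); rewrite -qpowD subrr qpow0 divff ?qpow_neq0.
Qed.

Lemma qpowB a b : e (a - b) = e a / e b.
Proof. by rewrite qpowD qpowN. Qed.

Lemma qpowMn a n : e (a *+ n) = e a ^+ n.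
Proof. by elim: n => [|n IH]; rewrite ?mulr0n ?qpow0 // mulrS qpowD IH exprS. Qed.

Lemma qpowMz a k : e (a *~ k) = e a ^ k.
Proof.
by case: k => n; rewrite ?NegzE ?mulrNz -pmulrn ?qpowN qpowMn // exprnN.
Qed.

Lemma qpow1 : e 1 = q.
Proof. by rewrite /qpow mul1r. Qed.

Lemma qpow_int k : e k%:~R = q ^ k.
Proof. by rewrite qpowMz qpow1. Qed.

Lemma qpow_int_eq1 k : e k%:~R = 1 -> k = 0.
Proof.
rewrite qpow_int; case: k => [[|n]|n] //.
  by move=> h; have := q_nonroot (ltn0Sn n); rewrite -exprnP in h; rewrite h eqxx.
rewrite NegzE -exprnN => h; have := q_nonroot (ltn0Sn n).
by rewrite -[q ^+ n.+1]invrK h invr1 eqxx.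
Qed.

Lemma qpow_int_inj k j : e k%:~R = e j%:~R -> k = j.
Proof.
move=> h; apply/eqP; rewrite -subr_eq0; apply/eqP/qpow_int_eq1.
by rewrite rmorphB /= qpowB h divff ?qpow_neq0.
Qed.

Lemma lq_neq0 : lq != 0.
Proof.
apply: contraT; rewrite negbK => /eqP lq0; have := q_nonroot (ltn0Sn 0).
by rewrite expr1 -lq_log lq0 expC0 eqxx.
Qed.

Lemma qpow_surj t : t != 0 -> exists a, e a = t.
Proof.
move=> /expC_surj[a <-]; exists (a / lq).
by rewrite /qpow divfK ?lq_neq0.
Qed.

Lemma qpow_half_period : exists a, e a = -1.
Proof. by exists ((0 +i* (pi : R)) / lq); rewrite /qpow divfK ?lq_neq0 ?expC_ipi. Qed.

Lemma qbr_eq0 a : (br a == 0) = (e (2 * a) == 1).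
Proof.
rewrite /qbr subr_eq0 qpowN -(inj_eq (mulIf (qpow_neq0 a))) mulVf ?qpow_neq0 //.
by rewrite -qpowD mulr_natl mulr2n.
Qed.

Lemma qbrN a : br (- a) = - br a.
Proof. by rewrite /qbr opprK opprB. Qed.

Lemma qbr_int_neq0 k : k != 0 -> br k%:~R != 0.
Proof.
move=> k0; rewrite qbr_eq0; apply/eqP.
rewrite (_ : 2 * _ = (2 * k)%:~R); last by rewrite rmorphM.
move/qpow_int_eq1 => h; move: k0 h; clear; lia.
Qed.

End QuantumNumbers.

(** * The rank one Baker-Akhiezer function *)

Section QuantumFactorials.
Implicit Types (a b : R[i]).

Definition qrising b (k : nat) : R[i] := \prod_(i < k) br (b + i%:R).

Definition qfact (k : nat) : R[i] := \prod_(i < k) br i.+1%:R.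

Lemma qrisingD b k l : qrising b (k + l) = qrising b k * qrising (b + k%:R) l.
Proof.
rewrite /qrising big_split_ord /=; congr (_ * _).
by apply: eq_bigr => i _; rewrite natrD addrA.
Qed.

Lemma qrising_neg k l : (l <= k)%N ->
  qrising (- k%:R) l * qfact (k - l) = (-1) ^+ l * qfact k.
Proof.
elim: l => [|l IH] lk; first by rewrite /qrising big_ord0 subn0 expr0.
rewrite /qrising big_ord_recr /= -/(qrising _ _) exprS -[RHS]mulrA -IH; last exact: ltnW.
have -> : qfact (k - l) = qfact (k - l.+1) * br (k - l)%:R.
  by rewrite -(subnSK lk) /qfact big_ord_recr.
have -> : br (- k%:R + l%:R) = - br (k - l)%:R.
  by rewrite -qbrN natrB 1?ltnW // opprB addrC.
ring.
Qed.

Lemma qfact_neq0 k : qfact k != 0.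
Proof.
apply/prodf_neq0 => i _; exact: (qbr_int_neq0 (k := i.+1%:Z) isT).
Qed.

Lemma qbr_sum_inv a b : (e a + (e a)^-1) - (e b + (e b)^-1) = br ((a + b) / 2) * br ((a - b) / 2).
Proof.
have -> : e a = e ((a + b) / 2) * e ((a - b) / 2) by rewrite -qpowD; congr (e _); by field.
have -> : e b = e ((a + b) / 2) / e ((a - b) / 2) by rewrite -qpowB; congr (e _); by field.
have := qpow_neq0 ((a + b) / 2); have := qpow_neq0 ((a - b) / 2).
rewrite /qbr !qpowN; move: (e _) (e _) => y z y0 z0; field.
by rewrite y0 z0.
Qed.

Variable m : nat.

(* The coefficient psi_(rho^vee - j a^vee) for the root system {a, -a}, as a function of (a,x) *)
Definition rank1 (j : nat) (a : R[i]) : R[i] :=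
  (-1) ^+ (m + j) * (qfact m / (qfact j * qfact (m - j))) *
  qrising (a - m%:R) (m - j) * qrising (a + (m - j)%:R + 1) j.

Lemma rank1_0 a : rank1 0 a = \prod_(1 <= j < m.+1) br (j%:R - a).
Proof.
rewrite /rank1 addn0 subn0 {2}/qfact big_ord0 mul1r divff ?qfact_neq0 // mulr1.
rewrite [qrising _ 0]/qrising big_ord0 mulr1 big_add1 /= big_mkord.
rewrite (reindex_inj rev_ord_inj) /= /qrising.
have -> : (-1) ^+ m = \prod_(i < m) (-1) :> R[i] by rewrite prodr_const card_ord.
rewrite -big_split /=; apply: eq_bigr => i _.
rewrite mulN1r -qbrN subnSK //; congr (br _).
by rewrite natrB 1?ltnW //; ring.
Qed.

Lemma rank1_m a : rank1 m a = \prod_(1 <= j < m.+1) br (j%:R + a).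
Proof.
rewrite /rank1 subnn {3}/qfact big_ord0 mulr1 divff ?qfact_neq0 // mulr1.
rewrite [qrising _ 0]/qrising big_ord0 mulr1 addnn -signr_odd odd_double mul1r.
rewrite big_add1 /= big_mkord addr0; apply: eq_bigr => i _.
by rewrite -natr1; congr (br _); ring.
Qed.

(** On a full string of [m + 1] weights the [m] equations fix the coefficients up to scale by
    [divided_differences]. The differences of the nodes factor into brackets by [qbr_sum_inv], which
    is the origin of the closed formula [rank1]. *)
Lemma rank1_solution (d : nat -> R[i]) (a r : R[i]) :
  (forall k : int, `|k| <= m%:Z -> br (a + k%:~R) != 0) ->
  (forall s, (1 <= s <= m)%N ->
     \sum_(j <- iota 0 m.+1) d j * br (s%:R * (a + m%:R - 2 * j%:R)) = 0) ->
  d 0%N = rank1 0 a * r -> forall j, (j <= m)%N -> d j = rank1 j a * r.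
Proof.
move=> nd h d0 j jm; pose u j := e (a + m%:R - 2 * j%:R).
have n0 := qfact_neq0.
have hu s : (1 <= s <= m)%N -> \sum_(j <- iota 0 m.+1) d j * (u j ^+ s - u j ^- s) = 0.
  move=> /h E; rewrite -[RHS]E; apply: eq_bigr => i _; congr (_ * _).
  by rewrite /u -qpowMn -qpowN /qbr (mulr_natl _ s).
have := divided_differences (iota_uniq 0 m.+1) _ (symmetric_sums (fun i => qpow_neq0 _) hu).
rewrite size_iota => /(_ (leqnn _) 0%N j); rewrite !mem_iota !add0n !leq0n !ltnS jm leq0n => /(_ isT isT).
have U i l : u i + (u i)^-1 - (u l + (u l)^-1) = br (a + m%:R - i%:R - l%:R) * br (l%:R - i%:R).
  by rewrite qbr_sum_inv; congr (br _ * br _); field.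
have gE i : u i - (u i)^-1 = br (a + m%:R - i%:R - i%:R).
  by rewrite /u -qpowN -/(br _); congr br; ring.
(* The factor [u i - (u i)^-1] supplies the omitted index [l = i] of the first family of brackets,
   so [m + 1] consecutive brackets appear. *)
have side i : (i <= m)%N ->
   (u i - (u i)^-1) * \prod_(l <- iota 0 m.+1 | l != i) (u i + (u i)^-1 - (u l + (u l)^-1)) =
   qrising (a - i%:R) m.+1 * ((-1) ^+ i * qfact i * qfact (m - i)).
  move=> im; rewrite gE (eq_bigr _ (fun l _ => U i l)) big_split /= mulrA; congr (_ * _).
    pose F l := br (a + m%:R - i%:R - l%:R).
    have full : \prod_(l <- iota 0 m.+1) F l = F i * \prod_(l <- iota 0 m.+1 | l != i) F l.
      by rewrite (bigD1_seq i) ?mem_iota ?iota_uniq ?add0n ?ltnS.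
    rewrite -/(F i) -full.
    rewrite -[iota 0 m.+1]/(index_iota 0 m.+1) big_mkord /F (reindex_inj rev_ord_inj) /=.
    apply: eq_bigr => l _; congr br; rewrite subSS natrB; first by ring.
    by rewrite -ltnS.
  rewrite prod_skip //; congr (_ * _).
    have := qrising_neg (leqnn i); rewrite subnn {1}/qfact big_ord0 mulr1 => <-.
    by apply: eq_bigr => l _; rewrite addrC.
  apply: eq_bigr => l _; congr br; rewrite addSn -addnS natrD; ring.
(* Both sides are the product of [br (a + k)] over [-m <= k <= m], cut at different places. *)
have key : qrising (a - m%:R) m * qrising a m.+1 =
    qrising (a - m%:R) (m - j) * qrising (a - j%:R) m.+1 * qrising (a + (m - j)%:R + 1) j.
  have -> : qrising a m.+1 = qrising (a - m%:R + m%:R) m.+1 by rewrite subrK.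
  rewrite -qrisingD.
  have -> : (m + m.+1 = (m - j) + m.+1 + j)%N by move: jm; clear; lia.
  rewrite !qrisingD; congr (_ * qrising _ _ * qrising _ _).
    by rewrite natrB //; ring.
  by rewrite natrD natrB // -natr1; ring.
have nz : qrising (a - j%:R) m.+1 != 0.
  apply/prodf_neq0 => i _; rewrite -addrA -[_ + i%:R](_ : (i%:Z - j%:Z)%:~R = _).
    by apply: nd; have := ltn_ord i; move: jm; clear; lia.
  by rewrite intrB addrC.
have U0 : qfact 0 = 1 by rewrite /qfact big_ord0.
rewrite -!mulrA !mulrA in side *.
move=> E.
have {}E : d 0%N * ((u 0%N - (u 0%N)^-1) *
      \prod_(l <- iota 0 m.+1 | l != 0%N) (u 0%N + (u 0%N)^-1 - (u l + (u l)^-1))) =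
    d j * ((u j - (u j)^-1) * \prod_(l <- iota 0 m.+1 | l != j) (u j + (u j)^-1 - (u l + (u l)^-1))).
  by rewrite !mulrA.
rewrite !side // d0 in E; move: E; rewrite subr0 subn0 U0 expr0 !mul1r.
rewrite {1}/rank1 addn0 subn0 U0 [qrising _ 0]/qrising big_ord0 mul1r mulr1 divff ?n0 // mulr1.
move=> E; have {}E : (-1) ^+ m * r * qfact m * (qrising (a - m%:R) m * qrising a m.+1) =
    d j * (qrising (a - j%:R) m.+1 * ((-1) ^+ j * qfact j * qfact (m - j))).
  by rewrite -E; ring.
rewrite key in E.
have sj : (-1) ^+ j * (-1) ^+ j = 1 :> R[i] by rewrite -expr2 sqrr_sign.
have j0 : (-1) ^+ j != 0 :> R[i] by rewrite signr_eq0.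
apply: (mulIf nz); apply: (mulIf (n0 j)); apply: (mulIf (n0 (m - j)%N)); apply: (mulIf j0).
transitivity (d j * (qrising (a - j%:R) m.+1 * ((-1) ^+ j * qfact j * qfact (m - j)))).
  by ring.
rewrite -E /rank1 exprD.
transitivity ((-1) ^+ m * r * qfact m * (qrising (a - m%:R) (m - j) *
  qrising (a - j%:R) m.+1 * qrising (a + (m - j)%:R + 1) j) * ((-1) ^+ j * (-1) ^+ j)).
  by rewrite sj mulr1.
by field; rewrite !n0.
Qed.

End QuantumFactorials.

(** * Laurent polynomials in w = q^t *)

Section LaurentFunctions.
Implicit Types (a b c t : R[i]).

Definition laurent (f : R[i] -> R[i]) : Prop :=
  exists (N : nat) (P : {poly R[i]}), forall t, e t ^+ N * f t = P.[e t].

Lemma laurent_const c : laurent (fun=> c).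
Proof. by exists 0%N, c%:P => t; rewrite hornerC mul1r. Qed.

Lemma laurent_exp (k : int) : laurent (fun t => e (t *~ k)).
Proof.
case: k => k.
  by exists 0%N, 'X^k => t; rewrite hornerXn mul1r -pmulrn qpowMn.
exists k.+1, 1 => t; rewrite hornerC NegzE mulrNz -pmulrn qpowN qpowMn divff //.
by rewrite expf_neq0 ?qpow_neq0.
Qed.

Lemma laurentD f g : laurent f -> laurent g -> laurent (fun t => f t + g t).
Proof.
move=> [N [P hP]] [M [Q hQ]]; exists (N + M)%N, ('X^M * P + 'X^N * Q) => t.
by rewrite !(hornerD, hornerM, hornerXn) -hP -hQ exprD; ring.
Qed.

Lemma laurentM f g : laurent f -> laurent g -> laurent (fun t => f t * g t).
Proof.
move=> [N [P hP]] [M [Q hQ]]; exists (N + M)%N, (P * Q) => t.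
by rewrite hornerM -hP -hQ exprD mulrACA.
Qed.

(** Since [q] is not a root of unity, integral [t] already give infinitely many values of [q^t]. *)
Lemma poly_qpow_eq0 (P : {poly R[i]}) : (forall t, P.[e t] = 0) -> P = 0.
Proof.
move=> h; apply/eqP; apply: contraT => P0.
pose s := [seq e k%:~R | k <- map Posz (iota 0 (size P))].
have us : uniq s.
  rewrite !map_inj_uniq ?iota_uniq //; first by move=> ? ? [].
  by move=> k j /qpow_int_inj.
have := max_poly_roots P0 _ us; rewrite !size_map size_iota ltnn; apply.
by apply/allP => _ /mapP[k _ ->]; apply/rootP.
Qed.

Lemma poly_qpow_neq0 (P : {poly R[i]}) : P != 0 -> exists t, P.[e t] != 0.
Proof.
move=> P0; apply: contrapT => no; move/eqP: P0; apply; apply: poly_qpow_eq0 => t.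
by apply/eqP; apply: contrapT => /negP h; apply: no; exists t.
Qed.

Lemma laurent_ext f g : f =1 g -> laurent f -> laurent g.
Proof. by move=> /funext ->. Qed.

Lemma laurent_poly (P : {poly R[i]}) : laurent (fun t => P.[e t]).
Proof. by exists 0%N, P => t; rewrite mul1r. Qed.

Lemma laurent_sum (I : eqType) (s : seq I) (Q : pred I) (f : I -> R[i] -> R[i]) :
  (forall i, i \in s -> laurent (f i)) -> laurent (fun t => \sum_(i <- s | Q i) f i t).
Proof.
elim: s => [|i s IH] h.
  by have := laurent_const 0; apply: laurent_ext => t; rewrite big_nil.
have hs : laurent (fun t => \sum_(j <- s | Q j) f j t).
  by apply: IH => j js; apply: h; rewrite inE js orbT.
apply: (@laurent_ext (fun t => (if Q i then f i t else 0) + \sum_(j <- s | Q j) f j t)).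
  by move=> t; rewrite big_cons; case: ifP; rewrite ?add0r.
apply: laurentD => //; case: (Q i); last exact: laurent_const.
by apply: h; rewrite mem_head.
Qed.

Lemma laurent_qbr a (k : int) : laurent (fun t => qbr lq (a + t *~ k)).
Proof.
have := laurentD (laurentM (laurent_const (e a)) (laurent_exp k))
  (laurentM (laurent_const (- e (- a))) (laurent_exp (- k))).
apply: laurent_ext => t.
by rewrite /qbr opprD mulrNz !qpowD; ring.
Qed.

(** Used to continue identities to the exceptional points of a line. *)
Lemma laurent_eq0 f (E : {poly R[i]}) : laurent f -> E != 0 ->
  (forall t, E.[e t] != 0 -> f t = 0) -> forall t, f t = 0.
Proof.
move=> [N [P fP]] E0 h t; have : P * E = 0.
  apply: poly_qpow_eq0 => s; rewrite hornerM -fP.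
  have [->|Es] := eqVneq E.[e s] 0; first by rewrite mulr0.
  by rewrite h // mulr0 mul0r.
move/eqP; rewrite mulf_eq0 (negbTE E0) orbF => /eqP P0.
have := fP t; rewrite P0 horner0 => /eqP; rewrite mulf_eq0 expf_eq0.
by rewrite (negbTE (qpow_neq0 _)) andbF => /eqP.
Qed.

Lemma laurent_family (I : eqType) (s : seq I) (f : I -> R[i] -> R[i]) :
  (forall i, i \in s -> laurent (f i)) -> exists (N : nat) (P : I -> {poly R[i]}),
  forall i t, i \in s -> e t ^+ N * f i t = (P i).[e t].
Proof.
elim: s => [|i s IH] h; first by exists 0%N, (fun=> 0).
have [N [P hP]] := IH (fun j js => h j (@mem_behead _ (i :: s) j js)).
have [M [Q hQ]] := h i (mem_head _ _).
exists (N + M)%N, (fun j => if j == i then 'X^N * Q else 'X^M * P j) => j t.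
rewrite inE; case: eqVneq => [->|_] /= js; rewrite hornerM hornerXn.
  by rewrite -hQ exprD mulrA.
by rewrite -hP // exprD mulrA (mulrC (e t ^+ M)).
Qed.

Lemma poly_generic_eq0 (P D : {poly R[i]}) : D != 0 ->
  (forall t, D.[e t] != 0 -> P.[e t] = 0) -> P = 0.
Proof. by move=> D0 h; apply: poly_qpow_eq0; apply: laurent_eq0 h => //; exact: laurent_poly. Qed.

(* The function f, read in w = q^t, has a pole of exact order k at w = 0. *)
Definition polar (k : nat) (f : R[i] -> R[i]) : Prop :=
  exists2 T : {poly R[i]}, T.[0] != 0 & forall t, e t ^+ k * f t = T.[e t].

Lemma polarM k j f g : polar k f -> polar j g -> polar (k + j) (fun t => f t * g t).
Proof.
move=> [T T0 fT] [U U0 gU]; exists (T * U) => [|t]; first by rewrite hornerM mulf_neq0.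
by rewrite hornerM -fT -gU exprD mulrACA.
Qed.

Lemma polar_prod (I : eqType) (s : seq I) (Q : pred I) (k : I -> nat) (f : I -> R[i] -> R[i]) :
  (forall i, i \in s -> Q i -> polar (k i) (f i)) ->
  polar (\sum_(i <- s | Q i) k i) (fun t => \prod_(i <- s | Q i) f i t).
Proof.
elim: s => [|i s IH] h.
  by exists 1 => [|t]; rewrite ?hornerC ?oner_neq0 // !big_nil mulr1.
have hs : polar (\sum_(j <- s | Q j) k j) (fun t => \prod_(j <- s | Q j) f j t).
  by apply: IH => j js; apply: h; rewrite inE js orbT.
have := h i (mem_head _ _); case Qi : (Q i) => hi.
  rewrite big_cons Qi (_ : (fun t => _) = fun t => f i t * \prod_(j <- s | Q j) f j t).
    by apply: polarM => //; exact: hi.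
  by apply/funext => t; rewrite big_cons Qi.
rewrite big_cons Qi (_ : (fun t => _) = fun t => \prod_(j <- s | Q j) f j t) //.
by apply/funext => t; rewrite big_cons Qi.
Qed.

Lemma polar_qbr a (k : nat) : (0 < k)%N -> polar k (fun t => qbr lq (a - t *~ k)).
Proof.
move=> k0; exists ((e a)%:P - (e (- a))%:P * 'X^(k + k)) => [|t].
  by rewrite !(hornerD, hornerN, hornerM, hornerC, hornerXn) expr0n addn_eq0 eqn0Ngt k0 mulr0
    subr0 qpow_neq0.
rewrite !(hornerD, hornerN, hornerM, hornerC, hornerXn) /qbr opprB.
rewrite qpowB (_ : t *~ k - a = - a + t *+ k); last by rewrite addrC -pmulrn.
rewrite qpowD -pmulrn qpowMn exprD; field.
by rewrite expf_neq0 ?qpow_neq0.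
Qed.

End LaurentFunctions.

Context {n : nat}.
Variable Phi : {fset 'rV[R]_n}.
Hypothesis Phi_root : root_system Phi.
Hypothesis Phi_red : reduced Phi.
Variable m : 'rV[R]_n -> nat.
Hypothesis m_inv : W_invariant Phi m.
Local Notation pr l x := (dot (cplx l) x).
Local Notation trig_poly := (trig_poly lq Phi).
Local Notation trig_rational := (trig_rational lq Phi).
Local Notation generically := (generically lq Phi).
Local Notation difference_operator := (difference_operator lq Phi).

(** * Root systems and chambers *)

Section RootSystem.
Implicit Types (a b u v w : 'rV[R]_n) (c : R).

Lemma root_nz a : a \in Phi -> a != 0.
Proof. by move=> aP; apply: contraNneq (root_neq0 Phi_root) => <-. Qed.

Lemma rootN a : a \in Phi -> - a \in Phi.
Proof.
by move=> aP; rewrite -(reflv_self (root_nz aP)); exact: (root_refl Phi_root).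
Qed.

Lemma root_reflE a b : a \in Phi -> (reflv a b \in Phi) = (b \in Phi).
Proof.
move=> aP; apply/idP/idP => [h|]; last exact: (root_refl Phi_root).
by rewrite -(reflvK (root_nz aP) b); exact: (root_refl Phi_root).
Qed.

Lemma root_pairing a b : a \in Phi -> b \in Phi ->
  exists k : int, dot (checkv a) b = k%:~R.
Proof. by move=> aP bP; apply/intrP; exact: (root_int Phi_root). Qed.

Lemma root_separates v : (forall a, a \in Phi -> dot a v = 0) -> v = 0.
Proof.
move=> h; apply/eqP; rewrite -dot_eq0; apply/eqP.
have [c {1}->] := root_span Phi_root v.
rewrite dot_suml big_seq big1 // => a aP.
by rewrite dotZl h ?mulr0.
Qed.

(** Sums without signs suffice because the roots are closed under negation; lists with repetition
    are what [coroot_decomposition] shortens. *)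
Definition coroot_lattice v : Prop :=
  exists2 s : seq 'rV[R]_n, {subset s <= Phi} & v = \sum_(a <- s) checkv a.

Lemma coroot_lattice_root a : a \in Phi -> coroot_lattice (checkv a).
Proof.
by move=> aP; exists [:: a]; rewrite ?big_seq1 // => b; rewrite inE => /eqP->.
Qed.

Lemma coroot_lattice0 : coroot_lattice 0.
Proof. by exists [::]; rewrite ?big_nil. Qed.

Lemma coroot_latticeD u v : coroot_lattice u -> coroot_lattice v -> coroot_lattice (u + v).
Proof.
move=> [s sP ->] [t tP ->]; exists (s ++ t); rewrite ?big_cat // => a.
by rewrite mem_cat => /orP[/sP|/tP].
Qed.

Lemma coroot_latticeN u : coroot_lattice u -> coroot_lattice (- u).
Proof.
move=> [s sP ->]; exists (map -%R s).
  by move=> a /mapP[b /sP bP ->]; exact: rootN.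
by rewrite big_map -sumrN; apply: eq_bigr => a _; rewrite checkvN.
Qed.

Lemma coroot_latticeB u v : coroot_lattice u -> coroot_lattice v -> coroot_lattice (u - v).
Proof. by move=> hu /coroot_latticeN; exact: coroot_latticeD. Qed.

Lemma coroot_latticeMz u (k : int) : coroot_lattice u -> coroot_lattice (u *~ k).
Proof.
move=> hu; have hn j : coroot_lattice (u *+ j).
  by elim: j => [|j IH]; rewrite ?mulr0n ?mulrS; [exact: coroot_lattice0|exact: coroot_latticeD].
case: k => k; first by rewrite -pmulrn.
by rewrite NegzE mulrNz -pmulrn; exact: coroot_latticeN.
Qed.

Lemma coweight_pairing v a : coweight Phi v -> a \in Phi -> exists k : int, dot v a = k%:~R.
Proof. by move=> /(_ a) h aP; apply/intrP; exact: h. Qed.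

Lemma coweightD u v : coweight Phi u -> coweight Phi v -> coweight Phi (u + v).
Proof. by move=> hu hv a aP; rewrite dotDl rpredD ?hu ?hv. Qed.

Lemma coweightN u : coweight Phi u -> coweight Phi (- u).
Proof. by move=> hu a aP; rewrite dotNl rpredN hu. Qed.

Lemma coweightB u v : coweight Phi u -> coweight Phi v -> coweight Phi (u - v).
Proof. by move=> hu /coweightN; exact: coweightD. Qed.

Lemma coweight_checkv a : a \in Phi -> coweight Phi (checkv a).
Proof. by move=> aP b bP; exact: (root_int Phi_root). Qed.

Lemma coweightMz u (k : int) : coweight Phi u -> coweight Phi (u *~ k).
Proof. by move=> hu a aP; rewrite dotMzl rpredMz ?hu. Qed.

Lemma coweight_lattice u : coroot_lattice u -> coweight Phi u.
Proof.
move=> [s sP ->] a aP; rewrite dot_suml big_seq rpred_sum // => b /sP bP.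
exact: (root_int Phi_root).
Qed.

Lemma generic_vector (L : seq 'rV[R]_n) : 0 \notin L ->
  exists2 y, coroot_lattice y & forall l, l \in L -> dot l y != 0.
Proof.
elim: L => [|l L IH]; first by exists 0 => //; exact: coroot_lattice0.
rewrite inE negb_or eq_sym => /andP[l0 /IH[y hy yL]].
have [a aP al] : exists2 a, a \in Phi & dot l (checkv a) != 0.
  apply: contrapT => h; move/eqP: l0; apply; apply: root_separates => a aP.
  apply/eqP; apply: contrapT => /negP al; apply: h; exists a => //.
  by rewrite dotC dot_checkv_eq0 ?root_nz.
have [N h] := generic_comb (l :: L) y (checkv a).
exists (N%:R *: y + checkv a).
  apply: coroot_latticeD; last exact: coroot_lattice_root.
  by rewrite scaler_nat pmulrn; exact: coroot_latticeMz.
move=> l'; move: (h N (leqnn N) l'); rewrite inE => h' l'L; apply: (h' l'L).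
by move: l'L => /orP[/eqP->|/yL]; [right|left].
Qed.

(** A coweight is determined by its integral pairings with the roots, and bounded pairings leave
    finitely many codes. *)
Lemma coweight_ball (K : nat) : exists2 B : seq 'rV[R]_n, uniq B &
  forall v, v \in B <-> coweight Phi v /\ forall a, a \in Phi -> `|dot v a| <= K%:R.
Proof.
pose A := [set v | coweight Phi v /\ forall a, a \in Phi -> `|dot v a| <= K%:R].
pose code v : {ffun Phi -> 'I_(K + K).+1} :=
  [ffun a => inord (absz (Num.floor (dot v (val a)) + K%:Z)%R)].
have code_inj u v : A u -> A v -> code u = code v -> u = v.
  move=> [cu bu] [cv bv] /ffunP h; apply/eqP; rewrite -subr_eq0; apply/eqP.
  apply: root_separates => a aP; rewrite dotC dotBl.
  have := h [` aP]%fset; rewrite !ffunE /= => /(congr1 val) /=.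
  have [k kE] := coweight_pairing cu aP; have [j jE] := coweight_pairing cv aP.
  have := bu a aP; have := bv a aP; rewrite kE jE !intrKfloor -!intr_norm.
  rewrite -[K%:R]/(K%:Z%:~R) !ler_int => jK kK.
  rewrite !inordK; [|lia|lia] => kj.
  by rewrite (_ : k = j) ?subrr //; lia.
pose dec (h : {ffun Phi -> 'I_(K + K).+1}) := xget 0 [set v | A v /\ code v = h].
have fA : finite_set A.
  apply: (@sub_finite_set _ _ (dec @` setT)); last by apply: finite_image; exact: finite_finset.
  move=> v Av; exists (code v) => //; rewrite /dec.
  case: xgetP => [u _ [Au hu]|/(_ v) []] //.
  exact: code_inj.
exists (finmap.enum_fset (fset_set A)); first exact: fset_uniq.
by move=> v; rewrite -[v \in _]/(v \in fset_set A) in_fset_set // inE.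
Qed.

End RootSystem.

Section Chambers.
Implicit Types (a b u v w : 'rV[R]_n) (c : R).

Definition regular v : Prop := forall a, a \in Phi -> dot a v != 0.

Definition same_chamber v u : Prop :=
  forall a, a \in Phi -> (0 < dot a v) = (0 < dot a u).

(** The hyperplane of [a] is the only one separating [v] from [u]; the sign of [a] records the side
    of [v]. *)
Definition adjacent v u a : Prop :=
  [/\ regular v, regular u, a \in Phi, 0 < dot a v /\ dot a u < 0 &
    forall b, b \in Phi -> b != a -> b != - a -> (0 < dot b v) = (0 < dot b u)].

Lemma root_parallel a b c d : a \in Phi -> b \in Phi -> c != 0 ->
  c *: b = d *: a -> b = a \/ b = - a.
Proof.
move=> aP bP c0 h.
have bE : b = (c^-1 * d) *: a by rewrite -scalerA -h scalerA mulVf ?scale1r.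
case: (@Phi_red a (c^-1 * d) aP); rewrite -?bE // => e; rewrite bE e ?scale1r ?scaleN1r.
  by left.
by right.
Qed.

Lemma root_combination_neq0 a b c d : a \in Phi -> b \in Phi -> b != a -> b != - a ->
  (c != 0) || (d != 0) -> c *: b - d *: a != 0.
Proof.
move=> aP bP ba bNa; apply: contraL; rewrite subr_eq0 negb_or !negbK => /eqP h.
have [c0|c0] := eqVneq c 0.
  move/eqP: h; rewrite c0 scale0r eq_sym scaler_eq0 (negbTE (root_nz aP)).
  by rewrite orbF.
by case: (root_parallel aP bP c0 h) => e; move: ba bNa; rewrite e eqxx.
Qed.

Lemma regular_lt0 v a : regular v -> a \in Phi -> (dot a v < 0) = ~~ (0 < dot a v).
Proof. by move=> rv aP; rewrite -leNgt le_eqVlt (negbTE (rv a aP)). Qed.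

Lemma regular_gt0 v a : regular v -> a \in Phi -> (0 < dot a v) = ~~ (dot a v < 0).
Proof. by move=> rv aP; rewrite regular_lt0 // negbK. Qed.

Lemma pos_negE v a : (0 < dot (- a) v) = (dot a v < 0).
Proof. by rewrite dotNl oppr_gt0. Qed.

Lemma same_chamber_lt0 v u a : same_chamber v u -> a \in Phi ->
  (dot a v < 0) = (dot a u < 0).
Proof. by move=> h aP; rewrite -!pos_negE h // rootN. Qed.

(* [u] can be moved slightly so that the segment from [v] to [u] crosses the   *)
(* root hyperplanes one at a time.                                            *)
Lemma perturbation v u : regular v -> exists y N0, forall N, (N0 <= N)%N ->
  (forall a, a \in Phi -> 0 < dot a u -> 0 < dot a (N%:R *: u + y)) /\
  (forall a b, a \in Phi -> b \in Phi -> b != a -> b != - a ->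
     dot a v * dot b (N%:R *: u + y) != dot b v * dot a (N%:R *: u + y)).
Proof.
move=> rv.
pose L := [seq dot p.1 v *: p.2 - dot p.2 v *: p.1 |
  p <- [seq p <- [seq (a, b) | a <- Phi, b <- Phi] | (p.2 != p.1) && (p.2 != - p.1)]].
have L0 : 0 \notin L.
  apply/mapP => -[[a b]]; rewrite mem_filter => /andP[/= /andP[ba bNa]].
  move=> /allpairsP[[a' b'] /= [aP bP [ea eb]]] /esym/eqP; apply/negP.
  by subst; apply: root_combination_neq0; rewrite ?rv.
have [y _ yL] := generic_vector L0.
have [N1 h1] := large_comb Phi u y; have [N2 h2] := generic_comb L u y.
exists y, (maxn N1 N2) => N; rewrite geq_max => /andP[/h1 {}h1 /h2 {}h2]; split=> //.
move=> a b aP bP ba bNa; rewrite -subr_eq0 -!dotZl -dotBl.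
have lL : dot a v *: b - dot b v *: a \in L.
  apply/mapP; exists (a, b) => //; rewrite mem_filter ba bNa /=.
  by apply/allpairsP; exists (a, b).
by apply: h2 => //; right; exact: yL.
Qed.

Lemma separating_time (s : seq R) t : 0 < t -> (forall r, r \in s -> r < t) ->
  exists2 r, 0 <= r < t & forall r', r' \in s -> r' < r.
Proof.
move=> t0; elim: s => [|r s IH] h; first by exists 0; rewrite ?lexx.
have [|r0 /andP[r0_ge r0_lt] h0] := IH.
  by move=> r' r's; apply: h; rewrite inE r's orbT.
have rt := h r (mem_head _ _).
exists ((Num.max r r0 + t) / 2).
  have : Num.max r r0 < t by rewrite gt_max rt.
  have : 0 <= Num.max r r0 by rewrite le_max r0_ge orbT.
  by move=> *; apply/andP; split; lra.
have mt : Num.max r r0 < (Num.max r r0 + t) / 2.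
  have : Num.max r r0 < t by rewrite gt_max rt.
  by move=> *; lra.
move=> r'; rewrite inE => /orP[/eqP->|/h0 r'r].
  by apply: le_lt_trans mt; rewrite le_max lexx.
by apply: lt_trans mt; rewrite lt_max r'r orbT.
Qed.

(** Induction on the number of hyperplanes separating [v] from [u]. After a perturbation of [u] the
    segment crosses them at distinct times, and a point just before the last crossing is adjacent to
    the end point and has one separating hyperplane less. *)
Lemma chamber_ind (P : 'rV[R]_n -> Prop) :
  (forall v u, regular v -> regular u -> same_chamber v u -> P v -> P u) ->
  (forall v u a, adjacent v u a -> P v -> P u) ->
  forall v u, regular v -> regular u -> P v -> P u.
Proof.
move=> Psame Padj v u rv ru Pv.
pose X (u : 'rV[R]_n) := [seq a <- Phi | (0 < dot a v) && (dot a u < 0)].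
have [k] := ubnP (size (X u)); elim: k u ru => // k IH u ru; rewrite ltnS => szk.
have [y [N0 /(_ N0 (leqnn _)) []]] := perturbation u rv.
set u' := _ + y => pos' gen'.
have same : same_chamber u u'.
  move=> a aP; apply/idP/idP; first exact: pos'.
  apply: contraLR => h; rewrite -leNgt ltW //.
  rewrite -pos_negE; apply: pos'; rewrite ?rootN // pos_negE regular_lt0 //.
have ru' : regular u'.
  move=> a aP; have := ru a aP; rewrite !neq_lt => /orP[].
    by rewrite (same_chamber_lt0 same) // => ->.
  by rewrite same // => ->; rewrite orbT.
apply: (Psame u' u ru' ru) => [a aP|]; first by rewrite same.
have [X0|/eqP] := eqVneq (X u') [::].
  apply: (Psame v) => // a aP; apply/idP/idP => h.
    rewrite regular_gt0 //; apply/negP => h'.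
    by have := mem_filter (fun a => (0 < dot a v) && (dot a u' < 0)) a Phi;
       rewrite -/(X u') X0 h h' aP.
  rewrite regular_gt0 //; apply/negP => h'.
  have := mem_filter (fun a => (0 < dot a v) && (dot a u' < 0)) (- a) Phi.
  by rewrite -/(X u') X0 pos_negE h' dotNl oppr_lt0 h rootN.
case eX: (X u') => [//|a0 s] _.
have {eX s} a0X : a0 \in X u' by rewrite eX mem_head.
(* The time at which the segment from [v] to [u'] meets the hyperplane of the root. *)
pose tm (a : 'rV[R]_n) := dot a v / (dot a v - dot a u').
have [a aX amax] := seq_argmax tm a0X.
have memX b : (b \in X u') = [&& 0 < dot b v, dot b u' < 0 & b \in Phi].
  by rewrite mem_filter andbA.
move: (aX); rewrite memX => /and3P[av au' aP].
have tm_gt0 b : b \in X u' -> 0 < tm b < 1.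
  rewrite memX => /and3P[bv bu' _]; have den : 0 < dot b v - dot b u' by lra.
  rewrite divr_gt0 // ltr_pdivrMr // mul1r; lra.
have [t0 t1] := andP (tm_gt0 _ aX).
pose ts := [seq tm b | b <- X u' & b != a].
have ts_lt r : r \in ts -> r < tm a.
  move=> /mapP[b]; rewrite mem_filter => /andP[ba bX] ->.
  rewrite lt_neqAle amax // andbT; move: (bX); rewrite memX => /and3P[bv bu' bP].
  have bNa : b != - a by apply: contraL bv => /eqP->; rewrite pos_negE -leNgt ltW.
  apply: contra (gen' a b aP bP ba bNa).
  have d1 : dot b v - dot b u' != 0 by apply: lt0r_neq0; lra.
  have d2 : dot a v - dot a u' != 0 by apply: lt0r_neq0; lra.
  by rewrite /tm eqr_div // => /eqP h; apply/eqP; lra.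
have [r /andP[r0 ra] rts] := separating_time t0 ts_lt.
pose p := v + r *: (u' - v).
have pE b : dot b p = (1 - r) * dot b v + r * dot b u'.
  by rewrite dotDr dotZr dotBr; ring.
have r1 : r < 1 by apply: lt_trans t1.
have rlt : 0 < 1 - r by rewrite subr_gt0.
have tmE b : b \in X u' -> dot b p = (dot b v - dot b u') * (tm b - r).
  rewrite memX => /and3P[bv bu' _]; rewrite pE /tm; field.
  by apply: lt0r_neq0; lra.
have pa : 0 < dot a p by rewrite tmE // mulr_gt0 ?subr_gt0 //; lra.
have pb b : b \in Phi -> b != a -> b != - a -> dot b p != 0 /\ (0 < dot b p) = (0 < dot b u').
  have main b' : b' \in Phi -> b' != a -> b' != - a -> 0 < dot b' v ->
      dot b' p != 0 /\ (0 < dot b' p) = (0 < dot b' u').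
    move=> bP ba bNa bv; have [bu'|bu'|] := ltgtP (dot b' u') 0; last first.
    - by move=> e; have := ru' _ bP; rewrite e eqxx.
    - have : 0 < dot b' p by rewrite pE ltr_pwDl ?mulr_gt0 // mulr_ge0 // ltW.
      by move=> h; rewrite h gt_eqF.
    have bX : b' \in X u' by rewrite memX bv bu'.
    have : dot b' p < 0.
      rewrite tmE // pmulr_rlt0 ?subr_lt0; last lra.
      by apply: rts; apply/mapP; exists b'; rewrite // mem_filter ba.
    by move=> h; rewrite lt_eqF // ltNge ltW.
  move=> bP ba bNa; have := rv b bP; rewrite neq_lt => /orP[bv|]; last exact: main.
  have ba' : - b != a by apply: contra bNa => /eqP <-; rewrite opprK.
  have bNa' : - b != - a by apply: contra ba => /eqP /oppr_inj ->.
  have bv' : 0 < dot (- b) v by rewrite pos_negE.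
  have [] := main (- b) (rootN bP) ba' bNa' bv'.
  rewrite !pos_negE dotNl oppr_eq0 => h1 h2; split=> //.
  by rewrite (regular_gt0 ru' bP) -h2 -leNgt le_eqVlt eq_sym (negbTE h1).
have rp : regular p.
  move=> b bP; have [->|ba] := eqVneq b a; first by rewrite gt_eqF.
  have [->|bNa] := eqVneq b (- a); first by rewrite dotNl oppr_eq0 gt_eqF.
  by case: (pb b bP ba bNa).
apply: (Padj p u' a).
  by split=> // b bP ba bNa; case: (pb b bP ba bNa).
apply: IH => //; apply: (leq_trans _ szk).
have Xp b : b \in X p -> b \in X u' /\ b != a.
  rewrite mem_filter => /andP[/andP[bv bp] bP].
  have ba : b != a by apply: contraTneq bp => ->; rewrite -leNgt ltW.
  have bNa : b != - a by apply: contraL bv => /eqP->; rewrite pos_negE -leNgt ltW.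
  have [_ e] := pb b bP ba bNa; split=> //; rewrite memX bv bP andbT /=.
  by rewrite regular_lt0 // -e -leNgt ltW.
have Xu : X u = X u' by apply: eq_in_filter => b bP; rewrite (same_chamber_lt0 same).
rewrite Xu (_ : size (X u') = (size (a :: rem a (X u')))); last first.
  exact/perm_size/perm_to_rem.
rewrite ltnS; apply: uniq_leq_size; first by rewrite filter_uniq // fset_uniq.
move=> b /Xp[bX ba]; rewrite mem_rem_uniq ?inE ?ba //.
by rewrite filter_uniq // fset_uniq.
Qed.

End Chambers.

(** * Supports with long strings *)

Section SpreadBound.
Implicit Types (a b u v w : 'rV[R]_n) (c : R) (S X : seq 'rV[R]_n) (k : 'rV[R]_n -> nat).

(** Only the extent of the string through [t] is recorded; gaps inside are invisible to the convex
    hull. *)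
Definition string_spread S a (k : nat) : Prop :=
  forall t, t \in S -> exists i j : int,
    [/\ t + checkv a *~ i \in S, t - checkv a *~ j \in S & k%:Z <= i + j].

Lemma string_spread0 S a : string_spread S a 0.
Proof. by move=> t tS; exists 0, 0; rewrite !mulr0z addr0 subr0. Qed.

Let descend s0 X k := s0 - \sum_(a <- X) (k a)%:R *: checkv a.

(* Along the line v + tau w the maximum of S is convex in tau; at the time     *)
(* when [a] changes sign the maximal face is an interval of [a]-strings, which *)
(* makes the slope jump by at least k a times the length of the coroot.       *)
Lemma crossing_bound S X k v w s0 :
  s0 \in S -> (forall s, s \in S -> dot s v <= dot s0 v) ->
  uniq X -> {subset X <= Phi} ->
  {in X, forall a, 0 < dot a v} -> {in X, forall a, dot a w < 0} ->
  {in X, forall a, string_spread S a (k a)} ->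
  {in X &, forall a b, a != b -> dot a v * dot b w != dot b v * dot a w} ->
  forall tau, 0 < tau -> {in X, forall a, dot a (v + tau *: w) < 0} ->
  forall t, t \in S -> (forall s, s \in S -> dot s (v + tau *: w) <= dot t (v + tau *: w)) ->
  dot (descend s0 X k) (v + tau *: w) <= dot t (v + tau *: w) /\
  dot (descend s0 X k) w <= dot t w.
Proof.
move=> s0S s0max.
have [r] := ubnP (size X); elim: r X => // r IH X.
rewrite ltnS => szX uX XP Xv Xw Xspread Xdist tau tau0 Xtau t tS tmax.
have [eX|[a0 a0X]] : X = [::] \/ exists a0, a0 \in X.
- by case: (X) => [|a0 X0]; [left|right; exists a0; exact: mem_head].
- rewrite eX /descend big_nil subr0; split; first exact: tmax.
  have := s0max t tS; have := tmax s0 s0S; rewrite !dotDr !dotZr => h1 h2.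
  by rewrite -(ler_pM2l tau0); lra.
pose tm a := dot a v / - dot a w.
have [a aX amax] := seq_argmax tm a0X.
have aP := XP a aX; have a_nz := root_nz aP.
have av := Xv a aX; have aw := Xw a aX.
have pX : perm_eq X (a :: rem a X) by exact: perm_to_rem.
have sub' b : b \in rem a X -> b \in X /\ b != a.
  by rewrite mem_rem_uniq // inE => /andP[-> ->].
have dE : descend s0 X k = descend s0 (rem a X) k - (k a)%:R *: checkv a.
  rewrite /descend (perm_big _ pX) big_cons /= opprD addrA.
  by rewrite addrAC.
(* The last crossing time before [tau]; the induction hypothesis for the other roots is used at this
   time. *)
pose sg := tm a.
have sg0 : 0 < sg by rewrite divr_gt0 // oppr_gt0.
have asg : dot a (v + sg *: w) = 0.
  by rewrite dotDr dotZr /sg /tm; field; rewrite lt_eqF.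
have sgtau : sg < tau.
  have := Xtau a aX; rewrite dotDr dotZr /sg /tm ltr_pdivrMr ?oppr_gt0 //; lra.
have dsg b : b \in rem a X -> dot b (v + sg *: w) < 0.
  move=> /sub'[bX ba]; have bv := Xv b bX; have bw := Xw b bX.
  have : tm b < sg.
    rewrite lt_neqAle amax // andbT; apply: contra (Xdist b a bX aX ba).
    have d1 : - dot a w != 0 by rewrite oppr_eq0 lt_eqF.
    have d2 : - dot b w != 0 by rewrite oppr_eq0 lt_eqF.
    by rewrite /sg /tm eqr_div // => /eqP h; apply/eqP; lra.
  by rewrite /tm ltr_pdivrMr ?oppr_gt0 // dotDr dotZr; lra.
have {}IH : forall t, t \in S ->
    (forall s, s \in S -> dot s (v + sg *: w) <= dot t (v + sg *: w)) ->
    dot (descend s0 (rem a X) k) (v + sg *: w) <= dot t (v + sg *: w) /\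
    dot (descend s0 (rem a X) k) w <= dot t w.
  apply: IH => //.
  - by apply: (leq_trans _ szX); rewrite (perm_size pX).
  - by rewrite rem_uniq.
  - by move=> b /sub'[/XP].
  - by move=> b /sub'[/Xv].
  - by move=> b /sub'[/Xw].
  - by move=> b /sub'[/Xspread].
  - by move=> b c /sub'[bX _] /sub'[cX _]; exact: Xdist.
have [t1 t1S t1max] := seq_argmax (fun s => dot s (v + sg *: w)) s0S.
pose F := [seq s <- S | dot s (v + sg *: w) == dot t1 (v + sg *: w)].
have t1F : t1 \in F by rewrite mem_filter eqxx.
have [t' t'F t'max] := seq_argmax (fun s => dot s w) t1F.
have FS s : s \in F -> s \in S /\ forall s', s' \in S -> dot s' (v + sg *: w) <= dot s (v + sg *: w).
  by rewrite mem_filter => /andP[/eqP e sS]; split=> // s' s'S; rewrite e; exact: t1max.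
have [t'S t'top] := FS t' t'F.
have [i [j [iS jS kij]]] := Xspread a aX t' t'S.
have inF (l : int) : t' + checkv a *~ l \in S -> t' + checkv a *~ l \in F.
  move=> h; rewrite mem_filter h andbT dotDl dotMzl dot_checkv asg mulr0 mul0rz addr0.
  by move: t'F; rewrite mem_filter => /andP[].
have avw : dot (checkv a) w < 0 by rewrite dot_checkv_lt0.
(* On the face [F] the point [t'] maximizes [w], and adding [a^vee] lowers [w]. The string therefore
   has no point of [F] below [t'], and its whole extent lies above. *)
have j0 : j <= 0.
  have := jS; rewrite -mulrNz => /inF /t'max; rewrite dotDl dotMzl gerDl mulrNz oppr_le0.
  by rewrite -mulrzr nmulr_rge0 // lerz0.
have i_ge : (k a)%:Z <= i by apply: le_trans kij _; rewrite gerDl.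
have [iSF itop] := FS _ (inF _ iS).
have [p1 p2] := IH _ iSF itop.
have slope : dot (descend s0 X k) w <= dot t' w.
  rewrite dE dotBl dotZl; move: p2; rewrite (dotDl t') dotMzl -mulrzr.
  have : ((k a)%:Z%:~R : R) <= i%:~R by rewrite ler_int.
  rewrite -[(k a)%:Z%:~R]/((k a)%:R) => h.
  have : i%:~R * dot (checkv a) w <= (k a)%:R * dot (checkv a) w by rewrite ler_nM2r.
  by lra.
have value : dot (descend s0 X k) (v + sg *: w) <= dot t' (v + sg *: w).
  rewrite dE dotBl dotZl; move: p1.
  by rewrite (dotDl t') dotMzl dot_checkv asg mulr0 mul0rz mulr0 subr0 addr0.
have line s : dot s (v + tau *: w) = dot s (v + sg *: w) + (tau - sg) * dot s w.
  by rewrite !dotDr !dotZr; ring.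
have dt : 0 < tau - sg by rewrite subr_gt0.
have slope_t : dot t' w <= dot t w.
  have := tmax t' t'S; have := t'top t tS; rewrite !line => h1 h2.
  by rewrite -(ler_pM2l dt); lra.
split; last exact: le_trans slope slope_t.
apply: (le_trans _ (tmax t' t'S)); rewrite !line lerD //.
by rewrite ler_pM2l.
Qed.

(** The convex hull of [S] contains [s0] minus the segments from 0 to [k a] times [a^vee]. Replace
    [u] by [N u + y] with generic [y], so that [crossing_bound] applies at time 1; the error due to
    [y] is bounded in [N], whereas a failure of the claim would leave a gap growing linearly. *)
Lemma spread_bound S k v u s0 : regular v -> s0 \in S ->
  (forall s, s \in S -> dot s v <= dot s0 v) ->
  (forall a, a \in Phi -> 0 < dot a v -> string_spread S a (k a)) ->
  exists2 t, t \in S &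
    dot s0 u + \sum_(a <- Phi | 0 < dot a v) (k a)%:R * Num.max 0 (- dot (checkv a) u)
      <= dot t u.
Proof.
move=> rv s0S s0max spread.
pose E u := \sum_(a <- Phi | 0 < dot a v) (k a)%:R * Num.max 0 (- dot (checkv a) u).
rewrite -/(E u).
have [y [N1 hN1]] := perturbation u rv.
pose C := \sum_(a <- Phi | 0 < dot a v) (k a)%:R * `|dot (checkv a) y|.
apply: contrapT => no.
have gap t : t \in S -> 0 < dot s0 u + E u - dot t u.
  move=> tS; rewrite subr_gt0 ltNge; apply/negP => h; apply: no; exists t => //.
have [N2 hN2] := large_nat S (fun t => `|dot t y| + `|dot s0 y| + C)
  (fun t => dot s0 u + E u - dot t u).
pose N := maxn N1 N2.
have [_ gen] := hN1 N (leq_maxl _ _); have far := hN2 N (leq_maxr _ _).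
set u' := _ + y in gen.
pose w := u' - v; pose X := [seq a <- Phi | (0 < dot a v) && (dot a u' < 0)].
have memX a : (a \in X) = [&& 0 < dot a v, dot a u' < 0 & a \in Phi].
  by rewrite mem_filter andbA.
have u'E : v + 1 *: w = u' by rewrite scale1r addrC subrK.
have [t tS tmax] := seq_argmax (fun s => dot s u') s0S.
have [||||||||h _] := @crossing_bound S X k v w s0 s0S s0max _ _ _ _ _ _ 1 ltr01 _ t tS.
- by rewrite filter_uniq // fset_uniq.
- by move=> a; rewrite memX => /and3P[].
- by move=> a; rewrite memX => /and3P[].
- by move=> a; rewrite memX => /and3P[av au' _]; rewrite dotBr; lra.
- by move=> a; rewrite memX => /and3P[av au' aP]; exact: spread.
- move=> a b; rewrite !memX => /and3P[av au' aP] /and3P[bv bu' bP] ab.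
  have bNa : b != - a by apply: contraL bv => /eqP->; rewrite pos_negE -leNgt ltW.
  apply: contra (gen a b aP bP _ bNa); rewrite 1?eq_sym //.
  by rewrite /w !dotBr => /eqP h; apply/eqP; lra.
- by move=> a; rewrite memX u'E => /and3P[].
- by move=> s sS; rewrite u'E; exact: tmax.
have EX : E u' = - \sum_(a <- X) dot ((k a)%:R *: checkv a) u'.
  rewrite big_filter big_mkcondr /= -sumrN /E big_seq_cond [RHS]big_seq_cond.
  apply: eq_bigr => a /andP[aP av]; have a_nz := root_nz aP.
  have [au'|au'] := ltP (dot a u') 0.
    have h' : 0 <= - dot (checkv a) u' by rewrite oppr_ge0 ltW // dot_checkv_lt0.
    by rewrite (max_r h') (dotZl (k a)%:R) mulrN.
  by rewrite max_l ?mulr0 ?oppr0 // oppr_le0 leNgt dot_checkv_lt0 // -leNgt.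
have {h} : dot s0 u' + E u' <= dot t u'.
  by move: h; rewrite u'E EX /descend dotBl dot_suml.
have : N%:R * E u - C <= E u'.
  rewrite /E /C mulr_sumr -sumrB; apply: ler_sum => a _.
  rewrite mulrCA -mulrBr ler_wpM2l //.
  have := ler_norm (dot (checkv a) y).
  rewrite -[N%:R]ger0_norm // -[X in X * Num.max _ _]/(`|_|) ger0_norm //.
  rewrite /u' dotDr dotZr => h.
  rewrite lerBlDr maxr_pMr // mulr0 ge_max; apply/andP; split.
    by rewrite addr_ge0 // le_max lexx.
  rewrite mulrN -lerBlDr le_max; apply/orP; right; lra.
move=> h1; rewrite /u' !dotDr !dotZr => h2; have := far t tS (gap t tS).
have := ler_norm (dot t y); have := ler_norm (- dot s0 y); rewrite normrN.
rewrite mulrBr mulrDr; lra.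
Qed.

End SpreadBound.

(** * Half sums over chambers and the support function of N *)

Section Multiplicities.
Implicit Types (a b u v w : 'rV[R]_n) (c : R) (f : 'rV[R]_n -> 'rV[R]_n).

Lemma mult_opp a : a \in Phi -> m (- a) = m a.
Proof. by move=> aP; rewrite -(reflv_self (root_nz aP)) m_inv. Qed.

Lemma adjacent_sym v u a : adjacent v u a -> adjacent u v (- a).
Proof.
move=> [rv ru aP [av au] h]; split=> //; rewrite ?rootN //.
  by rewrite !dotNl oppr_gt0 oppr_lt0.
by move=> b bP ba bNa; rewrite h // -[a]opprK.
Qed.

(** At the point [u0], where the segment from [v] to [u] meets the wall (up to scale), all positive
    roots but [a] are positive. The reflection fixes [u0], so it cannot change the sign of [b]. *)
Lemma adjacent_refl v u a b : adjacent v u a -> b \in Phi -> 0 < dot b v -> b != a ->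
  [/\ reflv a b \in Phi, 0 < dot (reflv a b) v & reflv a b != a].
Proof.
move=> [rv ru aP [av au] h] bP bv ba; have a_nz := root_nz aP.
have bNa : b != - a by apply: contraL bv => /eqP->; rewrite pos_negE -leNgt ltW.
have rP : reflv a b \in Phi by rewrite root_reflE.
have ra : reflv a b != a.
  by apply: contra bNa => /eqP e; rewrite -(reflvK a_nz b) e reflv_self.
have rNa : reflv a b != - a.
  by apply: contra ba => /eqP e; rewrite -(reflvK a_nz b) e reflvN reflv_self // opprK.
split=> //; pose u0 := - dot a u *: v + dot a v *: u.
have au0 : dot a u0 = 0 by rewrite dotDr !dotZr; ring.
have bu : 0 < dot b u by rewrite -h.
have bu0 : 0 < dot b u0.
  by rewrite dotDr !dotZr addr_gt0 // mulr_gt0 // oppr_gt0.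
rewrite (regular_gt0 rv rP); apply/negP => rv0.
have ru0 : dot (reflv a b) u < 0.
  by rewrite (regular_lt0 ru rP) -h // -leNgt ltW.
have : dot (reflv a b) u0 < 0.
  rewrite dotDr !dotZr addrC ltr_wnDl //; first by rewrite pmulr_rle0 ?ltW.
  by rewrite pmulr_rlt0 // oppr_gt0.
rewrite /reflv dotBl dotZl au0 mulr0 subr0 => h0.
by have := lt_trans h0 bu0; rewrite ltxx.
Qed.

Lemma adjacent_perm v u a : adjacent v u a ->
  perm_eq [seq reflv a b | b <- Phi & (0 < dot b v) && (b != a)]
          [seq b <- Phi | (0 < dot b v) && (b != a)].
Proof.
move=> ad; have [_ _ aP _ _] := ad; have a_nz := root_nz aP.
have inj : injective (reflv a) by exact: inv_inj (reflvK a_nz).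
have ul : uniq [seq b <- Phi | (0 < dot b v) && (b != a)].
  by rewrite filter_uniq // fset_uniq.
apply: uniq_perm => //; first by rewrite map_inj_uniq.
have sub b : b \in [seq b <- Phi | (0 < dot b v) && (b != a)] ->
    reflv a b \in [seq b <- Phi | (0 < dot b v) && (b != a)].
  rewrite !mem_filter => /andP[/andP[bv ba] bP].
  by have [-> -> ->] := adjacent_refl ad bP bv ba.
move=> b; apply/mapP/idP => [[b' /sub h ->] //|/sub h].
by exists (reflv a b); rewrite ?reflvK.
Qed.

Lemma adjacent_big (T : Type) (idx : T) (op : Monoid.com_law idx) v u a
    (F : 'rV[R]_n -> T) : adjacent v u a ->
  \big[op/idx]_(b <- Phi | (0 < dot b v) && (b != a)) F (reflv a b) =
  \big[op/idx]_(b <- Phi | (0 < dot b v) && (b != a)) F b.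
Proof.
move=> /adjacent_perm h; rewrite -[LHS]big_filter -[RHS]big_filter.
by rewrite -[RHS](perm_big _ h) big_map.
Qed.

Lemma adjacent_big1 (T : Type) (idx : T) (op : Monoid.com_law idx) v u a
    (F : 'rV[R]_n -> T) : adjacent v u a ->
  \big[op/idx]_(b <- Phi | 0 < dot b v) F b =
  op (F a) (\big[op/idx]_(b <- Phi | (0 < dot b v) && (b != a)) F b).
Proof.
move=> [_ _ aP [av _] _]; rewrite (big_rem a) //= av; congr (op _ _).
rewrite rem_filter ?fset_uniq // big_filter_cond.
by apply: eq_bigl => b; rewrite andbC.
Qed.

Lemma adjacent_big2 (T : Type) (idx : T) (op : Monoid.com_law idx) v u a
    (F : 'rV[R]_n -> T) : adjacent v u a ->
  \big[op/idx]_(b <- Phi | 0 < dot b u) F b =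
  op (F (- a)) (\big[op/idx]_(b <- Phi | (0 < dot b v) && (b != a)) F b).
Proof.
move=> ad; rewrite (adjacent_big1 _ _ (adjacent_sym ad)); congr (op _ _).
have [_ _ aP [av au] h] := ad; rewrite big_seq_cond [RHS]big_seq_cond.
apply: eq_bigl => b; case: (boolP (b \in Phi)) => //= bP.
have [->|ba] := eqVneq b a; first by rewrite andbF ltNge ltW.
have [->|bNa] := eqVneq b (- a); first by rewrite andbF pos_negE ltNge ltW.
by rewrite h.
Qed.

Definition half_sum f v := 2^-1 *: \sum_(b <- Phi | 0 < dot b v) (m b)%:R *: f b.

Definition equivariant f : Prop :=
  (forall a b, a \in Phi -> f (reflv a b) = reflv a (f b)) /\ (forall b, f (- b) = - f b).

Lemma equivariant_id : equivariant id.
Proof. by split. Qed.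

Lemma equivariant_checkv : equivariant checkv.
Proof.
by split=> [a b aP|b]; rewrite ?checkvN // reflv_checkv // (root_nz aP).
Qed.

Lemma half_sum_same f v u : same_chamber v u -> half_sum f v = half_sum f u.
Proof.
move=> h; rewrite /half_sum big_seq_cond [in RHS]big_seq_cond; congr (_ *: _).
by apply: eq_bigl => b; case: (boolP (b \in Phi)) => //= bP; rewrite h.
Qed.

(** Crossing the wall exchanges [a] for [-a] among the positive roots and keeps the others, which
    the reflection permutes. *)
Lemma half_sum_adjacent f v u a : equivariant f -> adjacent v u a ->
  half_sum f u = reflv a (half_sum f v) /\ half_sum f u = half_sum f v - (m a)%:R *: f a.
Proof.
move=> [fr fN] ad; have [_ _ aP _ _] := ad.
pose Z := \sum_(b <- Phi | (0 < dot b v) && (b != a)) (m b)%:R *: f b.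
have vE : half_sum f v = 2^-1 *: ((m a)%:R *: f a + Z).
  by rewrite /half_sum (adjacent_big1 _ _ ad).
have uE : half_sum f u = 2^-1 *: (- ((m a)%:R *: f a) + Z).
  by rewrite /half_sum (adjacent_big2 _ _ ad) fN scalerN mult_opp.
have rZ : reflv a Z = Z.
  rewrite /Z reflv_sum -[RHS](adjacent_big _ _ ad) big_seq_cond [RHS]big_seq_cond.
  by apply: eq_bigr => b /andP[bP _]; rewrite reflvZ fr // m_inv.
split; rewrite vE uE.
  rewrite reflvZ reflvD rZ reflvZ -fr // reflv_self ?fN ?scalerN //.
  exact: root_nz aP.
set A := (m a)%:R *: f a.
have hA : A = 2^-1 *: (A + A) by rewrite -mulr2n -(scaler_nat 2 A) scalerA mulVf ?scale1r ?pnatr_eq0.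
by rewrite [X in _ - X]hA -scalerBr opprD addrACA subrr add0r addrC.
Qed.

(* rho^vee and rho for the positive system of the chamber of v *)
Definition rvee := half_sum checkv.
Definition rroot := half_sum id.

Lemma rvee_wall v u a : adjacent v u a -> dot (rvee v) a = (m a)%:R.
Proof.
move=> ad; have [h1 h2] := half_sum_adjacent equivariant_checkv ad.
have [_ _ aP _ _] := ad; have a_nz := root_nz aP.
move: h2; rewrite h1 reflvE => /addrI /oppr_inj /(congr1 (dot^~ a)).
rewrite /= !(dotZl _ (checkv a)) dot_checkv_self // dotC => /mulIf-> //.
Qed.

(** A generic point of the hyperplane of [a] lies on no other root hyperplane; small steps to its
    two sides give the chambers. *)
Lemma wall_exists a : a \in Phi -> exists v u, adjacent v u a.
Proof.
move=> aP; have a_nz := root_nz aP; have aa : 0 < dot a a by rewrite dot_gt0.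
pose L := [seq 1 *: b - (dot (checkv a) b / 2) *: a | b <- Phi & (b != a) && (b != - a)].
have L0 : 0 \notin L.
  apply/mapP => -[b]; rewrite mem_filter => /andP[/andP[ba bNa] bP] /esym/eqP.
  apply/negP; have := root_combination_neq0 (c := 1)
    (d := dot (checkv a) b / 2) aP bP ba bNa.
  by apply; rewrite oner_eq0.
have [y _ yL] := generic_vector L0.
pose u0 := y - (dot (checkv a) y / 2) *: a.
have au0 : dot a u0 = 0.
  by rewrite dotBr dotZr dot_checkv; field; rewrite gt_eqF.
have bu0 b : b \in Phi -> b != a -> b != - a -> dot b u0 != 0.
  move=> bP ba bNa.
  have lL : 1 *: b - (dot (checkv a) b / 2) *: a \in L.
    by apply/mapP; exists b => //; rewrite mem_filter ba bNa.
  apply: contra (yL _ lL) => /eqP h; apply/eqP; rewrite -h /u0 dotBl dotBr scale1r.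
  rewrite (dotZl _ a) (dotZr _ b a) !dot_checkv (dotC b a); ring.
have [N1 h1] := large_comb Phi u0 a; have [N2 h2] := large_comb Phi u0 (- a).
pose N := maxn N1 N2; pose v := N%:R *: u0 + a; pose u := N%:R *: u0 - a.
have hv b : b \in Phi -> 0 < dot b u0 -> 0 < dot b v by apply: h1; exact: leq_maxl.
have hu b : b \in Phi -> 0 < dot b u0 -> 0 < dot b u by apply: h2; exact: leq_maxr.
have av : 0 < dot a v by rewrite dotDr dotZr au0 mulr0 add0r.
have au : dot a u < 0 by rewrite dotBr dotZr au0 mulr0 sub0r oppr_lt0.
have key b : b \in Phi -> b != a -> b != - a -> [/\ dot b v != 0, dot b u != 0 &
    (0 < dot b v) = (0 < dot b u)].
  move=> bP ba bNa; have := bu0 b bP ba bNa; rewrite neq_lt => /orP[b0|b0]; last first.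
    by rewrite !hv ?hu // !gt_eqF ?hv ?hu.
  have nb : 0 < dot (- b) u0 by rewrite pos_negE.
  have := hv _ (rootN bP) nb; have := hu _ (rootN bP) nb.
  by rewrite !pos_negE => h h'; rewrite !lt_eqF // !ltNge !ltW.
exists v, u; split=> //.
- move=> b bP; have [->|ba] := eqVneq b a; first by rewrite gt_eqF.
  have [->|bNa] := eqVneq b (- a); first by rewrite dotNl oppr_eq0 gt_eqF.
  by case: (key b bP ba bNa).
- move=> b bP; have [->|ba] := eqVneq b a; first by rewrite lt_eqF.
  have [->|bNa] := eqVneq b (- a); first by rewrite dotNl oppr_eq0 lt_eqF.
  by case: (key b bP ba bNa).
by move=> b bP ba bNa; case: (key b bP ba bNa).
Qed.

(** The pairing with [b] is the integer [m b] in a chamber that has [b] as a wall, and each crossing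
    changes [rho^vee] by an integral multiple of a coroot. *)
Lemma coweight_rvee v : regular v -> coweight Phi (rvee v).
Proof.
move=> rv b bP; have [v0 [u0 ad0]] := wall_exists bP; have [rv0 _ _ _ _] := ad0.
apply: (chamber_ind (P := fun v => dot (rvee v) b \is a Num.int) _ _ rv0 rv).
- by move=> v1 v2 _ _ /half_sum_same; rewrite /rvee => ->.
- move=> v1 v2 a ad; have [_ _ aP _ _] := ad.
  rewrite /rvee; have [_ ->] := half_sum_adjacent equivariant_checkv ad => h.
  by rewrite dotBl (dotZl (m a)%:R) rpredB // rpredM ?(root_int Phi_root) // natr_int.
by rewrite (rvee_wall ad0) natr_int.
Qed.

Lemma sum_pos_neg (V : nmodType) v (F : 'rV[R]_n -> V) : regular v ->
  \sum_(b <- Phi) F b = \sum_(b <- Phi | 0 < dot b v) (F b + F (- b)).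
Proof.
move=> rv; rewrite (bigID (fun b => 0 < dot b v)) /= big_split /=; congr (_ + _).
rewrite -big_filter -[RHS]big_filter.
rewrite (perm_big [seq - b | b <- Phi & 0 < dot b v]) ?big_map //=.
apply: uniq_perm.
- by rewrite filter_uniq // fset_uniq.
- by rewrite map_inj_uniq ?filter_uniq ?fset_uniq //; exact: oppr_inj.
move=> b; rewrite mem_filter; apply/andP/mapP => [[bv bP]|[b']].
  exists (- b); rewrite ?opprK // mem_filter rootN // andbT pos_negE.
  by rewrite (regular_lt0 rv bP).
rewrite mem_filter => /andP[b'v b'P] ->; rewrite rootN // -leNgt; split=> //.
by rewrite dotNl oppr_le0 ltW.
Qed.

(* support function of the polytope N *)
Definition hN u : R := 4^-1 * \sum_(b <- Phi) (m b)%:R * `|dot (checkv b) u|.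

Lemma hN_abs v u : regular v ->
  hN u = 2^-1 * \sum_(b <- Phi | 0 < dot b v) (m b)%:R * `|dot (checkv b) u|.
Proof.
move=> rv; rewrite /hN (sum_pos_neg _ rv) big_seq_cond.
rewrite (eq_bigr (fun b => 2 * ((m b)%:R * `|dot (checkv b) u|))); last first.
  move=> b /andP[bP _]; rewrite mult_opp // checkvN dotNl normrN; ring.
by rewrite -big_seq_cond -mulr_sumr mulrA; congr (_ * _); lra.
Qed.

(** The support function measured from the vertex [rvee v], in the shape produced by
    [spread_bound]. *)
Lemma hN_max v u : regular v ->
  hN u = dot (rvee v) u +
    \sum_(b <- Phi | 0 < dot b v) (m b)%:R * Num.max 0 (- dot (checkv b) u).
Proof.
move=> rv; rewrite (hN_abs _ rv) /rvee /half_sum (dotZl 2^-1) dot_suml !mulr_sumr -big_split /=.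
apply: eq_bigr => b _; rewrite (dotZl (m b)%:R).
have [h|h] := lerP 0 (dot (checkv b) u).
  by rewrite ger0_norm // max_l ?oppr_le0 //; ring.
by rewrite ltr0_norm // max_r ?oppr_ge0 ?ltW //; field.
Qed.

Lemma hN_chamber v : regular v -> hN v = dot (rvee v) v.
Proof.
move=> rv; rewrite (hN_max _ rv) big_seq_cond big1 ?addr0 // => b /andP[bP bv].
by rewrite max_l ?mulr0 // oppr_le0 ltW // dot_checkv_gt0 // (root_nz bP).
Qed.

(** For every root [a] the direction [N v + a] with [N] large is still in the chamber of [v], where
    [rvee v] is extremal; using [a] and [-a] leaves no room for [l]. *)
Lemma hN_top v l : regular v -> (forall u, dot l u <= hN u) ->
  dot l v = dot (rvee v) v -> l = rvee v.
Proof.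
move=> rv lN lv; apply/esym/eqP; rewrite -subr_eq0; apply/eqP.
apply: root_separates.
have half a : 0 <= dot (rvee v - l) a.
  have [N h] := large_comb Phi v a; pose u := N.+1%:R *: v + a.
  have : dot l u <= dot (rvee v) u.
    rewrite (le_trans (lN u)) // (hN_max _ rv) big_seq_cond big1 ?addr0 // => b /andP[bP bv].
    rewrite max_l ?mulr0 // oppr_le0 ltW // dot_checkv_gt0 ?(root_nz bP) //.
    exact: h.
  by rewrite /u !dotDr !dotZr lv dotBl; lra.
move=> a aP; rewrite dotC; apply/eqP; rewrite eq_le half andbT.
by rewrite -oppr_ge0 -dotNr.
Qed.

Lemma hN_root_bound : exists K : nat, forall l, (forall u, dot l u <= hN u) ->
  forall b, b \in Phi -> `|dot l b| <= K%:R.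
Proof.
pose K := \max_(b <- Phi) Num.bound (hN b); exists K => l lN b bP.
have bd b' : b' \in Phi -> dot l b' <= K%:R.
  move=> b'P; apply: (le_trans (lN b')).
  have : hN b' < (Num.bound (hN b'))%:R.
    by apply: archi_boundP; rewrite mulr_ge0 ?invr_ge0 ?sumr_ge0 // => ? _; rewrite mulr_ge0.
  move=> /ltW /le_trans; apply; rewrite ler_nat.
  exact: (@leq_bigmax_seq _ (finmap.enum_fset Phi) xpredT (fun b => Num.bound (hN b)) b' b'P isT).
by rewrite ler_norml bd // andbT lerNl -dotNr bd ?rootN.
Qed.

Lemma hN_list : exists2 B : seq 'rV[R]_n, uniq B &
  forall l, l \in B <-> coweight Phi l /\ forall u, dot l u <= hN u.
Proof.
have [K hK] := hN_root_bound; have [B uB hB] := coweight_ball K.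
exists [seq l <- B | `[< forall u, dot l u <= hN u >]]; first exact: filter_uniq.
move=> l; rewrite mem_filter; split=> [/andP[/asboolP h /hB[]] //|[lP h]].
by apply/andP; split; [exact/asboolP|apply/hB; split=> //; exact: hK].
Qed.

End Multiplicities.

(** * Minuscule and quasiminuscule orbits *)

Section Orbits.
Implicit Types (a b u v w t l nu : 'rV[R]_n) (S : seq 'rV[R]_n).

(** Both Cartan integers are negative and their product is less than 4 by strict Cauchy-Schwarz. So
    one of them is -1, and the corresponding reflection adds the two coroots. *)
Lemma coroot_add a b : a \in Phi -> b \in Phi -> dot a b < 0 ->
  checkv a + checkv b = 0 \/ exists2 d, d \in Phi & checkv a + checkv b = checkv d.
Proof.
move=> aP bP ab; have a_nz := root_nz aP; have b_nz := root_nz bP.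
have [[c abE]|no] := pselect (exists c, a = c *: b).
  have : 1 *: a = c *: b by rewrite scale1r.
  move=> /(root_parallel bP aP (oner_neq0 _))[e|e].
    by move: ab; rewrite e ltNge dot_ge0.
  by left; rewrite e checkvN addNr.
have [k1 k1E] := root_pairing aP bP; have [k2 k2E] := root_pairing bP aP.
have aa : 0 < dot a a by rewrite dot_gt0.
have bb : 0 < dot b b by rewrite dot_gt0.
have k1n : k1 < 0 by rewrite -(ltrz0 R) -k1E dot_checkv_lt0.
have k2n : k2 < 0 by rewrite -(ltrz0 R) -k2E dot_checkv_lt0 // dotC.
have : dot a b ^+ 2 < dot a a * dot b b.
  by apply: dot_sqr_lt => // c; apply/eqP => e; apply: no; exists c.
have -> : dot a b ^+ 2 = (k1 * k2)%:~R / 4 * (dot a a * dot b b).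
  rewrite intrM -k1E -k2E !dot_checkv (dotC b a) expr2; field.
  by rewrite !gt_eqF.
rewrite gtr_pMl ?mulr_gt0 // ltr_pdivrMr // mul1r -[4]/(4%:Z%:~R) ltr_int => k12.
have : k1 = -1 \/ k2 = -1 by move: k1n k2n k12; clear; nia.
move=> [k|k]; right.
  exists (reflv b a); first by rewrite root_reflE.
  rewrite -reflv_checkv // reflvE (dotC b) k1E k.
  by rewrite scaleN1r opprK.
exists (reflv a b); first by rewrite root_reflE.
rewrite -reflv_checkv // reflvE (dotC a) k2E k.
by rewrite scaleN1r opprK addrC.
Qed.

(** Coroots with negative pairing are merged or cancelled by [coroot_add]. In a list where this is
    impossible, each root pairs to 2 with its own coroot and nonnegatively with the rest. *)
Lemma coroot_decomposition l : coroot_lattice l -> exists2 s : seq 'rV[R]_n,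
  {subset s <= Phi} & l = \sum_(a <- s) checkv a /\ forall a, a \in s -> 2 <= dot l a.
Proof.
move=> [s sP lE]; have [k] := ubnP (size s); elim: k s sP lE => // k IH s sP lE.
rewrite ltnS => szs.
have [pos|neg] := pselect (forall a b, a \in s -> b \in rem a s -> 0 <= dot b a).
  exists s => //; split=> // a a_s; have a_nz := root_nz (sP a a_s).
  rewrite {}lE (perm_big _ (perm_to_rem a_s)) big_cons /= dotDl dot_checkv_self // lerDl.
  rewrite dot_suml big_seq sumr_ge0 // => b b_r.
  have b_nz := root_nz (sP b (mem_rem b_r)).
  by rewrite leNgt dot_checkv_lt0 // -leNgt; exact: pos.
have [a [b [a_s b_r ba]]] : exists a b, [/\ a \in s, b \in rem a s & dot b a < 0].
  apply: contrapT => no; apply: neg => a b a_s b_r; rewrite leNgt; apply/negP => ba.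
  by apply: no; exists a, b.
pose r := rem b (rem a s).
have pr : perm_eq s (a :: b :: r).
  by apply: (perm_trans (perm_to_rem a_s)); rewrite perm_cons perm_to_rem.
have aP := sP a a_s; have bP := sP b (mem_rem b_r).
have rP : {subset r <= Phi} by move=> c /mem_rem/mem_rem/sP.
have lE' : l = (checkv a + checkv b) + \sum_(c <- r) checkv c.
  by rewrite lE (perm_big _ pr) /= !big_cons /= addrA.
have szr : ((size r).+1 < k)%N.
  by apply: leq_trans szs; rewrite (perm_size pr).
have ab : dot a b < 0 by rewrite dotC.
have [e|[d dP e]] := coroot_add aP bP ab.
  by apply: (IH r) => //; [rewrite lE' e add0r|exact: ltnW].
apply: (IH (d :: r)) => //; last by rewrite big_cons lE' e.
by move=> c; rewrite inE => /orP[/eqP->|/rP].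
Qed.

(** The common content of minuscule and quasiminuscule, in a form stable under reflections. *)
Definition small_pairing t : Prop := coweight Phi t /\ forall a, a \in Phi ->
  [\/ -1 <= dot t a <= 1, t = checkv a | t = - checkv a].

Lemma small_pairing_refl a t : a \in Phi -> small_pairing t -> small_pairing (reflv a t).
Proof.
move=> aP [tP h]; have a_nz := root_nz aP; split=> b bP.
  by rewrite reflv_adj tP // root_reflE.
have := h (reflv a b); rewrite root_reflE // => /(_ bP) [h'|->|->].
- by constructor 1; rewrite reflv_adj.
- by constructor 2; rewrite -reflv_checkv // reflvK.
by constructor 3; rewrite -reflv_checkv // reflvN reflvK.
Qed.

Lemma minuscule_small p : minuscule_or_quasi Phi p -> small_pairing p.
Proof.
move=> [_ [[pP h]|[[a aP ->] h]]]; first by split=> // a /h; constructor 1.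
split; first exact: coweight_checkv.
move=> b bP; have := h b bP; rewrite checkvK => h'.
have [->|ba] := eqVneq b a; first by constructor 2.
have [->|bNa] := eqVneq b (- a); first by constructor 3; rewrite checkvN opprK.
by constructor 1; apply: h'; exact/eqP.
Qed.

Variable p : 'rV[R]_n.
Hypothesis p_small : small_pairing p.
Hypothesis p_neq0 : p <> 0.

Lemma orbit_ind (P : 'rV[R]_n -> Prop) : P p -> (forall a t, a \in Phi -> P t -> P (reflv a t)) ->
  forall t, W_orbit Phi p t -> P t.
Proof.
move=> Pp Pr t [s sP <-]; elim: s sP => //= a s IH sP.
apply: Pr; first by apply: sP; rewrite mem_head.
by apply: IH => b bs; apply: sP; rewrite inE bs orbT.
Qed.

Lemma orbit_refl a t : a \in Phi -> W_orbit Phi p t -> W_orbit Phi p (reflv a t).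
Proof.
move=> aP [s sP <-]; exists (a :: s) => //= b.
by rewrite inE => /orP[/eqP->|/sP].
Qed.

Lemma orbit_self : W_orbit Phi p p.
Proof. by exists [::]. Qed.

Lemma orbit_small t : W_orbit Phi p t -> small_pairing t.
Proof. by apply: orbit_ind => // a {}t aP; exact: small_pairing_refl. Qed.

Lemma orbit_norm t : W_orbit Phi p t -> dot t t = dot p p.
Proof.
apply: (@orbit_ind (fun t => dot t t = dot p p)) => // a {}t aP.
by rewrite reflv_iso // (root_nz aP).
Qed.

Lemma orbit_lattice t : W_orbit Phi p t -> coroot_lattice (t - p).
Proof.
move=> tW; have [] : W_orbit Phi p t /\ coroot_lattice (t - p); last by [].
apply: (@orbit_ind (fun t => W_orbit Phi p t /\ coroot_lattice (t - p))) tW.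
  by split; [exact: orbit_self|rewrite subrr; exact: coroot_lattice0].
move=> a {}t aP [tW h]; split; first exact: orbit_refl.
have [tP _] := orbit_small tW; have [k kE] := coweight_pairing tP aP.
rewrite reflvE (dotC a) kE scaler_int addrAC; apply: coroot_latticeB => //.
by apply: coroot_latticeMz => //; exact: coroot_lattice_root.
Qed.

Lemma orbit_list : exists2 T : seq 'rV[R]_n, uniq T & forall t, t \in T <-> W_orbit Phi p t.
Proof.
pose K := \max_(a <- Phi) Num.bound (dot p p + dot a a).
have [C uC hC] := coweight_ball K.
exists [seq t <- C | `[< W_orbit Phi p t >]]; first exact: filter_uniq.
move=> t; rewrite mem_filter; split=> [/andP[/asboolP //]|tW].
apply/andP; split; first exact/asboolP.
apply/hC; have [tP _] := orbit_small tW; split=> // a aP.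
have h : `|dot t a| <= dot p p + dot a a.
  have h1 := dot_ge0 (t - a); have h2 := dot_ge0 (t + a).
  move: h1 h2; rewrite !(dotBl, dotBr, dotDl, dotDr) (dotC a t) (orbit_norm tW) => h1 h2.
  have pp := dot_ge0 p; have aa := dot_ge0 a.
  rewrite ler_norml; apply/andP; split; lra.
apply: (le_trans h); apply: (le_trans (ltW (archi_boundP _))).
  by rewrite addr_ge0 ?dot_ge0.
rewrite ler_nat.
exact: (@leq_bigmax_seq _ (finmap.enum_fset Phi) xpredT
  (fun a => Num.bound (dot p p + dot a a)) a aP isT).
Qed.

Variable T : seq 'rV[R]_n.
Hypothesis uT : uniq T.
Hypothesis hT : forall t, t \in T <-> W_orbit Phi p t.

Lemma orbit_fsbig (V : Type) (idx : V) (op : Monoid.com_law idx) (F : 'rV[R]_n -> V) :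
  \big[op/idx]_(t \in W_orbit Phi p) F t = \big[op/idx]_(t <- T) F t.
Proof.
rewrite [RHS]fsbig_seq // (_ : [set` T] = W_orbit Phi p) //.
by apply/seteqP; split=> t /hT.
Qed.

Lemma orbit_big_refl (V : Type) (idx : V) (op : Monoid.com_law idx) a (F : 'rV[R]_n -> V) :
  a \in Phi -> \big[op/idx]_(t <- T) F (reflv a t) = \big[op/idx]_(t <- T) F t.
Proof.
move=> aP; have a_nz := root_nz aP.
rewrite -(big_map (reflv a) xpredT F); apply: perm_big; apply: uniq_perm => //.
  by rewrite map_inj_uniq //; exact: inv_inj (reflvK a_nz).
move=> t; apply/mapP/idP => [[t' /hT t'W ->]|/hT tW].
  by apply/hT; exact: orbit_refl.
by exists (reflv a t); rewrite ?reflvK //; apply/hT; exact: orbit_refl.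
Qed.

(** Membership in the convex hull of the orbit and 0, expressed by support functions. *)
Definition in_hull nu : Prop := forall u, dot nu u <= 0 \/ exists2 t, t \in T & dot nu u <= dot t u.

Lemma small_pairing_two t a : a \in Phi -> t \in T -> 2 <= dot t a -> t = checkv a.
Proof.
move=> aP /hT/orbit_small[_ /(_ a aP)] [/andP[_ h1] h2|//|->].
  by exfalso; lra.
rewrite dotNl dot_checkv_self ?(root_nz aP) // => h2.
by exfalso; lra.
Qed.

(** Some orbit point [t] pairs to at least 2 with [a], hence equals [a^vee]. Then [nu - t] is
    orthogonal to [t] while [nu] is no longer than [t], so they coincide. *)
Lemma hull_extreme nu a : in_hull nu -> a \in Phi -> 2 <= dot nu a -> nu \in T.
Proof.
move=> hull aP nua; have a_nz := root_nz aP.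
have [h|[t tT h]] := hull a; first by exfalso; lra.
have tE := small_pairing_two aP tT (le_trans nua h).
have ta : dot t a = 2 by rewrite tE dot_checkv_self.
have nu_a : dot nu a = 2 by lra.
have tt : dot nu t = dot t t.
  have ut u : dot u t = 2 / dot a a * dot u a by rewrite tE dotC dot_checkv (dotC a u).
  by rewrite !ut nu_a ta.
have norm : dot nu nu <= dot t t.
  have [h0|[t' t'T h']] := hull nu.
    exact: le_trans h0 (dot_ge0 _).
  have := dot_ge0 (t' - nu); rewrite !(dotBl, dotBr) (dotC nu t').
  have -> : dot t' t' = dot t t by rewrite !orbit_norm //; exact/hT.
  by move=> h0; lra.
suff -> : nu = t by [].
apply/eqP; rewrite -subr_eq0 -dot_eq0 eq_le dot_ge0 andbT.
by rewrite !(dotBl, dotBr) (dotC t nu) tt; lra.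
Qed.

(** Decompose [nu], or [t - nu] with [t] the orbit point extremal in direction [nu], by
    [coroot_decomposition]. A root of the decomposition either puts [nu] into the orbit by
    [hull_extreme] or forces [t = a^vee] and [nu] orthogonal to [a], which ends in [nu = 0]. *)
Lemma hull_lattice nu : in_hull nu ->
  coroot_lattice (nu - p) \/ coroot_lattice nu -> nu \in T \/ nu = 0.
Proof.
move=> hull; case=> [nuP|nuP]; last first.
  have [s sP [nuE h]] := coroot_decomposition nuP.
  case: s sP nuE h => [|a s] sP nuE h; first by right; rewrite nuE big_nil.
  left; apply: (hull_extreme hull (sP a (mem_head _ _))); exact: h (mem_head _ _).
have pT : p \in T by apply/hT; exact: orbit_self.
have [t tT tmax] := seq_argmax (dot^~ nu) pT.
have dom a : a \in Phi -> 0 < dot a nu -> 0 <= dot t a.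
  move=> aP anu; have rT : reflv a t \in T by apply/hT; apply: orbit_refl => //; exact/hT.
  have := tmax _ rT; rewrite reflvE dotBl (dotZl _ (checkv a)) gerBl.
  by rewrite pmulr_lge0 ?dot_checkv_gt0 ?(root_nz aP) // dotC.
have dP : coroot_lattice (t - nu).
  have := coroot_latticeB (orbit_lattice (proj1 (hT t) tT)) nuP.
  by rewrite opprB addrA subrK.
have [s sP [dE h]] := coroot_decomposition dP.
have [[a a_s anu]|no] := pselect (exists2 a, a \in s & dot nu a < 0).
  have NaP : - a \in Phi by rewrite rootN // sP.
  left; apply: (hull_extreme hull NaP); rewrite dotNr.
  have := h a a_s; rewrite dotBl.
  have := dom (- a) NaP; rewrite pos_negE (dotC a) dotNr => /(_ anu); lra.
have sE a : a \in s -> t = checkv a /\ dot nu a = 0.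
  move=> a_s; have nua : 0 <= dot nu a.
    by rewrite leNgt; apply/negP => anu; apply: no; exists a.
  have := h a a_s; rewrite dotBl => ta.
  have tE := small_pairing_two (sP a a_s) tT (_ : 2 <= dot t a).
  have e : t = checkv a by apply: tE; lra.
  split=> //; move: ta; rewrite e dot_checkv_self ?(root_nz (sP a a_s)) //; lra.
case: s sP dE h sE {no} => [|a s] sP dE h sE.
  by left; move: dE; rewrite big_nil => /eqP; rewrite subr_eq0 => /eqP <-.
right; have [tE nua] := sE a (mem_head _ _).
have a_nz := root_nz (sP a (mem_head _ _)).
(* All coroots in the decomposition equal [t]; pairing with [a] shows that there is just one. *)
have dE' : t - nu = (size (a :: s))%:R *: t.
  rewrite dE (eq_big_seq (fun _ => t)); last by move=> b /sE[<-].
  by rewrite big_const_seq count_predT iter_addr_0 scaler_nat.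
have : dot (t - nu) a = (size (a :: s))%:R * 2 by rewrite dE' dotZl tE dot_checkv_self.
rewrite dotBl nua tE dot_checkv_self // subr0 => h2.
have k1 : (size (a :: s))%:R = 1 :> R by lra.
by move: dE'; rewrite k1 scale1r => /eqP; rewrite subr_eq addrC -subr_eq subrr eq_sym => /eqP.
Qed.

Lemma dominant_chamber t v0 : regular v0 -> t \in T -> exists v,
  [/\ regular v, forall a, a \in Phi -> 0 < dot a t -> 0 < dot a v,
      forall t', t' \in T -> t' != t -> dot t' v < dot t v & 0 < dot t v].
Proof.
move=> rv0 tT; have tt : 0 < dot t t.
  by rewrite orbit_norm; [rewrite dot_gt0; exact/eqP|exact/hT].
have [N1 h1] := large_comb (finmap.enum_fset Phi) t v0.
have [N2 h2] := large_comb (t :: [seq t - t' | t' <- T]) t v0.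
pose v := (maxn N1 N2)%:R *: t + v0.
have av a : a \in Phi -> 0 < dot a t -> 0 < dot a v by apply: h1; exact: leq_maxl.
have tv l : l \in t :: [seq t - t' | t' <- T] -> 0 < dot l t -> 0 < dot l v.
  by apply: h2; exact: leq_maxr.
exists v; split=> //.
- move=> a aP; have [at0|at0|at0] := ltgtP (dot a t) 0.
  + have NaP : - a \in Phi by rewrite rootN.
    have := av (- a) NaP; rewrite !pos_negE => /(_ at0) h; by rewrite lt_eqF.
  + by rewrite gt_eqF // av.
  by rewrite dotDr dotZr at0 mulr0 add0r rv0.
- move=> t' t'T t't; rewrite -subr_gt0 -dotBl; apply: tv.
    by rewrite inE; apply/orP; right; apply/mapP; exists t'.
  have : 0 < dot (t - t') (t - t') by rewrite dot_gt0 subr_eq0 eq_sym.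
  rewrite !(dotBl, dotBr) (dotC t t') (_ : dot t' t' = dot t t); first lra.
  by rewrite !orbit_norm //; exact/hT.
by apply: tv => //; rewrite mem_head.
Qed.

End Orbits.

(** * Quasi-invariance as linear equations *)

Section StringEquations.
Implicit Types (a b u v w t l : 'rV[R]_n) (S B : seq 'rV[R]_n) (c : 'rV[R]_n -> R[i]).

Definition same_string a t l : Prop := exists j : int, l = t + checkv a *~ j.

Definition supported B c : Prop := forall l, c l != 0 -> l \in B.

(** The common shape of [wave_eqs] and [limit_eqs]. Quantifying over all duplicate-free lists that
    contain the support makes the equations independent of the chosen list. *)
Definition string_eqs (D : 'rV[R]_n -> Prop) (g : 'rV[R]_n -> nat -> 'rV[R]_n -> R[i]) c : Prop :=
  forall a s t B, a \in Phi -> D a -> (1 <= s <= m a)%N -> coweight Phi t ->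
    uniq B -> supported B c ->
    \sum_(l <- B | `[< same_string a t l >]) c l * g a s l = 0.

Lemma string_eqs_intro D g c B : uniq B -> supported B c ->
  (forall a s t, a \in Phi -> D a -> (1 <= s <= m a)%N -> coweight Phi t ->
    \sum_(l <- B | `[< same_string a t l >]) c l * g a s l = 0) -> string_eqs D g c.
Proof.
move=> uB sB h a s t B' aP Da sm tP uB' sB'; rewrite -[RHS](h a s t) //.
have vanish C : supported C c -> forall l, c l * g a s l != 0 -> l \in C.
  by move=> sC l; rewrite mulf_eq0 negb_or => /andP[/sC].
by apply: big_support => //; exact: vanish.
Qed.

Lemma string_eqs_lin D g c1 c2 k1 k2 B1 B2 : supported B1 c1 -> supported B2 c2 ->
  string_eqs D g c1 -> string_eqs D g c2 -> string_eqs D g (fun l => k1 * c1 l + k2 * c2 l).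
Proof.
move=> s1 s2 h1 h2; pose B := undup (B1 ++ B2).
have s1' : supported B c1 by move=> l /s1 h; rewrite mem_undup mem_cat h.
have s2' : supported B c2 by move=> l /s2 h; rewrite mem_undup mem_cat h orbT.
apply: (@string_eqs_intro _ _ _ B); rewrite ?undup_uniq //.
  move=> l; apply: contraNT => lB.
  have -> : c1 l = 0 by apply/eqP; apply: contraNT lB; exact: s1'.
  have -> : c2 l = 0 by apply/eqP; apply: contraNT lB; exact: s2'.
  by rewrite !mulr0 addr0.
move=> a s t aP Da sm tP.
rewrite (eq_bigr (fun l => k1 * (c1 l * g a s l) + k2 * (c2 l * g a s l))); last first.
  by move=> l _; ring.
by rewrite big_split /= -!mulr_sumr h1 ?h2 ?undup_uniq // !mulr0 addr0.
Qed.

Lemma supported_shift c lam B : supported B c ->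
  supported [seq l + lam | l <- B] (fun l => c (l - lam)).
Proof. by move=> h l /h lB; apply/mapP; exists (l - lam); rewrite ?subrK. Qed.

Lemma string_eqs_shift D g g' c lam B : coweight Phi lam -> uniq B -> supported B c ->
  (forall a s l, a \in Phi -> g' a s l = g a s (l - lam)) ->
  string_eqs D g c -> string_eqs D g' (fun l => c (l - lam)).
Proof.
move=> lamP uB sB gg' h; apply: (@string_eqs_intro _ _ _ [seq l + lam | l <- B]).
- by rewrite map_inj_uniq //; exact: addIr.
- exact: supported_shift.
move=> a s t aP Da sm tP; rewrite big_map.
rewrite -[RHS](h a s (t - lam) B) //; last exact: coweightB.
apply: eq_big => [l|l _]; last by rewrite gg' // addrK.
apply/asboolP/asboolP => -[j e]; exists j; first by rewrite addrAC -e addrK.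
by rewrite e addrAC subrK.
Qed.

(* index of [l] on the [a]-string through [t] *)
Definition string_pos a t l : int := Num.floor (dot (l - t) a / 2).

Lemma string_posE a t (j : int) : a \in Phi -> string_pos a t (t + checkv a *~ j) = j.
Proof.
move=> aP; rewrite /string_pos addrC addKr dotMzl dot_checkv_self ?(root_nz aP) //.
by rewrite -[2 *~ j]mulrzr mulrC mulKf ?pnatr_eq0 // intrKfloor.
Qed.

Lemma string_spread_size S a k : a \in Phi -> uniq S ->
  (forall t, t \in S -> (k < size [seq l <- S | `[< same_string a t l >]])%N) ->
  string_spread S a k.
Proof.
move=> aP uS h t tS; pose T := [seq l <- S | `[< same_string a t l >]].
have tT : t \in T.
  by rewrite mem_filter tS andbT; apply/asboolP; exists 0; rewrite mulr0z addr0.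
have TP l : l \in T -> l \in S /\ l = t + checkv a *~ string_pos a t l.
  by rewrite mem_filter => /andP[/asboolP[j ->] lS]; rewrite string_posE.
have [l1 l1T max1] := seq_argmax (string_pos a t) tT.
have [l2 l2T max2] := seq_argmax (fun l => - string_pos a t l) tT.
have {}max2 y : y \in T -> string_pos a t l2 <= string_pos a t y.
  by move=> /max2; rewrite lerN2.
have [l1S e1] := TP _ l1T; have [l2S e2] := TP _ l2T.
exists (string_pos a t l1), (- string_pos a t l2).
split; [by rewrite -e1|by rewrite mulrNz opprK -e2|].
have := h t tS; rewrite -/T => kT.
pose N := (absz (string_pos a t l1 - string_pos a t l2)%R).+1.
have : (size (map (string_pos a t) T) <=
        size [seq (string_pos a t l2 + i%:Z)%R | i <- iota 0 N])%N.
  apply: uniq_leq_size.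
    rewrite map_inj_in_uniq; first by rewrite filter_uniq.
    by move=> x y /TP[_ ex] /TP[_ ey] exy; rewrite ex ey exy.
  move=> j /mapP[l lT ->]; have h1 := max1 l lT; have h2 := max2 l lT.
  apply/mapP; exists (absz (string_pos a t l - string_pos a t l2)%R).
    by rewrite mem_iota /N; move: h1 h2; clear; lia.
  by move: h1 h2; clear; lia.
rewrite !size_map size_iota /N => hN.
have h1 := max1 _ l2T.
move: kT hN h1; clear; lia.
Qed.

(** A string with at most [k] support points and distinct nodes would be annihilated by
    [vandermonde_sums]. *)
Lemma string_spread_vandermonde B a k c (g U : 'rV[R]_n -> R[i]) :
  a \in Phi -> uniq B -> supported B c ->
  (forall l, c l != 0 -> g l != 0) ->
  (forall l l', c l != 0 -> c l' != 0 -> same_string a l l' -> U l = U l' -> l = l') ->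
  (forall t j, c t != 0 -> (j < k)%N ->
    \sum_(l <- B | `[< same_string a t l >]) (c l * g l) * U l ^+ j = 0) ->
  string_spread [seq l <- B | c l != 0] a k.
Proof.
move=> aP uB sB g0 injU h; apply: string_spread_size; rewrite ?filter_uniq // => t.
rewrite mem_filter => /andP[ct tB]; rewrite ltnNge; apply/negP => szT.
set T := [seq l <- _ | `[< _ >]] in szT.
have memT l : l \in T -> [/\ c l != 0 & same_string a t l].
  by rewrite mem_filter => /andP[/asboolP ? ]; rewrite mem_filter => /andP[].
have tT : t \in T.
  rewrite mem_filter mem_filter ct tB !andbT.
  by apply/asboolP; exists 0; rewrite mulr0z addr0.
have : c t * g t = 0.
  apply: (@vandermonde_sums _ _ T (fun l => c l * g l) U k) => //.
  - by rewrite !filter_uniq.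
  - move=> l l' /memT[cl [j e]] /memT[cl' [j' e']]; apply: injU => //.
    by exists (j' - j); rewrite e e' mulrzBr addrA addrAC addrK.
  move=> j jk; rewrite -[RHS](h t j ct jk) big_filter big_filter_cond.
  rewrite [RHS](bigID (fun l => c l != 0)) /= [X in _ + X]big1 ?addr0.
    by apply: eq_bigl => l; rewrite andbC.
  by move=> l /andP[_]; rewrite negbK => /eqP->; rewrite !mul0r.
by apply/eqP; rewrite mulf_neq0 ?g0.
Qed.

(** Placing the vertex [rvee v] of N at a maximum [s0] of [S] in direction [v], the hull of [S]
    contains the resulting translate of N. *)
Lemma top_bound S v : regular v -> S != [::] ->
  (forall a, a \in Phi -> string_spread S a (m a)) ->
  exists2 s0, s0 \in S & forall u, exists2 t, t \in S &
    dot (s0 - rvee v) u + hN u <= dot t u.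
Proof.
move=> rv; case eS: S => [//|s1 S1] _; rewrite -eS => spread.
have [s0 s0S smax] : exists2 s, s \in S & forall y, y \in S -> dot y v <= dot s v.
  by apply: (seq_argmax (dot^~ v) (x0 := s1)); rewrite eS mem_head.
exists s0 => // u.
have [t tS h] := spread_bound (k := m) u rv s0S smax (fun a aP _ => spread a aP).
exists t => //; apply: le_trans h; rewrite (hN_max _ rv) dotBl; lra.
Qed.

(** No strings in direction [a] are available, so [spread_bound] is applied with multiplicity 0 at
    [a], in the direction [u] of the component of [s0 - rvee v] orthogonal to [a]. There [a] does
    not contribute to [hN] either, and the bound forces [u = 0]. *)
Lemma wall_bound S v a (k : nat) : regular v -> a \in Phi -> 0 < dot a v -> S != [::] ->
  (forall b, b \in Phi -> b != a -> b != - a -> string_spread S b (m b)) ->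
  (forall s u, s \in S -> dot s u <= hN u + k%:R * Num.max 0 (dot (checkv a) u)) ->
  exists2 s0, s0 \in S & exists r : R, s0 = rvee v + r *: checkv a.
Proof.
move=> rv aP av; case eS: S => [//|s1 S1] _; rewrite -eS => spread bd.
have [s0 s0S smax] : exists2 s, s \in S & forall y, y \in S -> dot y v <= dot s v.
  by apply: (seq_argmax (dot^~ v) (x0 := s1)); rewrite eS mem_head.
exists s0 => //; pose kk b := if b == a then 0%N else m b.
pose d := s0 - rvee v; have a_nz := root_nz aP.
pose u := d - (dot (checkv a) d / 2) *: a.
have au : dot (checkv a) u = 0.
  by rewrite /u dotBr (dotZr _ (checkv a)) dot_checkv_self //; field.
have [|t tS h] := spread_bound (k := kk) u rv s0S smax.
  move=> b bP bv; rewrite /kk; case: eqVneq => [_|ba]; first exact: string_spread0.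
  by apply: spread => //; apply: contraTneq bv => ->; rewrite pos_negE -leNgt ltW.
have := le_trans h (bd t u tS); rewrite au max_l // mulr0 addr0 (hN_max _ rv).
rewrite big_seq_cond [X in _ <= _ + X]big_seq_cond.
rewrite [X in _ <= _ + X](eq_bigr (fun b => (kk b)%:R * Num.max 0 (- dot (checkv b) u))).
  rewrite lerD2r -subr_le0 -dotBl -/d => du.
  have : dot u u <= 0.
    rewrite {1}/u dotBl (dotZl _ a) (_ : dot a u = 0) ?mulr0 ?subr0 //.
    by apply/eqP; rewrite -dot_checkv_eq0 // au.
  rewrite le_eqVlt ltNge dot_ge0 orbF dot_eq0 => /eqP u0.
  exists (dot (checkv a) d / 2 * (dot a a / 2)).
  rewrite /checkv scalerA mulrAC -mulrA [X in _ * X](_ : _ = 1).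
    by rewrite mulr1 -/(checkv a); apply/eqP; rewrite addrC -subr_eq -/d -subr_eq0 -/u u0.
  by field; rewrite dot_eq0.
move=> b _; rewrite /kk; case: eqVneq => [->|//].
by rewrite au oppr0 max_l // !mulr0.
Qed.

End StringEquations.

Section QuasiInvariance.
Implicit Types (a b u v w t l : 'rV[R]_n) (S B : seq 'rV[R]_n) (c : 'rV[R]_n -> R[i]).
Implicit Types (x y z : 'rV[R[i]]_n).

Lemma real_complex_int (k : int) : ((k%:~R : R)%:C)%C = k%:~R :> R[i].
Proof. exact: rmorph_int. Qed.

Lemma even_or_odd (k : int) : exists j : int, k = j + j \/ k = j + j + 1.
Proof. by exists (k %/ 2)%Z; move: k; clear => k; lia. Qed.

(** Along the part of [d] orthogonal to [a] the condition on [z] holds trivially, and the character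
    would take the value [q] there. Along [a], with [q^kap = -1], it takes the value [(-1)^(d,a)].
    So [d] is a multiple of [a] with even pairing. *)
Lemma character_separation a d : a \in Phi -> coweight Phi d ->
  (forall z, e (2 * pr (checkv a) z) = 1 -> e (2 * pr d z) = 1) ->
  exists k : int, d = checkv a *~ k.
Proof.
move=> aP dP h; have a_nz := root_nz aP.
have aa : dot a a != 0 by rewrite dot_eq0.
pose r := dot (checkv a) d / 2; pose u := d - r *: a.
have au : dot (checkv a) u = 0.
  by rewrite /u dotBr (dotZr _ (checkv a)) dot_checkv_self // /r; field.
have du : dot d u = dot u u.
  rewrite {2}/u dotBl (dotZl _ a) (_ : dot a u = 0) ?mulr0 ?subr0 //.
  by apply/eqP; rewrite -dot_checkv_eq0 // au.
have u0 : u = 0.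
  apply/eqP; rewrite -dot_eq0; apply/negPn/negP => uu.
  have uuC : (dot u u)%:C != 0 :> R[i] by rewrite eq_complex /= eqxx andbT.
  have := h ((2 * (dot u u)%:C)^-1 *: cplx u).
  rewrite !(dotZr _ _ (cplx u)) !dot_cplx au du mulr0 mulr0 qpow0 => /(_ erefl).
  rewrite (_ : 2 * _ = 1); last by field; rewrite uuC.
  rewrite qpow1 => q1; have := q_nonroot (ltn0Sn 0).
  by rewrite expr1 q1 eqxx.
have dE : d = r *: a by apply/eqP; rewrite -subr_eq0 -/u u0.
have [k kE] := coweight_pairing dP aP.
have [kap kapE] := qpow_half_period.
have kap2 : e (kap + kap) = 1 by rewrite qpowD kapE mulrNN mulr1.
have := h ((kap / 2) *: cplx a).
rewrite !(dotZr _ _ (cplx a)) !dot_cplx dot_checkv_self // kE.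
rewrite (_ : 2 * _ = kap + kap); last first.
  by rewrite -[2%:R%:C]/((2%:Z%:~R : R)%:C)%C real_complex_int; field.
rewrite real_complex_int (_ : 2 * _ = kap *~ k); last first.
  by rewrite -mulrzr; field.
move=> /(_ kap2); have [j [kj|kj]] := even_or_odd k.
  move=> _; exists j; rewrite dE /checkv -scaler_int scalerA; congr (_ *: _).
  apply: (mulIf aa); rewrite -(dotZl r a) -dE kE kj rmorphD /=; field; exact: aa.
rewrite kj !mulrzDr -mulrzDl mulr1z qpowD qpowMz kap2 exp1rz mul1r kapE => /eqP.
by rewrite eqNr oner_eq0.
Qed.

Lemma string_characters a t l : a \in Phi -> coweight Phi t -> coweight Phi l ->
  `[< same_string a t l >] =
  `[< forall z, e (2 * pr (checkv a) z) = 1 -> e (2 * pr l z) = e (2 * pr t z) >].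
Proof.
move=> aP tP lP; apply/asboolP/asboolP => [[j ->] z h|h].
  rewrite cplxD dotDl cplxMz dotMzl mulrDr qpowD mulrzAr qpowMz h exp1rz mulr1 //.
have [z hz|k dE] := character_separation aP (coweightB lP tP).
  by rewrite cplxB dotBl mulrBr qpowB h // divff ?qpow_neq0.
by exists k; rewrite -dE addrC subrK.
Qed.

(** Shifting [z] by [s a / 2] in both directions and subtracting turns the exponentials into these
    brackets. *)
Definition wave_eqs x c : Prop :=
  string_eqs (fun _ => True) (fun a s l => br (s%:R * (pr a x + (dot a l)%:C))) c.

Lemma string_sums (I : eqType) (s : seq I) (nu : I -> 'rV[R]_n) (c : I -> R[i]) a t :
  (forall i, i \in s -> coweight Phi (nu i)) -> a \in Phi ->
  (forall z, e (2 * pr (checkv a) z) = 1 -> \sum_(i <- s) c i * e (2 * pr (nu i) z) = 0) ->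
  \sum_(i <- s | `[< same_string a t (nu i) >]) c i = 0.
Proof.
move=> sP aP sum0.
have [/hasP[i0 i0s /asboolP i0t]|no] := boolP (has (fun i => `[< same_string a t (nu i) >]) s); last first.
  by rewrite big_hasC.
pose G := [set z : 'rV[R[i]]_n | e (2 * pr (checkv a) z) = 1].
pose X i z := e (2 * pr (nu i) z).
have cls i : i \in s -> `[< same_string a t (nu i) >] = `[< forall z, G z -> X i z = X i0 z >].
  move=> i_s; rewrite -(string_characters aP (sP i0 i0s) (sP i i_s)).
  move: i0t => [j0 ->]; apply/asboolP/asboolP => -[j ->].
    by exists (j - j0); rewrite mulrzBr addrA addrAC addrK.
  by exists (j0 + j); rewrite mulrzDr addrA.
rewrite big_seq_cond (eq_bigl (fun i => (i \in s) && `[< forall z, G z -> X i z = X i0 z >])).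
  rewrite -big_seq_cond; apply: (@character_sums _ _ _ G s c X) => //.
  - by rewrite /G /= dot0r mulr0 qpow0.
  - by move=> y z; rewrite /G /= dotDr mulrDr qpowD => -> ->; rewrite mulr1.
  - by move=> i; rewrite /X dot0r mulr0 qpow0.
  - by move=> i y z; rewrite /X dotDr mulrDr qpowD.
by move=> i; case: (boolP (i \in s)) => //= /cls ->.
Qed.

Lemma quasi_invariant_sums (I : eqType) (s : seq I) (nu : I -> 'rV[R]_n) (c : I -> R[i]) x :
  (forall i, i \in s -> coweight Phi (nu i)) ->
  quasi_invariant lq Phi m
    (fun z => e (2 * dot x z) * \sum_(i <- s) c i * e (2 * pr (nu i) z)) ->
  forall a k t, a \in Phi -> (1 <= k <= m a)%N -> coweight Phi t ->
  \sum_(i <- s | `[< same_string a t (nu i) >])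
     c i * br (k%:R * (pr a x + (dot a (nu i))%:C)) = 0.
Proof.
move=> sP qi a k t aP km tP; apply: string_sums => // z Gz; have := qi a k z aP km Gz.
have half (w : R[i]) (y : 'rV[R[i]]_n) :
    2 * dot y (z + w *: cplx a) = 2 * dot y z + 2 * w * dot y (cplx a).
  by rewrite dotDr (dotZr _ y (cplx a)); ring.
have Fw (w : R[i]) : e (2 * dot x (z + w *: cplx a)) *
    (\sum_(i <- s) c i * e (2 * pr (nu i) (z + w *: cplx a))) =
    e (2 * dot x z) * \sum_(i <- s) c i * e (2 * pr (nu i) z) *
      e (2 * w * (pr a x + (dot a (nu i))%:C)).
  rewrite [LHS]mulr_sumr [RHS]mulr_sumr; apply: eq_bigr => i _.
  rewrite !half dot_cplx (dotC x (cplx a)) (dotC (nu i) a).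
  by rewrite (mulrDr (2 * w)) !qpowD; ring.
rewrite -(scaleNr (k%:R / 2)) !Fw => /(mulfI (qpow_neq0 _)) /eqP.
rewrite -subr_eq0 -sumrB => /eqP E; rewrite -[RHS]E; apply: eq_bigr => i _.
rewrite -mulrBr [LHS]mulrAC /qbr; congr (_ * (e _ - e _)); by field.
Qed.

Definition nondegenerate a (K : nat) x : Prop :=
  forall k : int, `|k| <= K%:Z -> br (pr a x + k%:~R) != 0.

(** The nodes [u + u^-1] of two weights coincide only if the weights do or if the two values of [u]
    are inverse to each other. The latter would be a vanishing bracket at the midpoint of the two
    pairings. *)
Lemma wave_spread x c B a K : wave_eqs x c -> uniq B -> supported B c ->
  (forall l, l \in B -> coweight Phi l) -> (forall l, l \in B -> `|dot l a| <= K%:R) ->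
  a \in Phi -> nondegenerate a K x -> string_spread [seq l <- B | c l != 0] a (m a).
Proof.
move=> we uB sB BP BK aP nd.
pose u l := e (pr a x + (dot a l)%:C).
have pairing l : l \in B -> exists2 k : int, dot a l = k%:~R & `|k| <= K%:Z.
  move=> lB; have [k kE] := coweight_pairing (BP l lB) aP.
  exists k; rewrite ?(dotC a) //; have := BK l lB.
  by rewrite kE -intr_norm -[K%:R]/(K%:Z%:~R) ler_int.
apply: (@string_spread_vandermonde _ _ _ c
   (fun l => u l - (u l)^-1) (fun l => u l + (u l)^-1)) => //.
- move=> l /sB /pairing[k kE kK]; rewrite /u kE real_complex_int -qpowN.
  exact: nd.
- move=> l l' /sB lB /sB l'B [j l'E] uu'.
  have [k kE kK] := pairing l lB; have [k' k'E k'K] := pairing l' l'B.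
  have k'j : k' = k + j + j.
    apply/eqP; rewrite -(eqr_int R) -k'E l'E dotDr dotMzr kE !rmorphD /=.
    by rewrite dotC dot_checkv_self ?(root_nz aP) // -mulrzr mulr_natl mulr2n addrA.
  have ul : u l != 0 by exact: qpow_neq0.
  have ul' : u l' != 0 by exact: qpow_neq0.
  have : (u l - u l') * (1 - (u l * u l')^-1) = 0.
    have /eqP := uu'; rewrite -subr_eq0 => /eqP uu; rewrite -[RHS]uu.
    by field; rewrite ul ul'.
  move=> /eqP; rewrite mulf_eq0 => /orP[|].
    rewrite subr_eq0 /u kE k'E !real_complex_int => /eqP h.
    have : e k%:~R = e k'%:~R by apply: (mulfI (qpow_neq0 (pr a x))); rewrite -!qpowD.
    move=> /qpow_int_inj kk'.
    have j0 : j = 0 by move: k'j; rewrite -kk'; clear; lia.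
    by rewrite l'E j0 mulr0z addr0.
  have k1 : `|k + j| <= K%:Z by move: kK k'K k'j; clear; lia.
  rewrite subr_eq0 => /eqP h2.
  have uu1 : u l * u l' = 1 by rewrite -[LHS]invrK -h2 invr1.
  have := nd _ k1; rewrite qbr_eq0 => /negP[]; apply/eqP; rewrite -[RHS]uu1.
  rewrite /u kE k'E !real_complex_int -qpowD k'j !intrD; congr (e _); ring.
move=> t j ct jm; rewrite -big_filter.
apply: (@symmetric_sums _ _ _ c u (m a)) => // [l|s sm]; first exact: qpow_neq0.
rewrite -[RHS](we a s t B aP I sm (BP t (sB t ct)) uB sB) big_filter.
apply: eq_bigr => l _; congr (_ * _).
by rewrite /u -!qpowMn /qbr -qpowN mulr_natl.
Qed.

(* The limit of wave_eqs at x + t y as q^t -> 0, where one of the two exponentials *)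
(* in each bracket with (a,y) < 0 dominates *)
Definition limit_eqs (y : 'rV[R]_n) c : Prop :=
  string_eqs (fun a => dot a y < 0) (fun a s l => e (s%:R * (dot a l)%:C)) c.

(** Here the nodes are plain powers of [q], hence distinct. For a root positive on [y] the equations
    of its negative are used, the strings being the same. *)
Lemma limit_spread (y : 'rV[R]_n) c B a : limit_eqs y c -> regular y -> uniq B ->
  supported B c -> (forall l, l \in B -> coweight Phi l) ->
  a \in Phi -> string_spread [seq l <- B | c l != 0] a (m a).
Proof.
move=> le ry uB sB BP.
have main b : b \in Phi -> dot b y < 0 -> string_spread [seq l <- B | c l != 0] b (m b).
  move=> bP by0; pose u l := e (dot b l)%:C.
  have pairing l : l \in B -> exists k : int, dot b l = k%:~R.
    by move=> lB; rewrite dotC; exact: coweight_pairing (BP l lB) bP.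
  apply: (@string_spread_vandermonde _ _ _ c u u) => //.
  - by move=> l _; exact: qpow_neq0.
  - move=> l l' /sB lB /sB l'B [j l'E].
    have [k kE] := pairing l lB; have [k' k'E] := pairing l' l'B.
    rewrite /u kE k'E !real_complex_int => /qpow_int_inj kk'.
    have := k'E; rewrite l'E dotDr dotMzr kE kk' dotC dot_checkv_self ?(root_nz bP) //.
    move=> /(canRL (addKr _)); rewrite addNr => /eqP; rewrite mulrz_eq0 pnatr_eq0 orbF => /eqP ->.
    by rewrite mulr0z addr0.
  move=> t j ct jm.
  rewrite -[RHS](le b j.+1 t B bP by0 _ (BP t (sB t ct)) uB sB) //.
  apply: eq_bigr => l _; rewrite /u -qpowMn -mulrA -qpowD.
  by rewrite mulr_natl mulrS.
move=> aP; have := ry a aP; rewrite neq_lt => /orP[|ay]; first exact: main.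
have := main (- a) (rootN aP).
rewrite dotNl oppr_lt0 (mult_opp aP) => /(_ ay) h t tS.
have [i [j [iS jS ij]]] := h t tS; exists j, i; split; last by rewrite addrC.
  by move: jS; rewrite checkvN mulNrz opprK.
by move: iS; rewrite checkvN mulNrz.
Qed.

End QuasiInvariance.

(** * Trigonometric polynomials and generic points *)

Section TrigonometricFunctions.
Implicit Types (a b u v w l : 'rV[R]_n) (x z : 'rV[R[i]]_n) (t : R[i]).
Implicit Types (p r d : 'rV[R[i]]_n -> R[i]).

Lemma root_lattice0 : root_lattice Phi 0.
Proof. by exists (fun=> 0); rewrite big1 // => a _; rewrite mulr0z. Qed.

Lemma root_lattice_root a : a \in Phi -> root_lattice Phi a.
Proof.
move=> aP; exists (fun b => if b == a then 1 else 0).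
rewrite (big_rem a) //= eqxx mulr1z big_seq big1 ?addr0 // => b.
rewrite (mem_rem_uniq _ (fset_uniq Phi)) inE => /andP[/negbTE -> _].
by rewrite mulr0z.
Qed.

Lemma root_latticeD u v : root_lattice Phi u -> root_lattice Phi v -> root_lattice Phi (u + v).
Proof.
move=> [k ->] [j ->]; exists (fun a => k a + j a).
by rewrite -big_split; apply: eq_bigr => a _; rewrite mulrzDr.
Qed.

Lemma root_latticeMz u (k : int) : root_lattice Phi u -> root_lattice Phi (u *~ k).
Proof.
move=> [j ->]; exists (fun a => j a * k).
by rewrite mulrz_suml; apply: eq_bigr => a _; rewrite mulrzA.
Qed.

Lemma root_latticeN u : root_lattice Phi u -> root_lattice Phi (- u).
Proof. by move=> /(root_latticeMz (-1)); rewrite mulrNz mulr1z. Qed.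

Lemma root_lattice_pairing l v : root_lattice Phi l -> coweight Phi v ->
  exists k : int, dot l v = k%:~R.
Proof.
move=> [k ->] vP; apply/intrP; rewrite dot_suml big_seq rpred_sum // => a aP.
by rewrite dotMzl dotC rpredMz ?vP.
Qed.

Lemma trig_poly_canon p : trig_poly p -> exists s c,
  [/\ uniq s, forall l, l \in s -> root_lattice Phi l &
      forall x, p x = \sum_(l <- s) c l * e (pr l x)].
Proof.
move=> [s [c [sP pE]]]; exists (undup s), (fun l => c l *+ count_mem l s).
split; [exact: undup_uniq|by move=> l; rewrite mem_undup; exact: sP|move=> x].
rewrite pE -big_undup_iterop_count; apply: eq_bigr => l _.
by rewrite mulrnAl.
Qed.

Lemma trig_polyI p (L : seq ('rV[R]_n * R[i])) :
  (forall i, i \in L -> root_lattice Phi i.1) ->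
  (forall x, p x = \sum_(i <- L) i.2 * e (pr i.1 x)) -> trig_poly p.
Proof.
move=> LP pE; exists (undup [seq i.1 | i <- L]), (fun l => \sum_(i <- L | i.1 == l) i.2).
split=> [l|x]; first by rewrite mem_undup => /mapP[i /LP h ->].
rewrite pE (eq_bigr (fun l => \sum_(i <- L | i.1 == l) i.2 * e (pr i.1 x))); last first.
  by move=> l _; rewrite mulr_suml; apply: eq_bigr => i /eqP->.
rewrite (exchange_big_dep xpredT) //= big_seq [RHS]big_seq; apply: eq_bigr => i iL.
rewrite -big_filter (_ : [seq l <- _ | _] = [:: i.1]) ?big_seq1 //.
rewrite (eq_filter (a2 := pred1 i.1)); last by move=> l /=; rewrite eq_sym.
by rewrite filter_pred1_uniq ?undup_uniq // mem_undup map_f.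
Qed.

Lemma trig_polyE p : trig_poly p -> exists L : seq ('rV[R]_n * R[i]),
  (forall i, i \in L -> root_lattice Phi i.1) /\
  (forall x, p x = \sum_(i <- L) i.2 * e (pr i.1 x)).
Proof.
move=> [s [c [sP pE]]]; exists [seq (l, c l) | l <- s]; split=> [i /mapP[l /sP h ->] //|x].
by rewrite pE big_map.
Qed.

Lemma trig_poly_ext p r : p =1 r -> trig_poly p -> trig_poly r.
Proof. by move=> /funext ->. Qed.

Lemma trig_poly_exp l c : root_lattice Phi l -> trig_poly (fun x => c * e (pr l x)).
Proof.
move=> lP; apply: (@trig_polyI _ [:: (l, c)]) => [i|x]; last by rewrite big_seq1.
by rewrite inE => /eqP ->.
Qed.

Lemma trig_poly_const c : trig_poly (fun=> c).
Proof.
apply: trig_poly_ext (trig_poly_exp c root_lattice0) => x.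
by rewrite cplx0 dot0l qpow0 mulr1.
Qed.

Lemma trig_polyD p r : trig_poly p -> trig_poly r -> trig_poly (fun x => p x + r x).
Proof.
move=> /trig_polyE[L [LP pE]] /trig_polyE[M [MP rE]]; apply: (@trig_polyI _ (L ++ M)).
  by move=> i; rewrite mem_cat => /orP[/LP|/MP].
by move=> x; rewrite big_cat pE rE.
Qed.

Lemma trig_polyM p r : trig_poly p -> trig_poly r -> trig_poly (fun x => p x * r x).
Proof.
move=> /trig_polyE[L [LP pE]] /trig_polyE[M [MP rE]].
apply: (@trig_polyI _ [seq (i.1 + j.1, i.2 * j.2) | i <- L, j <- M]).
  by move=> _ /allpairsP[[i j] /= [/LP hi /MP hj ->]]; exact: root_latticeD.
move=> x; rewrite pE rE big_allpairs_dep [LHS]mulr_suml; apply: eq_bigr => i _.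
rewrite [LHS]mulr_sumr; apply: eq_bigr => j _ /=.
by rewrite cplxD dotDl qpowD; ring.
Qed.

Lemma trig_poly_sum (I : eqType) (s : seq I) (P : pred I) (F : I -> 'rV[R[i]]_n -> R[i]) :
  (forall i, i \in s -> P i -> trig_poly (F i)) -> trig_poly (fun x => \sum_(i <- s | P i) F i x).
Proof.
elim: s => [|i s IH] h.
  by apply: trig_poly_ext (trig_poly_const 0) => x; rewrite big_nil.
have {}IH : trig_poly (fun x => \sum_(i <- s | P i) F i x).
  by apply: IH => j js; apply: h; rewrite inE js orbT.
have [Pi|nPi] := boolP (P i).
  apply: trig_poly_ext (trig_polyD (h i (mem_head _ _) Pi) IH) => x.
  by rewrite big_cons Pi.
by apply: trig_poly_ext IH => x; rewrite big_cons (negbTE nPi).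
Qed.

Lemma trig_poly_prod (I : eqType) (s : seq I) (P : pred I) (F : I -> 'rV[R[i]]_n -> R[i]) :
  (forall i, i \in s -> P i -> trig_poly (F i)) -> trig_poly (fun x => \prod_(i <- s | P i) F i x).
Proof.
elim: s => [|i s IH] h.
  by apply: trig_poly_ext (trig_poly_const 1) => x; rewrite big_nil.
have {}IH : trig_poly (fun x => \prod_(i <- s | P i) F i x).
  by apply: IH => j js; apply: h; rewrite inE js orbT.
have [Pi|nPi] := boolP (P i).
  apply: trig_poly_ext (trig_polyM (h i (mem_head _ _) Pi) IH) => x.
  by rewrite big_cons Pi.
by apply: trig_poly_ext IH => x; rewrite big_cons (negbTE nPi).
Qed.

Lemma trig_poly_qbr l c : root_lattice Phi l -> trig_poly (fun x => br (pr l x + c)).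
Proof.
move=> lP; have := trig_polyD (trig_poly_exp (e c) lP)
  (trig_poly_exp (- e (- c)) (root_latticeN lP)).
apply: trig_poly_ext => x; rewrite /qbr opprD !qpowD cplxN dotNl; ring.
Qed.

Lemma trig_poly_shift p x0 : trig_poly p -> trig_poly (fun x => p (x + x0)).
Proof.
move=> /trig_polyE[L [LP pE]].
apply: (@trig_polyI _ [seq (i.1, i.2 * e (pr i.1 x0)) | i <- L]).
  by move=> _ /mapP[i /LP h ->].
move=> x; rewrite pE big_map; apply: eq_bigr => i _ /=.
by rewrite dotDr qpowD; ring.
Qed.

Lemma laurent_trig p x0 v : trig_poly p -> coweight Phi v ->
  laurent (fun t => p (x0 + t *: cplx v)).
Proof.
move=> /trig_polyE[L [LP pE]] vP.
rewrite (_ : (fun t => _) = (fun t => \sum_(i <- L) i.2 * e (pr i.1 (x0 + t *: cplx v)))).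
  elim: L LP {pE} => [|i L IH] LP.
    by rewrite (_ : (fun t => _) = fun=> 0); [exact: laurent_const|apply/funext => t; rewrite big_nil].
  rewrite (_ : (fun t => _) = fun t => i.2 * e (pr i.1 (x0 + t *: cplx v)) +
     \sum_(j <- L) j.2 * e (pr j.1 (x0 + t *: cplx v))).
    apply: laurentD; last by apply: IH => j jL; apply: LP; rewrite inE jL orbT.
    have [k kE] := root_lattice_pairing (LP i (mem_head _ _)) vP.
    rewrite (_ : (fun t => _) = fun t => i.2 * e (pr i.1 x0) * e (t *~ k)).
      by apply: laurentM (laurent_const _) (laurent_exp k).
    apply/funext => t; rewrite dotDr (dotZr t) dot_cplx kE real_complex_int mulrzr.
    by rewrite qpowD mulrA.
  by apply/funext => t; rewrite big_cons.
by apply/funext => t; rewrite pE.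
Qed.

Lemma trig_poly_line_neq0 p : trig_poly p -> (exists x, p x != 0) ->
  exists L : seq 'rV[R]_n, 0 \notin L /\
    forall v, coweight Phi v -> (forall l, l \in L -> dot l v != 0) ->
    exists t, p (t *: cplx v) != 0.
Proof.
move=> /trig_poly_canon[s [c [us sP pE]]] [x1 px1].
pose L := [seq l <- [seq i - j | i <- s, j <- s] | l != 0].
exists L; split; first by rewrite mem_filter eqxx.
move=> v vP vL; apply: contrapT => no.
have cls l : l \in s -> c l = 0.
  move=> ls; have := @character_sums R[i] R[i] _ setT s c (fun l t => e (t * (dot l v)%:C)) I.
  move=> /(_ (fun _ _ _ _ => I)) h.
  rewrite -[RHS](h _ _ _ l).
  - rewrite -big_filter (_ : [seq i <- s | _] = [:: l]) ?big_seq1 //.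
    rewrite -[RHS](filter_pred1_uniq us ls); apply: eq_in_filter => i i_s.
    apply/asboolP/eqP => [hi|-> //]; apply/eqP; rewrite -subr_eq0.
    apply: contraT => il; have := vL (i - l).
    rewrite mem_filter il /= => /(_ (allpairs_f _ i_s ls)); rewrite dotBl.
    have [k kE] := root_lattice_pairing (sP i i_s) vP.
    have [j jE] := root_lattice_pairing (sP l ls) vP.
    have := hi 1 I; rewrite !mul1r kE jE !real_complex_int.
    by move=> /qpow_int_inj ->; rewrite subrr eqxx.
  - by move=> i; rewrite mul0r qpow0.
  - by move=> i y z; rewrite mulrDl qpowD.
  move=> t _; apply/eqP; apply: contrapT => /negP h'; apply: no; exists t.
  rewrite pE; move: h'; congr (_ != 0); apply: eq_bigr => i _.
  by rewrite (dotZr t) dot_cplx.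
by move: px1; rewrite pE big_seq big1 ?eqxx // => l /cls->; rewrite mul0r.
Qed.

(** Restriction to a common line makes both functions nonzero polynomials in one variable, up to
    powers of it. *)
Lemma trig_poly_domain p r : trig_poly p -> trig_poly r ->
  (exists x, p x != 0) -> (exists x, r x != 0) -> exists x, p x * r x != 0.
Proof.
move=> hp hr /(trig_poly_line_neq0 hp)[L [L0 Lp]] /(trig_poly_line_neq0 hr)[M [M0 Mr]].
have [|v vP vL] := generic_vector (L := L ++ M); first by rewrite mem_cat negb_or L0.
have cv := coweight_lattice vP.
have [|t1 pt1] := Lp v cv; first by move=> l lL; apply: vL; rewrite mem_cat lL.
have [|t2 rt2] := Mr v cv; first by move=> l lL; apply: vL; rewrite mem_cat lL orbT.
have [N [P hP]] := laurent_trig 0 hp cv; have [K [Q hQ]] := laurent_trig 0 hr cv.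
have P0 : P != 0.
  apply: contraNneq pt1 => P0; have := hP t1; rewrite P0 horner0 add0r => /eqP.
  by rewrite mulf_eq0 expf_eq0 (negbTE (qpow_neq0 _)) andbF.
have Q0 : Q != 0.
  apply: contraNneq rt2 => Q0; have := hQ t2; rewrite Q0 horner0 add0r => /eqP.
  by rewrite mulf_eq0 expf_eq0 (negbTE (qpow_neq0 _)) andbF.
have [t] : exists t, (P * Q).[e t] != 0 by apply: poly_qpow_neq0; rewrite mulf_neq0.
rewrite hornerM mulf_eq0 negb_or -hP -hQ !mulf_eq0 !negb_or => /andP[/andP[_ h1] /andP[_ h2]].
by exists (0 + t *: cplx v); rewrite mulf_neq0.
Qed.

Lemma generically_and (P Q : 'rV[R[i]]_n -> Prop) :
  generically P -> generically Q -> generically (fun x => P x /\ Q x).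
Proof.
move=> [p [tp p0 hp]] [r [tr r0 hr]]; exists (fun x => p x * r x).
split; [exact: trig_polyM|exact: trig_poly_domain|].
by move=> x; rewrite mulf_eq0 negb_or => /andP[/hp ? /hr].
Qed.

Lemma generically_mono (P Q : 'rV[R[i]]_n -> Prop) :
  (forall x, P x -> Q x) -> generically P -> generically Q.
Proof. by move=> PQ [p [tp p0 hp]]; exists p; split=> // x /hp /PQ. Qed.

Lemma generically_all (P : 'rV[R[i]]_n -> Prop) : (forall x, P x) -> generically P.
Proof.
move=> h; exists (fun=> 1); split=> //; first exact: trig_poly_const.
by exists 0; rewrite oner_eq0.
Qed.

Lemma generically_seq (I : eqType) (s : seq I) (P : I -> 'rV[R[i]]_n -> Prop) :
  (forall i, i \in s -> generically (P i)) ->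
  generically (fun x => forall i, i \in s -> P i x).
Proof.
elim: s => [|i s IH] h; first exact: generically_all.
have := generically_and (h i (mem_head _ _)) (IH (fun j js => h j (mem_behead (s := i :: s) js))).
by apply: generically_mono => x [Pi Ps] j; rewrite inE => /orP[/eqP->|/Ps].
Qed.

Lemma generically_ex (P : 'rV[R[i]]_n -> Prop) : generically P -> exists x, P x.
Proof. by move=> [p [_ [x px] hp]]; exists x; exact: hp. Qed.

Lemma generically_shift (P : 'rV[R[i]]_n -> Prop) x0 :
  generically P -> generically (fun x => P (x + x0)).
Proof.
move=> [p [tp [x1 p0] hp]]; exists (fun x => p (x + x0)); split.
- exact: trig_poly_shift.
- by exists (x1 - x0); rewrite subrK.
by move=> x /hp.
Qed.

Lemma generically_neq0 p : trig_poly p -> (exists x, p x != 0) -> generically (fun x => p x != 0).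
Proof. by move=> tp p0; exists p; split. Qed.

Lemma trig_rational_poly p : trig_poly p -> trig_rational p.
Proof.
move=> tp; exists p, (fun=> 1); split=> //; first exact: trig_poly_const.
  by exists 0; rewrite oner_eq0.
by move=> x _; rewrite divr1.
Qed.

Lemma trig_rational_const c : trig_rational (fun=> c).
Proof. by apply: trig_rational_poly; exact: trig_poly_const. Qed.

Lemma trig_rational_ext d d' : generically (fun x => d x = d' x) ->
  trig_rational d -> trig_rational d'.
Proof.
move=> [g [tg g0 hg]] [p [r [tp tr r0 h]]].
exists (fun x => p x * g x), (fun x => r x * g x).
split; [exact: trig_polyM|exact: trig_polyM|exact: trig_poly_domain|move=> x].
rewrite mulf_eq0 negb_or => /andP[rx gx]; rewrite -hg // h //.
by field; rewrite rx gx.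
Qed.

Lemma trig_rationalD d d' : trig_rational d -> trig_rational d' ->
  trig_rational (fun x => d x + d' x).
Proof.
move=> [p [r [tp tr r0 h]]] [p' [r' [tp' tr' r0' h']]].
exists (fun x => p x * r' x + p' x * r x), (fun x => r x * r' x).
split; [by apply: trig_polyD; exact: trig_polyM|exact: trig_polyM|exact: trig_poly_domain|].
move=> x; rewrite mulf_eq0 negb_or => /andP[rx rx']; rewrite h // h' //.
by field; rewrite rx rx'.
Qed.

Lemma trig_rationalM d d' : trig_rational d -> trig_rational d' ->
  trig_rational (fun x => d x * d' x).
Proof.
move=> [p [r [tp tr r0 h]]] [p' [r' [tp' tr' r0' h']]].
exists (fun x => p x * p' x), (fun x => r x * r' x).
split; [exact: trig_polyM|exact: trig_polyM|exact: trig_poly_domain|].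
move=> x; rewrite mulf_eq0 negb_or => /andP[rx rx']; rewrite h // h' //.
by field; rewrite rx rx'.
Qed.

Lemma trig_rational_sum (I : eqType) (s : seq I) (P : pred I) (F : I -> 'rV[R[i]]_n -> R[i]) :
  (forall i, i \in s -> P i -> trig_rational (F i)) ->
  trig_rational (fun x => \sum_(i <- s | P i) F i x).
Proof.
elim: s => [|i s IH] h.
  have -> : (fun x => \sum_(i <- [::] | P i) F i x) = fun=> 0.
    by apply/funext => x; rewrite big_nil.
  exact: trig_rational_const.
have {}IH : trig_rational (fun x => \sum_(i <- s | P i) F i x).
  by apply: IH => j js; apply: h; rewrite inE js orbT.
have [Pi|nPi] := boolP (P i).
  have -> : (fun x => \sum_(i <- i :: s | P i) F i x) =
            fun x => F i x + \sum_(i <- s | P i) F i x.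
    by apply/funext => x; rewrite big_cons Pi.
  by apply: trig_rationalD IH; apply: h; rewrite ?mem_head.
have -> : (fun x => \sum_(i <- i :: s | P i) F i x) = fun x => \sum_(i <- s | P i) F i x.
  by apply/funext => x; rewrite big_cons (negbTE nPi).
exact: IH.
Qed.

Lemma trig_rational_prod (I : eqType) (s : seq I) (P : pred I) (F : I -> 'rV[R[i]]_n -> R[i]) :
  (forall i, i \in s -> P i -> trig_rational (F i)) ->
  trig_rational (fun x => \prod_(i <- s | P i) F i x).
Proof.
elim: s => [|i s IH] h.
  have -> : (fun x => \prod_(i <- [::] | P i) F i x) = fun=> 1.
    by apply/funext => x; rewrite big_nil.
  exact: trig_rational_const.
have {}IH : trig_rational (fun x => \prod_(i <- s | P i) F i x).
  by apply: IH => j js; apply: h; rewrite inE js orbT.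
have [Pi|nPi] := boolP (P i).
  have -> : (fun x => \prod_(i <- i :: s | P i) F i x) =
            fun x => F i x * \prod_(i <- s | P i) F i x.
    by apply/funext => x; rewrite big_cons Pi.
  by apply: trig_rationalM IH; apply: h; rewrite ?mem_head.
have -> : (fun x => \prod_(i <- i :: s | P i) F i x) = fun x => \prod_(i <- s | P i) F i x.
  by apply/funext => x; rewrite big_cons (negbTE nPi).
exact: IH.
Qed.

Lemma trig_rational_inv d : trig_rational d -> generically (fun x => d x != 0) ->
  trig_rational (fun x => (d x)^-1).
Proof.
move=> [p [r [tp tr r0 h]]] gd.
have [x1 [dx1 rx1]] := generically_ex (generically_and gd (generically_neq0 tr r0)).
have p0 : exists x, p x != 0.
  by exists x1; move: dx1; rewrite h // mulf_eq0 negb_or => /andP[].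
have p1 x : p x * r x != 0 -> (d x)^-1 = r x / p x.
  rewrite mulf_eq0 negb_or => /andP[px rx]; rewrite h //.
  by rewrite invfM invrK mulrC.
exists (fun x => r x * r x), (fun x => p x * r x).
split; [exact: trig_polyM|exact: trig_polyM|exact: trig_poly_domain|].
move=> x pr0; rewrite p1 //; move: pr0; rewrite mulf_eq0 negb_or => /andP[px rx].
by field; rewrite rx px.
Qed.

Lemma trig_rational_shift d x0 : trig_rational d -> trig_rational (fun x => d (x + x0)).
Proof.
move=> [p [r [tp tr [x1 r0] h]]]; exists (fun x => p (x + x0)), (fun x => r (x + x0)).
split; [exact: trig_poly_shift|exact: trig_poly_shift|by exists (x1 - x0); rewrite subrK|].
by move=> x /h.
Qed.

Lemma generically_nondegenerate a K : root_lattice Phi a -> a != 0 ->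
  generically (nondegenerate a K).
Proof.
move=> aP a_nz; pose ks := [seq i%:Z - K%:Z | i <- iota 0 (K + K).+1].
have : generically (fun x => forall k, k \in ks -> br (pr a x + k%:~R) != 0).
  apply: generically_seq => k _; apply: generically_neq0.
    exact: trig_poly_qbr.
  have aa : (dot a a)%:C != 0 :> R[i] by rewrite eq_complex /= eqxx andbT dot_eq0.
  exists (((1 - k%:~R) / (dot a a)%:C) *: cplx a).
  rewrite (dotZr _ (cplx a)) dot_cplx divfK // subrK.
  by rewrite -[1]/(1%:~R) qbr_int_neq0.
apply: generically_mono => x h k kK; apply: h; apply/mapP; exists (absz (k + K%:Z)).
  by rewrite mem_iota; move: kK; clear; lia.
by move: kK; clear; lia.
Qed.

End TrigonometricFunctions.

(** * Determinants and adjugates with trigonometric entries *)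

Lemma trig_poly_det k
    (A : 'rV[R[i]]_n -> 'M[R[i]]_k) :
  (forall i j, trig_poly (fun x => A x i j)) -> trig_poly (fun x => \det (A x)).
Proof.
move=> h; apply: (trig_poly_ext (p := fun x =>
  \sum_(s : {perm 'I_k}) (-1) ^+ s * \prod_(i < k) A x i (s i))) => //.
apply: trig_poly_sum => s _ _.
apply: (trig_polyM (trig_poly_const ((-1) ^+ s)) (trig_poly_prod _)) => i _ _.
exact: h.
Qed.

Lemma trig_poly_adj k
    (A : 'rV[R[i]]_n -> 'M[R[i]]_k) :
  (forall i j, trig_poly (fun x => A x i j)) ->
  forall i j, trig_poly (fun x => (\adj (A x)) i j).
Proof.
move=> h i j; have := trig_polyM (trig_poly_const ((-1) ^+ (j + i)))
  (@trig_poly_det _ (fun x => row' j (col' i (A x))) _).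
move=> H; apply: trig_poly_ext (H _) => [x|k1 k2]; first by rewrite mxE.
by apply: trig_poly_ext (h (lift j k1) (lift i k2)) => x; rewrite !mxE.
Qed.

Section RationalMatrices.

Lemma trig_rational_det k (A : 'rV[R[i]]_n -> 'M[R[i]]_k) :
  (forall i j, trig_rational (fun x => A x i j)) -> trig_rational (fun x => \det (A x)).
Proof.
move=> h; have : trig_rational (fun x =>
  \sum_(s : {perm 'I_k}) (-1) ^+ s * \prod_(i < k) A x i (s i)); last by [].
apply: trig_rational_sum => s _ _.
apply: trig_rationalM; first exact: trig_rational_const.
by apply: trig_rational_prod => i _ _; exact: h.
Qed.

Lemma trig_rational_adj k (A : 'rV[R[i]]_n -> 'M[R[i]]_k) :
  (forall i j, trig_rational (fun x => A x i j)) ->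
  forall i j, trig_rational (fun x => (\adj (A x)) i j).
Proof.
move=> h i j; have : trig_rational (fun x => (-1) ^+ (j + i) * \det (row' j (col' i (A x)))).
  apply: trig_rationalM; first exact: trig_rational_const.
  apply: trig_rational_det => k1 k2.
  by have := h (lift j k1) (lift i k2); congr Defs.trig_rational; apply/funext => x; rewrite !mxE.
by congr Defs.trig_rational; apply/funext => x; rewrite mxE.
Qed.

End RationalMatrices.

(** * Weighted root sums and products of coroot brackets *)

Section RootSums.
Implicit Types (a b u v w t l : 'rV[R]_n).

Lemma root_big_refl (V : nmodType) a (F : 'rV[R]_n -> V) : a \in Phi ->
  \sum_(b <- Phi) F (reflv a b) = \sum_(b <- Phi) F b.
Proof.
move=> aP; have a_nz := root_nz aP.
rewrite -(big_map (reflv a) xpredT F); apply: perm_big; apply: uniq_perm.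
- by rewrite map_inj_uniq ?fset_uniq //; exact: inv_inj (reflvK a_nz).
- exact: fset_uniq.
move=> b; apply/mapP/idP => [[b' b'P ->]|bP]; first by rewrite root_reflE.
by exists (reflv a b); rewrite ?reflvK // root_reflE.
Qed.

Lemma rroot_dot v u : dot (rroot v) u =
  2^-1 * \sum_(b <- Phi | 0 < dot b v) (m b)%:R * dot b u.
Proof.
rewrite /rroot /half_sum dotZl dot_suml; congr (_ * _); apply: eq_bigr => b _.
by rewrite (dotZl (m b)%:R).
Qed.

Lemma rroot_le v u : regular v ->
  dot (rroot v) u <= 4^-1 * \sum_(b <- Phi) (m b)%:R * `|dot b u|.
Proof.
move=> rv; rewrite (sum_pos_neg _ rv) rroot_dot.
rewrite (_ : 4^-1 = 2^-1 * 2^-1); last by field.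
rewrite -mulrA ler_pM2l ?invr_gt0 // [leRHS]mulr_sumr.
rewrite big_seq_cond [leRHS]big_seq_cond; apply: ler_sum => b /andP[bP _].
rewrite (mult_opp bP) dotNl normrN.
have h := ler_norm (dot b u); have := ler_wpM2l (ler0n R (m b)) h; lra.
Qed.

Lemma rroot_max v : regular v ->
  dot (rroot v) v = 4^-1 * \sum_(b <- Phi) (m b)%:R * `|dot b v|.
Proof.
move=> rv; rewrite (sum_pos_neg _ rv) rroot_dot.
rewrite (_ : 4^-1 = 2^-1 * 2^-1); last by field.
rewrite -mulrA; congr (_ * _); rewrite [RHS]mulr_sumr.
rewrite big_seq_cond [RHS]big_seq_cond; apply: eq_bigr => b /andP[bP bv].
by rewrite (mult_opp bP) dotNl normrN gtr0_norm //; field.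
Qed.

(** At [v] the pairing with [rroot v] attains the Weyl invariant bound of [rroot_le], so reflecting
    [v] in [b] cannot increase it. *)
Lemma rroot_dominant v b : regular v -> b \in Phi -> 0 < dot b v ->
  0 <= dot (rroot v) b.
Proof.
move=> rv bP bv; have b_nz := root_nz bP.
have := rroot_le (reflv b v) rv.
rewrite -(root_big_refl _ bP) (eq_big_seq (fun a => (m a)%:R * `|dot a v|)); last first.
  by move=> a aP; rewrite m_inv // reflv_iso.
rewrite -rroot_max // /reflv dotBr (dotZr (dot (checkv b) v)) gerBl.
by rewrite pmulr_rge0 // dot_checkv_gt0.
Qed.

Lemma rroot_pairing v b : b \in Phi ->
  exists k : int, 2 * dot (rroot v) (checkv b) = k%:~R.
Proof.
move=> bP; rewrite rroot_dot mulrA divff // mul1r.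
suff h (s : seq 'rV[R]_n) : {subset s <= Phi} -> exists k : int,
  \sum_(a <- s | 0 < dot a v) (m a)%:R * dot a (checkv b) = k%:~R by exact: h.
elim: s => [|a s IH] sP; first by exists 0; rewrite big_nil.
have [d ds|k kE] := IH; first by apply: sP; rewrite inE ds orbT.
rewrite big_cons kE; case: ifP => _; last by exists k.
have [j jE] := root_pairing bP (sP a (mem_head _ _)).
by exists ((m a)%:Z * j + k); rewrite dotC jE intrD intrM.
Qed.

Lemma rroot_wall v u a : adjacent v u a -> dot (checkv a) (rroot v) = (m a)%:R.
Proof.
move=> ad; have [_ _ aP _ _] := ad; have a_nz := root_nz aP.
have [-> ] := half_sum_adjacent equivariant_id ad.
move=> /(congr1 (dot (checkv a))); rewrite /reflv !dotBr !(dotZr _ (checkv a) a) dot_checkv_self //; lra.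
Qed.

(** Each bracket contributes one of two opposite exponents, so the weights differ from the half sum
    by lattice vectors and stay inside the zonotope of the factors. *)
Lemma qbr_prod_expand (L : seq ('rV[R]_n * R[i])) :
  (forall i, i \in L -> coroot_lattice i.1) ->
  exists P : seq ('rV[R]_n * R[i]),
  (forall z, \prod_(i <- L) qbr lq (dot (cplx i.1) z + i.2) =
     \sum_(k <- P) k.2 * e (2 * dot (cplx k.1) z)) /\
  forall k, k \in P -> coroot_lattice (2^-1 *: (\sum_(i <- L) i.1) - k.1) /\
    forall u, dot k.1 u <= 2^-1 * \sum_(i <- L) `|dot i.1 u|.
Proof.
elim: L => [|[b c] L IH] LP.
  exists [:: (0, 1)]; split=> [z|k]; first by rewrite big_nil big_seq1 /= cplx0 dot0l mulr0 qpow0 mulr1.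
  rewrite inE => /eqP->; rewrite !big_nil scaler0 subr0; split; first exact: coroot_lattice0.
  by move=> u; rewrite dot0l big_nil mulr0.
have [|P [PE Ph]] := IH; first by move=> i iL; apply: LP; rewrite inE iL orbT.
have bP : coroot_lattice b := LP (b, c) (mem_head _ _).
exists ([seq (k.1 + 2^-1 *: b, k.2 * e c) | k <- P] ++
        [seq (k.1 - 2^-1 *: b, - k.2 * e (- c)) | k <- P]); split=> [z|k].
  rewrite big_cons /= PE big_cat !big_map /= -big_split /= [LHS]mulr_sumr.
  have half : (2^-1 : R)%:C = 2^-1 :> R[i] by rewrite fmorphV rmorph_nat.
  apply: eq_bigr => k _; rewrite cplxB cplxD cplxZ half dotBl dotDl (dotZl _ (cplx b)).
  rewrite !mulrDr mulrN !mulrA divff ?pnatr_eq0 // mul1r /qbr opprD !qpowD; ring.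
rewrite mem_cat => /orP[] /mapP[k' /Ph[h1 h2] ->] /=; rewrite !big_cons /= scalerDr; split.
- by rewrite opprD [_ - 2^-1 *: b]addrC addrACA subrr add0r.
- move=> u; rewrite big_cons dotDl (dotZl _ b) mulrDr addrC lerD // ler_pM2l ?invr_gt0 //; exact: ler_norm.
- rewrite opprB addrACA -scalerDl (_ : 2^-1 + 2^-1 = 1); last by field.
  by rewrite scale1r; exact: coroot_latticeD.
move=> u; rewrite big_cons dotBl (dotZl _ b) mulrDr addrC lerD // -mulrN ler_pM2l ?invr_gt0 //.
by rewrite -normrN ler_norm.
Qed.

End RootSums.

(** * The coefficients of psi *)

Section Coefficients.
Implicit Types (a b u v w t l : 'rV[R]_n) (S : seq 'rV[R]_n) (c : 'rV[R]_n -> R[i]).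
Implicit Types (x y z : 'rV[R[i]]_n).

(* B lists N /\ P^vee and cf l x is psi_l(x); the weight rvee v0 is the one at *)
(* which psi is normalized.                                                    *)
Variable B : seq 'rV[R]_n.
Hypothesis uB : uniq B.
Hypothesis hB : forall l, l \in B <-> coweight Phi l /\ forall u, dot l u <= hN u.
Variable KB : nat.
Hypothesis hKB : forall l b, l \in B -> b \in Phi -> `|dot l b| <= KB%:R.
Hypothesis hKm : forall b, b \in Phi -> (m b <= KB)%N.

(** On this line N is the edge from [rvee v] to [rvee u], whose ends are extremal for the two
    chambers. *)
Lemma adjacent_line_bound v u a l (r : R) : adjacent v u a ->
  l = rvee v + r *: checkv a -> (forall w, dot l w <= hN w) -> - (m a)%:R <= r <= 0.
Proof.
move=> ad lE lN; have [rv ru aP [av au] _] := ad; have a_nz := root_nz aP.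
have [_ uE] := half_sum_adjacent equivariant_checkv ad.
have h1 := lN v; have h2 := lN u.
move: h1; rewrite (hN_chamber rv) lE dotDl (dotZl r) gerDl.
rewrite pmulr_lle0 ?dot_checkv_gt0 // => ->; rewrite andbT.
move: h2; rewrite (hN_chamber ru) lE dotDl (dotZl r).
have -> : rvee u = rvee v - (m a)%:R *: checkv a by [].
rewrite dotBl (dotZl (m a)%:R) lerD2l -mulNr ler_nM2r //.
by rewrite dot_checkv_lt0.
Qed.

(** A string of extent at least [m a] on an edge of exactly that length occupies both ends, so [l]
    is an integral number of steps from [rvee v]. *)
Lemma wave_line v u a x c l (r : R) : adjacent v u a -> wave_eqs x c ->
  supported B c -> nondegenerate a KB x -> c l != 0 -> l = rvee v + r *: checkv a ->
  exists2 j : nat, (j <= m a)%N & l = rvee v - checkv a *~ j.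
Proof.
move=> ad we sB nd cl lE; have [rv ru aP [av au] _] := ad.
have spread := wave_spread we uB sB
   (fun l lB => proj1 (proj1 (hB l) lB)) (fun l lB => hKB lB aP) aP nd.
have lS : l \in [seq l <- B | c l != 0] by rewrite mem_filter cl sB.
have [i [j [iS jS ij]]] := spread l lS.
have bd (k : int) : l + checkv a *~ k \in [seq l <- B | c l != 0] ->
    - (m a)%:R <= r + k%:~R <= 0.
  rewrite mem_filter => /andP[_ /hB[_ h]]; apply: (adjacent_line_bound ad _ h).
  by rewrite lE scalerDl addrA scaler_int.
have /andP[_ h1] := bd i iS; have := bd (- j); rewrite mulrNz => /(_ jS) /andP[h2 _].
have rE : r = - i%:~R.
  have : ((m a)%:Z%:~R : R) <= (i + j)%:~R by rewrite ler_int.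
  rewrite -[(m a)%:Z%:~R]/((m a)%:R) intrD => h; move: h1 h2; rewrite intrN.
  by move=> h1 h2; apply/eqP; rewrite eq_le; apply/andP; split; lra.
have := bd 0; rewrite mulr0z addr0 => /(_ lS); rewrite rE -[(m a)%:R]/((m a)%:Z%:~R) !addr0.
rewrite lerN2 oppr_le0 ler_int ler0z => /andP[im i0].
exists `|i|%N; first by move: im i0; clear; lia.
by rewrite lE rE gez0_abs // scaleNr scaler_int.
Qed.

Definition top_coef v x : R[i] :=
  \prod_(b <- Phi | 0 < dot b v) \prod_(1 <= j < (m b).+1) br (j%:R - pr b x).

Definition wall_rest v a x : R[i] :=
  \prod_(b <- Phi | (0 < dot b v) && (b != a)) \prod_(1 <= j < (m b).+1) br (j%:R - pr b x).

Lemma string_formula v u a x c : adjacent v u a -> wave_eqs x c ->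
  supported B c -> nondegenerate a KB x -> c (rvee v) = top_coef v x ->
  forall j, (j <= m a)%N ->
  c (rvee v - checkv a *~ j) = rank1 (m a) j (pr a x) * wall_rest v a x.
Proof.
move=> ad we sB nd top; have [rv ru aP [av au] _] := ad.
have a_nz := root_nz aP; have ca_nz := checkv_neq0 a_nz.
have topE : top_coef v x = rank1 (m a) 0 (pr a x) * wall_rest v a x.
  by rewrite rank1_0 /top_coef (adjacent_big1 _ _ ad).
apply: (rank1_solution (d := fun j => c (rvee v - checkv a *~ j%:Z))).
- by move=> k km; apply: nd; apply: (le_trans km); rewrite lez_nat hKm.
- move=> s sm; pose L := [seq rvee v - checkv a *~ j%:Z | j <- iota 0 (m a).+1].
  have uL : uniq L.
    rewrite map_inj_uniq ?iota_uniq // => i j /addrI /oppr_inj /eqP.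
    rewrite -subr_eq0 -mulrzBr -scaler_int scaler_eq0 (negbTE ca_nz) orbF intr_eq0 subr_eq0.
    by move=> /eqP[].
  (* The edge string and the part of [B] off the string; by [wave_line] the support has no further
     points. *)
  pose L' := [seq l <- B | ~~ `[< same_string a (rvee v) l >]].
  have L_str l : l \in L -> same_string a (rvee v) l.
    by move=> /mapP[j _ ->]; exists (- j%:Z); rewrite mulrNz.
  have uLL : uniq (L ++ L').
    rewrite cat_uniq uL filter_uniq // andbT; apply/hasPn => l.
    by rewrite mem_filter => /andP[/negP h _]; apply/negP => /L_str/asboolP.
  have sLL : supported (L ++ L') c.
    move=> l cl; rewrite mem_cat; have lB := sB l cl.
    have [[k lE]|no] := pselect (same_string a (rvee v) l); last first.
      by apply/orP; right; rewrite mem_filter lB andbT; apply/negP => /asboolP.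
    have [|j jm ->] := wave_line (r := k%:~R) ad we sB nd cl; first by rewrite scaler_int.
    by apply/orP; left; apply/mapP; exists j; rewrite ?mem_iota ?add0n ?ltnS.
  have rP := coweight_rvee rv.
  have := we a s (rvee v) (L ++ L') aP I sm rP uLL sLL.
  have E2 : \sum_(l <- L' | `[< same_string a (rvee v) l >])
      c l * br (s%:R * (pr a x + (dot a l)%:C)) = 0.
    by rewrite big1_seq // => l /andP[h]; rewrite mem_filter h.
  rewrite big_cat /= E2 addr0.
  rewrite big_seq_cond (eq_bigl (fun l => l \in L)) -?big_seq; last first.
    move=> l; case: (boolP (l \in L)) => //= /L_str h; exact/asboolP.
  rewrite big_map => E; rewrite -[RHS]E; apply: eq_bigr => j _.
  congr (_ * br (_ * _)); rewrite dotBr dotMzr (dotC a (rvee v)) (dotC a (checkv a)).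
  rewrite (rvee_wall ad) dot_checkv_self //.
  have -> : ((m a)%:R - 2 *~ j%:Z)%:C = (m a)%:R - 2 * j%:R :> R[i].
    rewrite -mulrzr -[(m a)%:R]/((m a)%:Z%:~R) -[2]/(2%:Z%:~R) -intrM -intrB real_complex_int.
    by rewrite intrB intrM.
  ring.
by rewrite mulr0z subr0 top topE.
Qed.

Lemma rvee_B v : regular v -> rvee v \in B.
Proof.
move=> rv; apply/hB; split; first exact: (coweight_rvee rv).
move=> u; rewrite (hN_max u rv) lerDl sumr_ge0 // => a _.
by rewrite mulr_ge0 // le_max lexx.
Qed.

Variable cf : 'rV[R]_n -> 'rV[R[i]]_n -> R[i].
Hypothesis cf_supp : forall x l, cf l x != 0 -> l \in B.
Hypothesis cf_wave : forall x, wave_eqs x (cf^~ x).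
Variable v0 : 'rV[R]_n.
Hypothesis rv0 : regular v0.
Hypothesis cf_top : forall x, cf (rvee v0) x = top_coef v0 x.

Definition good x : Prop := forall b, b \in Phi -> nondegenerate b KB x.

(** The far end of an edge carries [rank1] with [j = m a], which is the near end with [a] replaced
    by [-a], as the crossing of the wall requires. *)
Lemma chamber_formula x v : good x -> regular v -> cf (rvee v) x = top_coef v x.
Proof.
move=> gx rv.
apply: (chamber_ind (P := fun v => cf (rvee v) x = top_coef v x) _ _ rv0 rv) => //.
- move=> v1 v2 _ _ h; rewrite /rvee (half_sum_same _ h) => ->.
  rewrite /top_coef big_seq_cond [RHS]big_seq_cond; apply: eq_bigl => b.
  by case: (boolP (b \in Phi)) => //= bP; rewrite h.
move=> v1 v2 a ad h1; have [_ _ aP _ _] := ad.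
have [_ v2E] := half_sum_adjacent equivariant_checkv ad.
have := string_formula ad (@cf_wave x) (@cf_supp x) (gx a aP) h1 (leqnn _).
rewrite (_ : rvee v1 - _ = rvee v2); last first.
  by rewrite /rvee v2E scaler_nat pmulrn.
move=> ->; rewrite rank1_m /top_coef (adjacent_big2 _ _ ad).
rewrite (mult_opp aP); congr (_ * _); apply: eq_bigr => j _.
by rewrite cplxN dotNl opprK.
Qed.

Lemma top_coef_neq0 v x : good x -> top_coef v x != 0.
Proof.
move=> gx; rewrite /top_coef prodf_seq_neq0; apply/allP => b bP; apply/implyP => _.
rewrite prodf_seq_neq0; apply/allP => j; rewrite mem_index_iota ltnS => /andP[_ jm].
rewrite /= -opprB qbrN oppr_eq0 -[- j%:R]/(- (j%:Z%:~R)) -intrN.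
by apply: gx => //; rewrite normrN ger0_norm // lez_nat (leq_trans jm) // hKm.
Qed.

Lemma exp_independent (C : seq 'rV[R]_n) (k : 'rV[R]_n -> R[i]) : uniq C ->
  (forall z, \sum_(l <- C) k l * e (2 * pr l z) = 0) -> forall l, l \in C -> k l = 0.
Proof.
move=> uC h l lC.
have := @character_sums _ R[i] _ setT C k (fun l z => e (2 * pr l z)) I (fun _ _ _ _ => I).
move=> H; rewrite -[RHS](H _ _ _ l).
- rewrite -big_filter (_ : [seq i <- C | _] = [:: l]) ?big_seq1 //.
  rewrite -[RHS](filter_pred1_uniq uC lC); apply: eq_in_filter => i iC.
  apply/asboolP/eqP => [hi|-> //]; apply/eqP; rewrite -subr_eq0; apply: contraT => il.
  have dd : (dot (i - l) (i - l))%:C != 0 :> R[i].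
    by rewrite eq_complex /= eqxx andbT dot_eq0.
  have := hi ((2 * (dot (i - l) (i - l))%:C)^-1 *: cplx (i - l)) I.
  move=> /eqP; rewrite -subr_eq0 -(inj_eq (mulIf (qpow_neq0 (- (2 * pr l ((2 * (dot (i - l) (i - l))%:C)^-1 *: cplx (i - l))))))).
  rewrite mul0r mulrBl -!qpowD subrr qpow0 -mulrBr -dotBl -cplxB.
  rewrite (dotZr _ _ (cplx (i - l))) dot_cplx (_ : 2 * _ = 1); last by field; rewrite dd.
  rewrite qpow1 subr_eq0 => /eqP q1.
  by have := q_nonroot (ltn0Sn 0); rewrite expr1 q1 eqxx.
- by move=> i; rewrite dot0r mulr0 qpow0.
- by move=> i y z; rewrite dotDr mulrDr qpowD.
by move=> z _.
Qed.

(** Writing [psi (x + nu)] with the prefactor [q^(2(x,z))] translates its weights by [nu]; all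
    shifts of psi thus solve the equations at the same [x]. *)
Lemma wave_shift x nu C c : coweight Phi nu -> uniq C -> supported C c ->
  wave_eqs (x + cplx nu) c -> wave_eqs x (fun l => c (l - nu)).
Proof.
move=> nuP uC sC; apply: (string_eqs_shift nuP uC sC) => a s l aP.
by rewrite dotDr dot_cplx dotBr rmorphB /=; congr (br _); ring.
Qed.

Lemma wave_sum (I : eqType) (s : seq I) (k : I -> R[i]) (ci : I -> 'rV[R]_n -> R[i]) C x :
  (forall i, i \in s -> supported C (ci i)) -> (forall i, i \in s -> wave_eqs x (ci i)) ->
  wave_eqs x (fun l => \sum_(i <- s) k i * ci i l).
Proof.
elim: s => [|i s IH] sC h.
  move=> a r t C' aP _ rm tP uC' _; rewrite big1 // => l _.
  by rewrite big_nil mul0r.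
have {}IH := IH (fun j js => sC j (mem_behead (s := i :: s) js))
                (fun j js => h j (mem_behead (s := i :: s) js)).
have sC' : supported C (fun l => \sum_(j <- s) k j * ci j l).
  move=> l; apply: contraNT => lC; rewrite big_seq big1 // => j js.
  have -> : ci j l = 0.
    by apply/eqP; apply: contraNT lC; apply: sC; rewrite inE js orbT.
  by rewrite mulr0.
have := string_eqs_lin (k1 := k i) (k2 := 1) (sC i (mem_head _ _)) sC' (h i (mem_head _ _)) IH.
by congr string_eqs; apply/funext => l; rewrite big_cons mul1r.
Qed.

Lemma string_eqs_collect D (g : 'rV[R]_n -> nat -> 'rV[R]_n -> R[i]) (I : eqType) (s : seq I)
    (nu : I -> 'rV[R]_n) (c : I -> R[i]) :
  (forall a k t, a \in Phi -> D a -> (1 <= k <= m a)%N -> coweight Phi t ->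
     \sum_(i <- s | `[< same_string a t (nu i) >]) c i * g a k (nu i) = 0) ->
  string_eqs D g (fun l => \sum_(i <- s | nu i == l) c i).
Proof.
move=> sums.
apply: (@string_eqs_intro _ _ _ (undup (map nu s))); first exact: undup_uniq.
  move=> l; rewrite mem_undup; apply: contraNT => lC; rewrite big_seq_cond big1 // => i.
  by move=> /andP[i_s /eqP e]; case/negP: lC; rewrite -e map_f.
move=> a k t aP Da km tP; rewrite -[RHS](sums a k t aP Da km tP).
rewrite (eq_bigr (fun l => \sum_(i <- s | nu i == l) c i * g a k (nu i))); last first.
  by move=> l _; rewrite mulr_suml; apply: eq_bigr => i /eqP ->.
rewrite (exchange_big_dep (fun i => `[< same_string a t (nu i) >])) /=; last first.
  by move=> l i h /eqP->.
rewrite big_seq_cond [RHS]big_seq_cond; apply: eq_bigr => i /andP[i_s hi].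
rewrite -big_filter (_ : [seq l <- _ | _] = [:: nu i]) ?big_seq1 //.
rewrite (eq_in_filter (a2 := pred1 (nu i))); last first.
  move=> l _ /=; rewrite eq_sym; case: eqVneq => [->|]; rewrite ?andbF ?andbT //.
by rewrite filter_pred1_uniq ?undup_uniq // mem_undup map_f.
Qed.

Lemma quasi_invariant_wave (I : eqType) (s : seq I) (nu : I -> 'rV[R]_n) (c : I -> R[i]) x :
  (forall i, i \in s -> coweight Phi (nu i)) ->
  quasi_invariant lq Phi m
    (fun z => e (2 * dot x z) * \sum_(i <- s) c i * e (2 * pr (nu i) z)) ->
  wave_eqs x (fun l => \sum_(i <- s | nu i == l) c i).
Proof.
move=> sP qi; apply: string_eqs_collect => a k t aP _.
exact: (quasi_invariant_sums sP qi).
Qed.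

(** A nonzero solution would contain in the hull of its support a translate [N + nu] by [top_bound],
    with the vertex [rvee v + nu] in the support. Since the support lies in N plus the hull of [L],
    this [nu] lies in the hull of [L], where the coefficient is assumed to vanish. *)
Lemma wave_vanish x c C K (L : seq 'rV[R]_n) v : wave_eqs x c -> uniq C -> supported C c ->
  (forall l, l \in C -> coweight Phi l) ->
  (forall l b, l \in C -> b \in Phi -> `|dot l b| <= K%:R) ->
  (forall b, b \in Phi -> nondegenerate b K x) ->
  (forall l u, l \in C -> exists2 k, k \in L & dot l u <= hN u + dot k u) ->
  regular v ->
  (forall nu, coweight Phi nu -> (forall u, exists2 k, k \in L & dot nu u <= dot k u) ->
     c (rvee v + nu) = 0) ->
  forall l, c l = 0.
Proof.
move=> we uC sC CP CK nd CL rv h l; apply/eqP; apply: contraT => cl.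
pose S := [seq l <- C | c l != 0].
have S0 : S != [::].
  have : l \in S by rewrite mem_filter cl sC.
  by case: (S).
have [|s0] := top_bound rv S0.
  move=> b bP; exact: (wave_spread we uC sC CP
    (fun l lC => CK l b lC bP) bP (nd b bP)).
rewrite mem_filter => /andP[cs0 s0C] top.
have := h (s0 - rvee v); rewrite (addrC (rvee v)) subrK => h0; move/eqP: cs0; case; apply: h0.
  apply: coweightB; first exact: CP.
  exact: (coweight_rvee rv).
move=> u; have [t] := top u; rewrite mem_filter => /andP[_ tC] ht.
by have [k kL hk] := CL t u tC; exists k => //; lra.
Qed.

Lemma cf_unique v x c : regular v -> good x -> wave_eqs x c -> supported B c ->
  c (rvee v) = 0 -> forall l, c l = 0.
Proof.
move=> rv gx we sB c0.
apply: (wave_vanish (L := [:: 0]) (v := v) (K := KB) we uB sB) => //.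
- by move=> l /hB[].
- by move=> l u /hB[_ h]; exists 0; rewrite ?mem_head // dot0l addr0.
move=> nu nuP nu0; rewrite (_ : nu = 0) ?addr0 //.
have nu_le u : dot nu u <= 0.
  by have [k] := nu0 u; rewrite inE => /eqP->; rewrite dot0l.
by apply/eqP; rewrite -dot_eq0 eq_le dot_ge0 nu_le.
Qed.

Lemma generically_good : generically good.
Proof.
have := generically_seq
  (fun b (bP : b \in finmap.enum_fset Phi) =>
     generically_nondegenerate KB (root_lattice_root bP)
       (root_nz bP)).
exact: generically_mono.
Qed.

Lemma trig_poly_top v : trig_poly (top_coef v).
Proof.
apply: trig_poly_prod => b bP _; apply: trig_poly_prod => j _ _.
have := trig_poly_qbr (j%:R) (root_latticeN (root_lattice_root bP)).
by apply: trig_poly_ext => x; rewrite cplxN dotNl addrC.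
Qed.

(* The linear system defining the coefficients has a constant left inverse at  *)
(* one good point; Cramer's rule then applies at every point.                 *)
Lemma cf_cramer : exists (D : 'rV[R[i]]_n -> R[i]) (P : 'rV[R]_n -> 'rV[R[i]]_n -> R[i]),
  [/\ trig_poly D, exists x, D x != 0, forall l, trig_poly (P l) &
      forall l x, l \in B -> D x * cf l x = P l x].
Proof.
(* [None] stands for the normalization at [rvee v0], [Some (a, s, t)] for the equation of order [s]
   on the [a]-string through [t]. *)
pose eqs : seq (option ('rV[R]_n * nat * 'rV[R]_n)) :=
  None :: [seq Some p | p <- [seq (p, t) | p <- [seq (a, s) | a <- Phi, s <- iota 1 (m a)], t <- B]].
pose ent (k : option ('rV[R]_n * nat * 'rV[R]_n)) l x : R[i] :=
  if k is Some (a, s, t) then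
    if `[< same_string a t l >] then br (s%:R * (pr a x + (dot a l)%:C)) else 0
  else (l == rvee v0)%:R.
pose rhs (k : option ('rV[R]_n * nat * 'rV[R]_n)) x : R[i] :=
  if k is Some _ then 0 else top_coef v0 x.
pose M x := \matrix_(k < size eqs, i < size B) ent (nth None eqs k) (nth 0 B i) x.
pose b x := \col_(k < size eqs) rhs (nth None eqs k) x.
have vec c k x : \sum_(i < size B) ent k (nth 0 B i) x * c (nth 0 B i) =
    \sum_(l <- B) ent k l x * c l.
  by rewrite (big_nth 0) big_mkord.
have rP := coweight_rvee rv0.
have rB := rvee_B rv0.
have top_ent c x : \sum_(l <- B) ent None l x * c l = c (rvee v0).
  rewrite (bigD1_seq (rvee v0)) //= eqxx mul1r big1 ?addr0 // => l /negbTE ->.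
  by rewrite mul0r.
have str_ent c x a s t : \sum_(l <- B) ent (Some (a, s, t)) l x * c l =
    \sum_(l <- B | `[< same_string a t l >]) c l * br (s%:R * (pr a x + (dot a l)%:C)).
  rewrite [RHS]big_mkcond; apply: eq_bigr => l _ /=.
  by case: ifP => _; rewrite ?mul0r // mulrC.
have sys x : M x *m (\col_i cf (nth 0 B i) x) = b x.
  apply/matrixP => k j; rewrite !mxE.
  under eq_bigr => i _ do rewrite !mxE.
  rewrite (vec (cf^~ x)); have := mem_nth None (ltn_ord k).
  case: (nth None eqs k) => [[[a s] t]|_]; last by rewrite top_ent cf_top.
  rewrite inE /= => /mapP[_ /allpairsP[[[a' s'] t'] /= [/allpairsPdep[a1 [s1 [aP sP [-> ->]]]] tB ->]] [-> -> ->]].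
  rewrite str_ent; apply: (@cf_wave x) => //.
  - by move: sP; rewrite mem_iota add1n ltnS.
  - by have [] := proj1 (hB t') tB.
  - exact: cf_supp.
have [x1 gx1] := generically_ex generically_good.
(* A kernel vector is a solution at a good point with vanishing vertex coefficient, hence zero by
   [cf_unique]. *)
have full : row_full (M x1).
  rewrite /row_full; have := mxrank_coker (M x1).
  suff -> : cokermx (M x1) = 0.
    rewrite mxrank0 => /esym/eqP; rewrite subn_eq0 => h.
    by rewrite eqn_leq h rank_leq_col.
  apply/matrixP => i j; rewrite [RHS]mxE.
  pose y := col j (cokermx (M x1)).
  have My : M x1 *m y = 0 by rewrite /y colE mulmxA mulmx_coker mul0mx.
  pose c l := oapp (fun i => y i 0) 0 (insub (index l B)).
  have cE (k : 'I_(size B)) : c (nth 0 B k) = y k 0.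
    by rewrite /c index_uniq // valK.
  have sB : supported B c.
    by move=> l; rewrite /c; case: insubP => [u|]; rewrite ?eqxx //= -index_mem.
  have Mc k : k \in eqs -> \sum_(l <- B) ent k l x1 * c l = 0.
    move=> kE; have szk : (index k eqs < size eqs)%N by rewrite index_mem.
    have := congr1 (fun A : 'cV_(size eqs) => A (Ordinal szk) 0) My; rewrite !mxE /= => E.
    rewrite -vec -[RHS]E; apply: eq_bigr => i' _; rewrite cE !mxE /=.
    by rewrite nth_index.
  have c0 : c (rvee v0) = 0 by rewrite -(top_ent c x1) Mc ?mem_head.
  have we : wave_eqs x1 c.
    apply: (@string_eqs_intro _ _ _ B) => // a s t aP _ sm tP.
    have [/hasP[t' t'B /asboolP str]|no] := boolP (has (fun l => `[< same_string a t l >]) B); last first.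
      by rewrite big_hasC.
    rewrite -[RHS](Mc (Some (a, s, t'))).
      rewrite str_ent; apply: eq_bigl => l; case: str => j1 ->.
      apply/asboolP/asboolP => -[j2 ->].
        by exists (j2 - j1); rewrite mulrzBr addrA addrAC addrK.
      by exists (j1 + j2); rewrite mulrzDr addrA.
    rewrite inE /=; apply/mapP; exists (a, s, t') => //.
    apply: allpairs_f => //; apply/allpairsPdep; exists a, s; split=> //.
    by rewrite mem_iota add1n ltnS.
  by have := cf_unique rv0 gx1 we sB c0 (nth 0 B i); rewrite cE mxE.
have [L hL] := row_fullP full.
pose A x := L *m M x.
have tM k i : trig_poly (fun x => M x k i).
  apply: (trig_poly_ext (p := fun x => ent (nth None eqs k) (nth 0 B i) x)) => [x|].
    by rewrite mxE.
  have := mem_nth None (ltn_ord k); case: (nth None eqs k) => [[[a s] t]|_]; last first.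
    exact: trig_poly_const.
  rewrite inE /= => /mapP[_ /allpairsP[[[a' s'] t'] /= [/allpairsPdep[a1 [s1 [aP sP [-> ->]]]] tB ->]] [-> -> ->]].
  case: asboolP => _; last exact: trig_poly_const.
  have := trig_poly_qbr (s1%:R * (dot a1 (nth 0 B i))%:C)
    (root_latticeMz s1 (root_lattice_root aP)).
  apply: trig_poly_ext => x; rewrite cplxMz dotMzl -mulrzl mulrDr //.
have tA i j : trig_poly (fun x => A x i j).
  apply: (trig_poly_ext (p := fun x => \sum_k L i k * M x k j)) => [x|]; first by rewrite /A !mxE.
  by apply: trig_poly_sum => k _ _; exact: trig_polyM (trig_poly_const _) (tM k j).
have tb k : trig_poly (fun x => b x k 0).
  apply: (trig_poly_ext (p := fun x => rhs (nth None eqs k) x)) => [x|]; first by rewrite mxE.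
  by case: (nth None eqs k) => [p|]; [exact: trig_poly_const|exact: trig_poly_top].
exists (fun x => \det (A x)), (fun l x => oapp (fun i => (\adj (A x) *m (L *m b x)) i 0) 0 (insub (index l B))).
split.
- exact: trig_poly_det.
- by exists x1; rewrite /A hL det1 oner_eq0.
- move=> l; case: insubP => [i _ _|_]; last exact: trig_poly_const.
  apply: (trig_poly_ext (p := fun x => \sum_j (\adj (A x)) i j * \sum_k L j k * b x k 0)) => [x|].
    by rewrite /= mxE; apply: eq_bigr => j _; congr (_ * _); rewrite mxE.
  apply: trig_poly_sum => j _ _; apply: trig_polyM; first exact: trig_poly_adj.
  by apply: trig_poly_sum => k _ _; exact: trig_polyM (trig_poly_const _) (tb k).
move=> l x lB; rewrite insubT ?index_mem //= => szl.
rewrite -(sys x) (mulmxA L) -/(A x) mulmxA mul_adj_mx mul_scalar_mx !mxE /=.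
by rewrite nth_index.
Qed.

Lemma cf_rational l : trig_rational (cf l).
Proof.
have [D [P [tD D0 tP h]]] := cf_cramer; have [lB|lB] := boolP (l \in B); last first.
  apply: trig_rational_ext (trig_rational_const 0).
  apply: generically_all => x; apply/esym/eqP; apply: contraNT lB; exact: cf_supp.
exists (P l), D; split=> // x Dx; by rewrite -h // mulrAC divff // mul1r.
Qed.

Lemma trig_poly_rank1 k j a : a \in Phi -> trig_poly (fun x => rank1 k j (pr a x)).
Proof.
move=> aP; have ra := root_lattice_root aP.
have tqr (b : R[i]) (i0 : nat) : trig_poly (fun x => qrising (pr a x + b) i0).
  rewrite /qrising.
  apply: (@trig_poly_ext (fun x => \prod_(i <- index_enum 'I_i0) br (pr a x + (b + i%:R)))).
    by move=> x; apply: eq_bigr => i _; rewrite addrA.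
  by apply: trig_poly_prod => i _ _; exact: trig_poly_qbr.
apply: trig_polyM; last first.
  by have := tqr ((k - j)%:R + 1) j; apply: trig_poly_ext => x; rewrite addrA.
apply: trig_polyM; last exact: tqr.
exact: trig_poly_const.
Qed.

Lemma trig_poly_rest v a : trig_poly (wall_rest v a).
Proof.
apply: trig_poly_prod => b bP _; apply: trig_poly_prod => j _ _.
have := trig_poly_qbr (j%:R) (root_latticeN (root_lattice_root bP)).
by apply: trig_poly_ext => x; rewrite cplxN dotNl addrC.
Qed.

Hypothesis Phi_neq0 : exists a, a \in Phi.

Section OneWall.
Variable y : 'rV[R]_n.
Hypothesis yP : coweight Phi y.
Hypothesis ry : regular y.

(** If brackets of [b] and [b'] vanish at the same point of the line, the combination of the two
    roots orthogonal to [y] eliminates [t] and gives a vanishing bracket in [x0] alone. *)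
Lemma generically_one_wall : generically (fun x0 => forall (t : R[i]) b b', b \in Phi -> b' \in Phi ->
  b' != b -> b' != - b ->
  nondegenerate b KB (x0 + t *: cplx y) \/ nondegenerate b' KB (x0 + t *: cplx y)).
Proof.
pose yi b := Num.floor (dot b y).
have yiE b : b \in Phi -> dot b y = (yi b)%:~R.
  by move=> bP; have [k kE] := coweight_pairing yP bP; rewrite /yi dotC kE intrKfloor.
pose g p : 'rV[R]_n := p.1 *~ yi p.2 - p.2 *~ yi p.1.
pose K p := (KB * (absz (yi p.1) + absz (yi p.2)))%N.
pose ps := [seq p <- [seq (b, b') | b <- finmap.enum_fset Phi, b' <- finmap.enum_fset Phi] |
   (p.2 != p.1) && (p.2 != - p.1)].
have : generically (fun x0 => forall p, p \in ps -> nondegenerate (g p) (K p) x0).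
  apply: generically_seq => -[b b'].
  rewrite mem_filter /= => /andP[/andP[h1 h2] /allpairsP[[d d'] [dP d'P [E1 E2]]]].
  move: dP d'P; rewrite /= -E1 -E2 => bP b'P.
  apply: generically_nondegenerate; rewrite /g /=.
    apply: root_latticeD; first exact/root_latticeMz/root_lattice_root.
    exact/root_latticeN/root_latticeMz/root_lattice_root.
  rewrite -(scaler_int (yi b')) -(scaler_int (yi b)) -opprB oppr_eq0.
  by apply: root_combination_neq0 => //; rewrite -yiE // ry.
apply: generically_mono => x0 h t b b' bP b'P h1 h2; apply: contrapT => no.
have [k kK k0] : exists2 k : int, `|k| <= KB%:Z & br (pr b (x0 + t *: cplx y) + k%:~R) = 0.
  apply: contrapT => no'; apply: no; left => k kK; apply/eqP => e0.
  by apply: no'; exists k.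
have [j jK j0] : exists2 k : int, `|k| <= KB%:Z & br (pr b' (x0 + t *: cplx y) + k%:~R) = 0.
  apply: contrapT => no'; apply: no; right => j jK; apply/eqP => e0.
  by apply: no'; exists j.
have pP : (b, b') \in ps.
  by rewrite mem_filter /= h1 h2 /=; apply/allpairsP; exists (b, b').
have := h _ pP (k * yi b' - j * yi b).
have -> : `|k * yi b' - j * yi b| <= (K (b, b'))%:Z.
  rewrite /K /=; apply: (le_trans (ler_normB _ _)); rewrite !normrM.
  rewrite PoszM PoszD !abszE; move: kK jK; move: (normr_ge0 (yi b)) (normr_ge0 (yi b')).
  by clear; nia.
move=> /(_ isT); case/negP; rewrite qbr_eq0 // .
move/eqP: k0; move/eqP: j0; rewrite !qbr_eq0 // => /eqP j0 /eqP k0.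
have -> : 2 * (pr (g (b, b')) x0 + (k * yi b' - j * yi b)%:~R) =
  (2 * (pr b (x0 + t *: cplx y) + k%:~R)) *~ yi b' - (2 * (pr b' (x0 + t *: cplx y) + j%:~R)) *~ yi b.
  rewrite /g /= cplxB !cplxMz dotBl !dotMzl !dotDr !(dotZr t) !dot_cplx !yiE // !real_complex_int.
  by rewrite -(mulrzr (pr b x0)) -(mulrzr (pr b' x0)) -[(2 * _) *~ yi b']mulrzr
    -[(2 * _) *~ yi b]mulrzr !intrB !intrM; ring.
by rewrite qpowB !qpowMz j0 k0 !exp1rz divr1.
Qed.

End OneWall.

(** * Regularity of the coefficients along a line *)

Section Ray.
Variables (y : 'rV[R]_n) (x0 : 'rV[R[i]]_n).
Hypothesis yP : coweight Phi y.
Hypothesis ry : regular y.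
Local Notation ray t := (x0 + t *: cplx y).
Hypothesis one_wall : forall (t : R[i]) b b', b \in Phi -> b' \in Phi -> b' != b -> b' != - b ->
  nondegenerate b KB (ray t) \/ nondegenerate b' KB (ray t).
Variable E : {poly R[i]}.
Hypothesis E0 : E != 0.
Hypothesis good_ray : forall t : R[i], E.[e t] != 0 -> good (ray t).
Variables (Dp : {poly R[i]}) (Pp : 'rV[R]_n -> {poly R[i]}).
Hypothesis Dp0 : Dp != 0.
Hypothesis cf_ray : forall l (t : R[i]), l \in B -> Dp.[e t] * cf l (ray t) = (Pp l).[e t].

Lemma rayE (t : R[i]) a : a \in Phi -> exists2 k : int, dot a y = k%:~R &
  pr a (ray t) = pr a x0 + t *~ k.
Proof.
move=> aP; have [k kE] := coweight_pairing yP aP; exists k; first by rewrite dotC kE.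
by rewrite dotDr (dotZr t) dot_cplx (dotC a) kE real_complex_int mulrzr.
Qed.

Lemma laurent_wave (c1 : R[i]) (s : nat) a : a \in Phi ->
  laurent (fun t : R[i] => br (s%:R * (pr a (ray t) + c1))).
Proof.
move=> aP; have [k kE] := coweight_pairing yP aP.
have := laurent_qbr (s%:R * (pr a x0 + c1)) (s%:Z * k).
apply: laurent_ext => t; congr br.
rewrite dotDr (dotZr t) dot_cplx (dotC a) kE real_complex_int -mulrzr intrM; ring.
Qed.

Section Division.
(** A stage of the cancellation: on the line [cf l] is [Q l] divided by [D' w^M], where [D'] is the
    part of the denominator still to be removed. *)
Variables (D' : {poly R[i]}) (Q : 'rV[R]_n -> {poly R[i]}) (M : nat).
Hypothesis D'0 : D' != 0.
Hypothesis DQ : forall l, l \in B -> D' * 'X^M * Pp l = Dp * Q l.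

Lemma line_value l (t : R[i]) : l \in B -> (Dp * D').[e t] != 0 ->
  (Q l).[e t] = D'.[e t] * e t ^+ M * cf l (ray t).
Proof.
move=> lB; rewrite hornerM mulf_eq0 negb_or => /andP[Dt _].
apply: (mulfI Dt); rewrite -hornerM -DQ // !hornerM hornerXn -cf_ray //; ring.
Qed.

(** The equations are Laurent identities in [w] valid off the zeros of the denominators, so they
    persist at the roots of [D']. *)
Lemma line_wave (t0 : R[i]) :
  wave_eqs (ray t0) (fun l => if l \in B then (Q l).[e t0] else 0).
Proof.
apply: (string_eqs_intro uB) => [l|a s t aP _ sm tP]; first by case: ifP => //; rewrite eqxx.
rewrite [LHS]big_seq_cond.
rewrite (eq_bigr (fun l => (Q l).[e t0] * br (s%:R * (pr a (ray t0) + (dot a l)%:C)))); last first.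
  by move=> l /andP[-> _].
rewrite -big_seq_cond.
apply: (laurent_eq0 (f := fun t1 : R[i] => \sum_(l <- B | `[< same_string a t l >])
     (Q l).[e t1] * br (s%:R * (pr a (ray t1) + (dot a l)%:C))) _ (mulf_neq0 Dp0 D'0)).
    apply: laurent_sum => l _; apply: laurentM; first exact: laurent_poly.
    exact: laurent_wave.
  move=> t1 Dt; have := @cf_wave (ray t1) a s t B aP I sm tP uB (@cf_supp (ray t1)).
  move=> /(congr1 ( *%R (D'.[e t1] * e t1 ^+ M))); rewrite mulr0 => h; apply: etrans h.
  rewrite [RHS]mulr_sumr [LHS]big_seq_cond [RHS]big_seq_cond; apply: eq_bigr => l /andP[lB _].
  by rewrite line_value // mulrA.
Qed.

(** On the edge line [cf] is generically either 0 or the polynomial expression of [string_formula],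
    so [Q l] inherits the roots of [D']. *)
Lemma line_top v u a (t0 : R[i]) l (r : R) : adjacent v u a -> l \in B ->
  l = rvee v + r *: checkv a -> D'.[e t0] = 0 -> (Q l).[e t0] = 0.
Proof.
move=> ad lB lE Dt0; have [rv ru aP [av au] _] := ad.
pose f (t : R[i]) : R[i] := cf l (ray t).
have [g Lg fg] : exists2 g, laurent g & forall t : R[i], E.[e t] != 0 -> f t = g t.
  have [[j jm ljE]|no] := pselect (exists2 j, (j <= m a)%N & l = rvee v - checkv a *~ j).
    exists (fun t : R[i] => rank1 (m a) j (pr a (ray t)) * wall_rest v a (ray t)).
      apply: (laurent_trig (p := fun x => rank1 (m a) j (pr a x) * wall_rest v a x) x0 _ yP).
      apply: trig_polyM; [exact: trig_poly_rank1|exact: trig_poly_rest].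
    move=> t /good_ray gt; rewrite /f ljE.
    apply: (string_formula ad
      (@cf_wave (ray t)) (@cf_supp (ray t)) (gt a aP)) => //.
    exact: chamber_formula.
  exists (fun=> 0) => [|t /good_ray gt]; first exact: laurent_const.
  apply/eqP; apply: contraT => ft; case: no.
  exact: (wave_line ad (@cf_wave (ray t))
     (@cf_supp (ray t)) (gt a aP) ft lE).
have := laurent_eq0 (f := fun t : R[i] => (Q l).[e t] + - 1 * (D'.[e t] * (e (t *~ M) * g t))) _
  (mulf_neq0 (mulf_neq0 Dp0 D'0) E0).
move=> /(_ _ _ t0); rewrite Dt0 mul0r mulr0 addr0; apply.
  apply: laurentD; first exact: laurent_poly.
  apply: laurentM; first exact: laurent_const.
  apply: laurentM; first exact: laurent_poly.
  by apply: laurentM => //; exact: laurent_exp.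
move=> t; rewrite [X in X != 0]hornerM mulf_eq0 negb_or => /andP[Dt Et].
by rewrite line_value // -fg // /f -pmulrn qpowMn; ring.
Qed.

(* At a root of D' the values of Q solve wave_eqs. At most one pair of roots    *)
(* being degenerate there, wall_bound yields a weight of their support on a     *)
(* string of weights rvee v - j a^vee, where cf is known and has no pole.       *)
Lemma line_root (t0 : R[i]) l : l \in B -> D'.[e t0] = 0 -> (Q l).[e t0] = 0.
Proof.
move=> lB Dt0; pose p l : R[i] := if l \in B then (Q l).[e t0] else 0.
have wp : wave_eqs (ray t0) p by exact: line_wave.
have sp : supported B p by move=> l'; rewrite /p; case: ifP => //; rewrite eqxx.
suff : p l = 0 by rewrite /p lB.
apply/eqP; apply: contraT => pl.
have [[a aP nda]|nd] := pselect (exists2 a, a \in Phi & ~ nondegenerate a KB (ray t0)); last first.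
  have gt : good (ray t0) by move=> a aP; apply: contrapT => h; apply: nd; exists a.
  have [a aP] := Phi_neq0.
  have [v [u ad]] := wall_exists aP; have [rv _ _ _ _] := ad.
  have pv : p (rvee v) = 0.
    rewrite /p; case: ifP => // rB.
    by apply: (line_top (r := 0) ad rB _ Dt0); rewrite scale0r addr0.
  by rewrite (cf_unique rv gt wp sp pv) eqxx in pl.
have [v [u ad]] := wall_exists aP; have [rv ru _ [av au] _] := ad.
pose S := [seq l <- B | p l != 0].
have S0 : S != [::] by have : l \in S by [rewrite mem_filter pl sp]; case: (S).
have [||s0] := wall_bound (k := 0) rv aP av S0.
- move=> b bP ba bNa; have [//|ndb] := one_wall t0 aP bP ba bNa.
  exact: (wave_spread wp uB sp (fun l lB => proj1 (proj1 (hB l) lB))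
    (fun l lB => hKB lB bP) bP ndb).
- by move=> s w; rewrite mem_filter mul0r addr0 => /andP[_ /hB[_ ->]].
rewrite mem_filter => /andP[ps0 s0B] [r s0E].
by move: ps0; rewrite /p s0B (line_top ad s0B s0E) // eqxx.
Qed.

End Division.
Let polyXsubC_nz (w : R[i]) : 'X - w%:P != 0 := monic_neq0 (monicXsubC w).

(** Linear factors of [D'] are removed one by one: a nonzero root is common to all [Q l] by
    [line_root], and the root 0 is moved into the power of [w]. *)
Lemma line_regular : exists (N : nat) (G : 'rV[R]_n -> {poly R[i]}),
  forall l, l \in B -> 'X^N * Pp l = Dp * G l.
Proof.
suff aux k (D' : {poly R[i]}) Q M : (size D' < k)%N -> D' != 0 ->
    (forall l, l \in B -> D' * 'X^M * Pp l = Dp * Q l) ->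
    exists (N : nat) (G : 'rV[R]_n -> {poly R[i]}), forall l, l \in B -> 'X^N * Pp l = Dp * G l.
  by apply: (@aux (size Dp).+1 Dp Pp 0%N) => // l lB; rewrite expr0 mulr1.
elim: k D' Q M => // k IH D' Q M; rewrite ltnS => szD D'0 DQ.
have [sz1|/closed_rootP[w0 /factor_theorem[D1 D1E]]] := eqVneq (size D') 1%N.
  have /size_poly1P[d d0 dE] := introT eqP sz1.
  exists M, (fun l => d^-1 *: Q l) => l /DQ.
  rewrite dE -scalerAr => <-; rewrite -mulrA mul_polyC scalerA mulVf // scale1r //.
have D10 : D1 != 0 by apply: contraNneq D'0 => D10; rewrite D1E D10 mul0r.
have szD1 : (size D1 < k)%N.
  by apply: leq_trans szD; rewrite D1E size_Mmonic ?monicXsubC // size_XsubC addn2.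
have [w00|w00] := eqVneq w0 0.
  apply: (IH D1 Q M.+1) => // l lB; rewrite -DQ // D1E w00 subr0 exprS mulrA.
  by rewrite -!mulrA.
have [t0 t0E] := qpow_surj w00.
have Qroot l : l \in B -> Q l = (Q l %/ ('X - w0%:P)) * ('X - w0%:P).
  move=> lB; apply/esym/divpK; rewrite dvdp_XsubCl; apply/rootP; rewrite -t0E.
  by apply: (line_root D'0 DQ lB); rewrite D1E t0E !hornerE subrr mulr0.
apply: (IH D1 (fun l => Q l %/ ('X - w0%:P)) M) => // l lB.
apply: (mulfI (polyXsubC_nz w0)).
by rewrite [RHS]mulrCA [_ * (Q l %/ _)]mulrC -Qroot // -DQ // D1E -!mulrA mulrCA.
Qed.

(** This is [2 (rroot y, y)], the pole order of [top_coef y] at [w = 0]. *)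
Definition pole_order : nat :=
  \sum_(b <- Phi | 0 < dot b y) \sum_(1 <= j < (m b).+1) absz (Num.floor (dot b y)).

Lemma polar_top : polar pole_order (fun t : R[i] => top_coef y (ray t)).
Proof.
apply: polar_prod => b bP by0; apply: polar_prod => j _ _.
have [k kE bE] := rayE 0 bP; rewrite kE intrKfloor.
have k0 : 0 < k by rewrite -(ltr0z R) -kE.
rewrite (_ : (fun t : R[i] => _) = fun t : R[i] => br (j%:R - pr b x0 - t *~ absz k)).
  by apply: polar_qbr; move: k0; clear; lia.
apply/funext => t1; rewrite dotDr (dotZr t1) dot_cplx kE real_complex_int opprD addrA gtz0_abs //.
by rewrite mulrzr.
Qed.

Lemma limit_unique c : limit_eqs y c -> supported B c -> c (rvee y) = 0 ->
  forall l, c l = 0.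
Proof.
move=> le sc c0 l; apply/eqP; apply: contraT => cl.
pose S := [seq l <- B | c l != 0].
have S0 : S != [::] by have : l \in S by [rewrite mem_filter cl sc]; case: (S).
have [|s0] := top_bound ry S0.
  move=> a aP; exact: (limit_spread le ry uB sc
    (fun l lB => proj1 (proj1 (hB l) lB)) aP).
rewrite mem_filter => /andP[cs0 s0B] top.
have s0le u : dot (s0 - rvee y) u <= 0.
  by have [t] := top u; rewrite mem_filter => /andP[_ /hB[_ /(_ u)]] h1 h2; lra.
move: cs0; suff -> : s0 = rvee y by rewrite c0 eqxx.
apply/eqP; rewrite -subr_eq0 -dot_eq0 eq_le dot_ge0 andbT; exact: s0le.
Qed.

(** Multiplied by [w^K] the bracket becomes the polynomial [W], whose value at [w = 0] is the
    dominating exponential. *)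
Lemma limit_wave N (G : 'rV[R]_n -> {poly R[i]}) :
  (forall l, l \in B -> 'X^N * Pp l = Dp * G l) ->
  limit_eqs y (fun l => if l \in B then (G l).[0] else 0).
Proof.
move=> hG; apply: (string_eqs_intro uB) => [l|a s t aP ay0 sm tP]; first by case: ifP => //; rewrite eqxx.
have [k kE _] := rayE 0 aP.
have k0 : k < 0 by rewrite -(ltrz0 R) -kE.
have [k1 k10 k1E] : exists2 k1 : nat, (0 < k1)%N & k = - k1%:Z.
  by exists (absz k); move: k0; clear; lia.
pose K := (s * k1)%N; pose A := s%:R * pr a x0.
pose d l := s%:R * (dot a l)%:C : R[i].
pose W l : {poly R[i]} := (e (A + d l))%:P - (e (- (A + d l)))%:P * 'X^(K + K).
have WE l (t1 : R[i]) : (W l).[e t1] = e t1 ^+ K * br (s%:R * (pr a (ray t1) + (dot a l)%:C)).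
  rewrite /W !(hornerD, hornerN, hornerM, hornerC, hornerXn).
  have -> : s%:R * (pr a (ray t1) + (dot a l)%:C) = A + d l - t1 *+ K.
    rewrite dotDr (dotZr t1) dot_cplx kE real_complex_int /A /d /K mulrnA -mulrzr.
    by rewrite k1E intrN -[t1 *+ s]mulr_natr -[_ *+ k1]mulr_natr; ring.
  move: (A + d l) => Z; rewrite /qbr opprB qpowB (_ : t1 *+ K - Z = t1 *+ K + - Z) // qpowD !qpowMn exprD.
  field; by rewrite expf_neq0 ?qpow_neq0.
have sum0 : \sum_(l <- B | `[< same_string a t l >]) (if l \in B then G l else 0) * W l = 0.
  apply: (poly_generic_eq0 Dp0) => t1 Dt.
  rewrite horner_sum; have := @cf_wave (ray t1) a s t B aP I sm tP uB (@cf_supp (ray t1)).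
  move=> /(congr1 ( *%R (e t1 ^+ N * e t1 ^+ K))); rewrite mulr0 => h; apply: etrans h.
  rewrite [RHS]mulr_sumr [LHS]big_seq_cond [RHS]big_seq_cond; apply: eq_bigr => l /andP[lB _].
  rewrite lB hornerM WE mulrACA; congr (_ * _); apply: (mulfI Dt).
  by rewrite -hornerM -hG // hornerM hornerXn -cf_ray //; ring.
move: sum0 => /(congr1 (fun P => P.[0])); rewrite horner_sum horner0.
move=> /(congr1 ( *%R (e (- A)))); rewrite mulr0 => h; apply: etrans h.
rewrite [RHS]mulr_sumr; apply: eq_bigr => l _.
have -> : (if l \in B then (G l).[0] else 0) = (if l \in B then G l else 0).[0].
  by case: ifP => // _; rewrite horner0.
rewrite hornerM /W !(hornerD, hornerN, hornerM, hornerC, hornerXn).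
have K0 : (0 < K)%N by rewrite muln_gt0 k10 andbT; case/andP: sm.
rewrite expr0n addn_eq0 eqn0Ngt K0 mulr0 subr0 mulrCA -qpowD.
by rewrite addrA addNr add0r.
Qed.

(* A higher pole would leave a nonzero solution of limit_eqs with vanishing     *)
(* coefficient at rvee y.                                                       *)
Lemma line_limit : exists G : 'rV[R]_n -> {poly R[i]},
  [/\ forall l, l \in B -> 'X^pole_order * Pp l = Dp * G l, (G (rvee y)).[0] != 0 &
      limit_eqs y (fun l => if l \in B then (G l).[0] else 0)].
Proof.
have [T T0 TE] := polar_top; have yB := rvee_B ry.
have topE : 'X^pole_order * Pp (rvee y) = Dp * T.
  apply/eqP; rewrite -subr_eq0; apply/eqP.
  apply: (poly_generic_eq0 E0) => t /good_ray gt.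
  rewrite !(hornerD, hornerN, hornerM, hornerXn) -TE -cf_ray //.
  rewrite (chamber_formula gt ry).
  ring.
have [N [G0 hG0]] := line_regular.
have : exists (d : nat) (G : 'rV[R]_n -> {poly R[i]}), forall l, l \in B -> 'X^(pole_order + d) * Pp l = Dp * G l.
  exists N, (fun l => 'X^pole_order * G0 l) => l lB.
  by rewrite exprD -mulrA hG0 // mulrCA.
move=> [d]; elim: d => [|d IH] [G hG].
  exists G; split; first by move=> l lB; rewrite -hG // addn0.
    suff -> : G (rvee y) = T by [].
    by apply: (mulfI Dp0); rewrite -topE -hG // addn0.
  by apply: (limit_wave (N := pole_order)) => l lB; rewrite -hG // addn0.
have GX l : l \in B -> G l = (G l %/ 'X) * 'X.
  move=> lB; apply/esym/divpK; rewrite -['X]subr0 -polyC0 dvdp_XsubCl; apply/rootP.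
  have := limit_unique (limit_wave hG) _ _ l; rewrite lB; apply.
    by move=> l'; case: ifP => //; rewrite eqxx.
  rewrite yB; have -> : G (rvee y) = 'X^(d.+1) * T.
    apply: (mulfI Dp0); rewrite -hG // exprD -mulrA mulrCA topE; ring.
  by rewrite hornerM hornerXn expr0n mul0r.
apply: IH; exists (fun l => G l %/ 'X) => l lB; apply: (mulfI (monic_neq0 (monicX _))).
by rewrite [RHS]mulrCA [_ * (G l %/ _)]mulrC -GX // -hG // mulrA -exprS addnS.
Qed.

End Ray.

(** The coefficients [d] of the product of all [[(b^vee,z) + s]] with [b] positive on [y] and
    [1 <= s <= m b] also solve the limit system, so [c] is proportional to [d]. At [z = rroot y] no
    factor vanishes because [(b^vee,z) >= 0]. *)
Lemma limit_sum_neq0 (y : 'rV[R]_n) c : regular y -> limit_eqs y c -> supported B c ->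
  c (rvee y) != 0 -> \sum_(l <- B) c l * e (2 * pr l (cplx (rroot y))) != 0.
Proof.
move=> ry le sc cy.
pose L : seq ('rV[R]_n * R[i]) :=
  [seq (checkv b, s%:R) | b <- [seq b <- finmap.enum_fset Phi | 0 < dot b y], s <- iota 1 (m b)].
have LP i : i \in L -> coroot_lattice i.1.
  move=> /allpairsPdep[b [s [+ _ ->]]]; rewrite mem_filter => /andP[_ bP] /=.
  exact: coroot_lattice_root.
have LE (V : nmodType) (F : 'rV[R]_n -> V) :
    \sum_(i <- L) F i.1 = \sum_(b <- Phi | 0 < dot b y) F (checkv b) *+ m b.
  rewrite big_allpairs_dep big_filter; apply: eq_bigr => b _ /=.
  by rewrite big_const_seq count_predT size_iota iter_addr_0.
have [P [PE Ph]] := qbr_prod_expand LP.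
have rvE : 2^-1 *: (\sum_(i <- L) i.1) = rvee y.
  rewrite (LE _ id) /rvee /half_sum; congr (_ *: _); apply: eq_bigr => b _.
  by rewrite scaler_nat.
have yB := rvee_B ry.
have PB k : k \in P -> k.1 \in B.
  move=> /Ph[h1 h2]; apply/hB; split.
    have -> : k.1 = rvee y - (rvee y - k.1) by rewrite opprB addrC subrK.
    apply: coweightB; first exact: (coweight_rvee ry).
    by rewrite -rvE; exact: coweight_lattice.
  move=> u; rewrite (hN_abs u ry); apply: (le_trans (h2 u)).
  rewrite (LE _ (fun v => `|dot v u|)); rewrite le_eqVlt; apply/orP; left; apply/eqP; congr (_ * _); apply: eq_bigr => b _.
  by rewrite mulr_natl.
pose d l : R[i] := \sum_(k <- P | k.1 == l) k.2.
have FE z : \prod_(i <- L) br (pr i.1 z + i.2) = \sum_(l <- B) d l * e (2 * pr l z).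
  rewrite PE (eq_bigr (fun l => \sum_(k <- P | k.1 == l) k.2 * e (2 * pr k.1 z))); last first.
    by move=> l _; rewrite mulr_suml; apply: eq_bigr => k /eqP->.
  rewrite (exchange_big_dep xpredT) //= big_seq [RHS]big_seq; apply: eq_bigr => k kP.
  rewrite -big_filter (eq_filter (a2 := pred1 k.1)); last by move=> l /=; rewrite eq_sym.
  by rewrite filter_pred1_uniq ?PB // big_seq1.
have sd : supported B d.
  move=> l; apply: contraNT => lB; rewrite /d big_seq_cond big1 // => k /andP[kP /eqP kl].
  by case/negP: lB; rewrite -kl PB.
have ld : limit_eqs y d.
  apply: string_eqs_collect => a s t aP ay sm tP.
  apply: string_sums => // [k /PB/hB[//]|z Gz].
  (* On the shifted wall the factor indexed by the coroot of [-a] and by [s] vanishes. *)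
  have : \prod_(i <- L) br (pr i.1 (z + (s%:R / 2) *: cplx a) + i.2) = 0.
    apply/eqP; rewrite prodf_seq_eq0; apply/hasP.
    have NaP : - a \in Phi by rewrite rootN.
    exists (checkv (- a), s%:R).
      apply/allpairsPdep; exists (- a), s; rewrite mem_filter pos_negE ay mem_iota.
      by split=> //; rewrite add1n ltnS (mult_opp aP).
    rewrite /= checkvN cplxN dotNl dotDr (dotZr _ _ (cplx a)) dot_cplx.
    rewrite dot_checkv_self ?(root_nz aP) // rmorph_nat divfK ?pnatr_eq0 //.
    by rewrite opprD subrK qbrN oppr_eq0 qbr_eq0 // Gz.
  rewrite PE => h; apply: etrans h; apply: eq_bigr => k _.
  rewrite dotDr (dotZr _ _ (cplx a)) dot_cplx mulrDr qpowD (dotC k.1 a).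
  rewrite (_ : 2 * (s%:R / 2 * _) = s%:R * (dot a k.1)%:C); last by field.
  by rewrite mulrAC mulrA.
have Fy : \prod_(i <- L) br (pr i.1 (cplx (rroot y)) + i.2) != 0.
  rewrite prodf_seq_neq0; apply/allP => i /allpairsPdep[b [s [+ + ->]]] /=.
  rewrite mem_filter mem_iota => /andP[bv bP] /andP[s0 _].
  have [k kE] := rroot_pairing y bP.
  have k0 : 0 <= k.
    rewrite -(ler0z R) -kE mulr_ge0 // dotC /checkv dotZl mulr_ge0 ?divr_ge0 ?dot_ge0 //.
    by rewrite dotC (rroot_dominant ry bP bv).
  have -> : pr (checkv b) (cplx (rroot y)) = (2 * dot (rroot y) (checkv b))%:C / 2.
    by rewrite dot_cplx (dotC (checkv b)) rmorphM rmorph_nat mulrC mulKf ?pnatr_eq0.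
  rewrite qbr_eq0 // kE real_complex_int mulrDr mulrC divfK ?pnatr_eq0 //.
  rewrite (_ : _ + _ = (k + (2 * s)%:Z)%:~R); last by rewrite intrD -pmulrn natrM.
  by apply/eqP => /qpow_int_eq1; move: s0 k0; clear; lia.
apply/eqP => F0.
(* This combination of [c] and [d] cancels at [rvee y] and therefore everywhere. *)
have h := limit_unique ry
  (string_eqs_lin (k1 := d (rvee y)) (k2 := - c (rvee y)) sc sd le ld) _ _.
have : d (rvee y) * (\sum_(l <- B) c l * e (2 * pr l (cplx (rroot y)))) +
    - c (rvee y) * (\sum_(l <- B) d l * e (2 * pr l (cplx (rroot y)))) = 0.
  rewrite [X in X + _]mulr_sumr [X in _ + X]mulr_sumr -big_split /= big1 // => l _.
  rewrite !mulrA -mulrDl h ?mul0r //; last by ring.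
  move=> l'; apply: contraNT => lB.
  rewrite (contraNeq (@sc l') lB) (contraNeq (@sd l') lB) !mulr0 addr0.
  by rewrite eqxx.
rewrite F0 mulr0 add0r -FE => /eqP; rewrite mulf_eq0 oppr_eq0.
by rewrite (negbTE cy) (negbTE Fy).
Qed.

(** * Algebra of difference operators *)

(** Different indices may carry the same shift, as happens in compositions; their coefficients are
    collected. *)
Lemma difference_operator_pairs (I : eqType) (s : seq I) (nu : I -> 'rV[R]_n)
    (d : I -> 'rV[R[i]]_n -> R[i]) (D : ('rV[R[i]]_n -> R[i]) -> 'rV[R[i]]_n -> R[i]) :
  (forall i, i \in s -> coweight Phi (nu i)) -> (forall i, i \in s -> trig_rational (d i)) ->
  (forall F x, D F x = \sum_(i <- s) d i x * F (x + cplx (nu i))) -> difference_operator D.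
Proof.
move=> sP dP DE; exists (undup (map nu s)), (fun l x => \sum_(i <- s | nu i == l) d i x).
split=> [l|l|F x].
- by rewrite mem_undup => /mapP[i /sP h ->].
- by move=> _; apply: trig_rational_sum => i i_s _; exact: dP.
rewrite DE (eq_bigr (fun l => \sum_(i <- s | nu i == l) d i x * F (x + cplx (nu i)))); last first.
  by move=> l _; rewrite mulr_suml; apply: eq_bigr => i /eqP->.
rewrite (exchange_big_dep xpredT) //= big_seq [RHS]big_seq; apply: eq_bigr => i i_s.
rewrite -big_filter (_ : [seq l <- _ | _] = [:: nu i]) ?big_seq1 //.
rewrite (eq_filter (a2 := pred1 (nu i))); last by move=> l /=; rewrite eq_sym.
by rewrite filter_pred1_uniq ?undup_uniq // mem_undup map_f.
Qed.

Lemma difference_operatorB D E : difference_operator D -> difference_operator E ->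
  difference_operator (fun F x => D F x - E F x).
Proof.
move=> [s [d [sP dP DE]]] [s' [d' [s'P d'P EE]]].
apply: (@difference_operator_pairs _ (map inl s ++ map inr s')
  (fun i => match i with inl l => l | inr l => l end)
  (fun i => match i with inl l => d l | inr l => fun x => - d' l x end)).
- by move=> i; rewrite mem_cat => /orP[] /mapP[l ? ->]; auto.
- move=> i; rewrite mem_cat => /orP[] /mapP[l lP ->]; first exact: dP.
  have := trig_rationalM (trig_rational_const (-1)) (d'P l lP).
  by congr Defs.trig_rational; apply/funext => x; rewrite mulN1r.
move=> F x; rewrite DE EE big_cat !big_map -sumrN; congr (_ + _).
by apply: eq_bigr => l _; rewrite mulNr.
Qed.

Lemma difference_operator_comp D E : difference_operator D -> difference_operator E ->
  difference_operator (D \o E).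
Proof.
move=> [s [d [sP dP DE]]] [s' [d' [s'P d'P EE]]].
apply: (@difference_operator_pairs _ [seq (l, l') | l <- s, l' <- s']
  (fun p => p.1 + p.2) (fun p x => d p.1 x * d' p.2 (x + cplx p.1))).
- by move=> _ /allpairsP[p [/sP h1 /s'P h2 ->]]; exact: coweightD.
- move=> _ /allpairsP[p [h1 h2 ->]]; apply: trig_rationalM; first exact: dP.
  by apply: trig_rational_shift; exact: d'P.
move=> F x; rewrite /= DE big_allpairs_dep; apply: eq_bigr => l _.
rewrite EE mulr_sumr; apply: eq_bigr => l' _ /=.
by rewrite cplxD addrA mulrA.
Qed.

Lemma shift_sum (F : 'rV[R]_n -> R[i]) C nu z : uniq C ->
  (forall l, F l != 0 -> l \in B) -> (forall l, l \in B -> nu + l \in C) ->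
  e (2 * pr nu z) * (\sum_(l <- B) F l * e (2 * pr l z)) =
  \sum_(l <- C) F (l - nu) * e (2 * pr l z).
Proof.
move=> uC sF BC; rewrite [LHS]mulr_sumr.
rewrite (eq_bigr (fun l => F (l + nu - nu) * e (2 * pr (l + nu) z))); last first.
  by move=> l _; rewrite addrK cplxD dotDl mulrDr qpowD; ring.
rewrite -(big_map (fun l => l + nu) xpredT (fun l => F (l - nu) * e (2 * pr l z))).
apply: big_support => //.
- by rewrite map_inj_uniq //; exact: addIr.
- move=> l; rewrite mulf_eq0 negb_or => /andP[/sF lB _].
  by apply/mapP; exists (l - nu); rewrite ?subrK.
move=> l; rewrite mulf_eq0 negb_or => /andP[/sF lB _].
by rewrite -(subrKC nu l); exact: BC.
Qed.

(** * The operators D_f *)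

Variable psi : 'rV[R[i]]_n -> 'rV[R[i]]_n -> R[i].
Hypothesis psiE : forall x z,
  psi x z = e (2 * dot x z) * \sum_(l <- B) cf l x * e (2 * pr l z).
Hypothesis psi_qi : forall x, quasi_invariant lq Phi m (psi x).

Lemma psi_shift C nu x z : uniq C -> (forall l, l \in B -> nu + l \in C) ->
  psi (x + cplx nu) z =
  e (2 * dot x z) * \sum_(l <- C) cf (l - nu) (x + cplx nu) * e (2 * pr l z).
Proof.
move=> uC BC; rewrite psiE dotDl mulrDr qpowD -mulrA; congr (_ * _).
by rewrite (shift_sum (F := cf^~ (x + cplx nu)) z uC) // => l; exact: cf_supp.
Qed.

(** Order the shifts by their pairing with [v0]. In the row of a maximal [nus] with nonzero
    coefficient, a nonzero entry at [nu] makes [nus + rvee v0 - nu] extremal in N at [v0], so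
    [nu = nus]; the diagonal entry is a nonzero vertex coefficient. *)
Lemma triangular_system Q (d : 'rV[R]_n -> R[i]) x : uniq Q ->
  (forall nu, nu \in Q -> good (x + cplx nu)) ->
  (forall nu', nu' \in Q -> \sum_(nu <- Q) d nu * cf (nu' + rvee v0 - nu) (x + cplx nu) = 0) ->
  forall nu, nu \in Q -> d nu = 0.
Proof.
move=> uQ gQ h nu1 nu1Q; apply/eqP; apply: contraT => dnu1.
have nu1Q' : nu1 \in [seq nu <- Q | d nu != 0] by rewrite mem_filter dnu1.
have [nus nusQ' nusmax] := seq_argmax (dot^~ v0) nu1Q'.
move: nusQ'; rewrite mem_filter => /andP[dnus nusQ].
have rest : \sum_(nu <- Q | nu != nus) d nu * cf (nus + rvee v0 - nu) (x + cplx nu) = 0.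
  rewrite big_seq_cond big1 // => nu /andP[nuQ nunus].
  have [->|dnu] := eqVneq (d nu) 0; first by rewrite mul0r.
  apply/eqP; rewrite mulf_eq0 (negbTE dnu) /=; apply: contraT => cfn.
  have := nusmax nu; rewrite mem_filter dnu nuQ => /(_ isT) nule.
  have [_ lN] := proj1 (hB _) (cf_supp cfn).
  have := lN v0; rewrite (hN_chamber rv0) dotBl dotDl => le1.
  have lE : nus + rvee v0 - nu = rvee v0.
    apply: (hN_top rv0) => //.
    by rewrite dotBl dotDl; apply/eqP; rewrite eq_le; apply/andP; split; lra.
  by move: nunus; rewrite -(inj_eq (addIr (rvee v0))) -{1}lE addrC subrK addrC eqxx.
have := h nus nusQ; rewrite (bigD1_seq nus) //= rest addr0.
rewrite addrAC subrr add0r cf_top => /eqP; rewrite mulf_eq0 (negbTE dnus) /=.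
by rewrite (negbTE (top_coef_neq0 v0 (gQ nus nusQ))).
Qed.

Lemma generically_good_shift (Q : seq 'rV[R]_n) :
  generically (fun x => forall nu, nu \in Q -> good (x + cplx nu)).
Proof.
apply: generically_seq => nu _; apply: generically_shift.
exact: generically_good.
Qed.

(* An operator annihilating psi vanishes: the coefficient of a maximal shift   *)
(* survives in the leading term.                                              *)
Lemma operator_unique D : difference_operator D ->
  generically (fun x => forall z, D (psi^~ z) x = 0) ->
  generically (fun x => forall F, D F x = 0).
Proof.
move=> [s [d [sP _ DE]]] D0; have gs := generically_good_shift s.
have := generically_and D0 gs.
apply: generically_mono => x [{}D0 {}gs] F.
pose Q := undup s; pose d' nu := d nu x *+ count_mem nu s.
have DE' F' : D F' x = \sum_(nu <- Q) d' nu * F' (x + cplx nu).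
  rewrite DE -big_undup_iterop_count; apply: eq_bigr => nu _.
  by rewrite /d' mulrnAl.
pose C := undup [seq nu + l | nu <- Q, l <- B].
have uC : uniq C by exact: undup_uniq.
have QBC nu l : nu \in Q -> l \in B -> nu + l \in C.
  by move=> nuQ lB; rewrite mem_undup; exact: allpairs_f.
have coef l : l \in C -> \sum_(nu <- Q) d' nu * cf (l - nu) (x + cplx nu) = 0.
  apply: (exp_independent (C := C)
    (k := fun l => \sum_(nu <- Q) d' nu * cf (l - nu) (x + cplx nu)) uC) => z.
  have := D0 z; rewrite DE' big_seq.
  rewrite (eq_bigr (fun nu => e (2 * dot x z) *
     (d' nu * \sum_(l <- C) cf (l - nu) (x + cplx nu) * e (2 * pr l z)))); last first.
    move=> nu nuQ; rewrite (psi_shift x z uC) 1?mulrCA // => l2 l2B; exact: QBC.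
  rewrite -big_seq -mulr_sumr => /eqP; rewrite mulf_eq0 (negbTE (qpow_neq0 _)) /= => /eqP E.
  rewrite -[RHS]E; under eq_bigr do rewrite mulr_suml.
  rewrite exchange_big; apply: eq_bigr => nu _; rewrite [RHS]mulr_sumr.
  by apply: eq_bigr => l' _; rewrite mulrA.
have d0 : forall nu, nu \in Q -> d' nu = 0.
  apply: (triangular_system (x := x)); first exact: undup_uniq.
    by move=> nu; rewrite mem_undup; exact: gs.
  by move=> nu' nu'Q; apply: coef; apply: QBC => //; exact: rvee_B.
by rewrite DE' big_seq big1 // => nu /d0->; rewrite mul0r.
Qed.

Lemma eigenoperator_unique f D E : eigenoperator lq Phi psi f D ->
  difference_operator E -> generically (fun x => forall z, E (psi^~ z) x = f z * psi x z) ->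
  operator_eq lq Phi D E.
Proof.
move=> [dD hD] dE hE.
have := operator_unique (difference_operatorB dD dE).
have h : generically (fun x => forall z, D (psi^~ z) x - E (psi^~ z) x = 0).
  have := generically_and hD hE.
  by apply: generically_mono => x [h1 h2] z; rewrite h1 h2 subrr.
move=> /(_ h); apply: generically_mono => x h' F; apply/eqP.
by rewrite -subr_eq0 h'.
Qed.

Lemma eigenoperator_comp f g D E : eigenoperator lq Phi psi f D ->
  eigenoperator lq Phi psi g E ->
  difference_operator (D \o E) /\
  generically (fun x => forall z, (D \o E) (psi^~ z) x = g z * f z * psi x z).
Proof.
move=> [dD hD] [dE hE]; split; first exact: difference_operator_comp.
have [s [d [sP dP DE]]] := dD.
have hEs : generically (fun x => forall nu, nu \in s ->
    forall z, E (psi^~ z) (x + cplx nu) = g z * psi (x + cplx nu) z).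
  apply: generically_seq => nu _.
  exact: (generically_shift (P := fun x => forall z, E (psi^~ z) x = g z * psi x z) (cplx nu) hE).
have := generically_and hD hEs.
apply: generically_mono => x [h1 h2] z.
rewrite /= DE -mulrA -h1 DE mulr_sumr big_seq [RHS]big_seq; apply: eq_bigr => nu nus.
by rewrite h2 // mulrCA.
Qed.

(** Both compositions multiply psi by [f g], and an operator is determined by its action on psi. *)
Lemma eigenoperators_commute f g D E : eigenoperator lq Phi psi f D ->
  eigenoperator lq Phi psi g E -> operator_eq lq Phi (D \o E) (E \o D).
Proof.
move=> hD hE; have [dDE hDE] := eigenoperator_comp hD hE.
have [dED hED] := eigenoperator_comp hE hD.
apply: (@eigenoperator_unique (fun z => g z * f z)) => //.
by apply: generically_mono hED => x h z; rewrite h [f z * _]mulrC.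
Qed.

Lemma pair_coef (s : seq 'rV[R]_n) (k : 'rV[R]_n -> R[i]) (F : 'rV[R]_n -> R[i]) l :
  (forall l, F l != 0 -> l \in B) ->
  \sum_(p <- [seq (kap, l) | kap <- s, l <- B] | p.1 + p.2 == l) k p.1 * F p.2 =
  \sum_(kap <- s) k kap * F (l - kap).
Proof.
move=> sF; rewrite big_mkcond big_allpairs_dep; apply: eq_bigr => kap _ /=.
have [hlB|lB] := boolP (l - kap \in B); last first.
  have -> : F (l - kap) = 0 by apply/eqP; apply: contraNT lB; exact: sF.
  rewrite mulr0 big_seq big1 // => l' l'B; rewrite ifN //.
  by apply: contraNneq lB => <-; rewrite addrC addKr.
rewrite (bigD1_seq (l - kap)) //= subrKC eqxx big1 ?addr0 // => l' l'l.
by rewrite ifN //; apply: contraNneq l'l => <-; rewrite addrC addKr.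
Qed.

Lemma quasi_invariantM (f g : 'rV[R[i]]_n -> R[i]) : quasi_invariant lq Phi m f ->
  quasi_invariant lq Phi m g -> quasi_invariant lq Phi m (fun z => f z * g z).
Proof. by move=> hf hg a s z aP sm h; rewrite hf // hg. Qed.

(** The product [f psi] is again quasi-invariant and keeps the prefactor [q^(2(x,z))]. *)
Lemma product_wave f (s : seq 'rV[R]_n) (k : 'rV[R]_n -> R[i]) x :
  (forall nu, nu \in s -> coweight Phi nu) -> quasi_invariant lq Phi m f ->
  (forall z, f z = \sum_(nu <- s) k nu * e (2 * pr nu z)) ->
  wave_eqs x (fun l => \sum_(kap <- s) k kap * cf (l - kap) x).
Proof.
move=> sP qf fE.
have := @quasi_invariant_wave _
  [seq (kap, l) | kap <- s, l <- B] (fun p => p.1 + p.2) (fun p => k p.1 * cf p.2 x) x.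
rewrite (_ : (fun l => _) = (fun l => \sum_(kap <- s) k kap * cf (l - kap) x)); last first.
  by apply/funext => l; rewrite (pair_coef _ _ (F := cf^~ x)) // => l'; exact: cf_supp.
apply.
  by move=> _ /allpairsP[p [/sP h1 /hB[h2 _] ->]]; exact: coweightD.
have := quasi_invariantM qf (psi_qi x); congr (quasi_invariant _ _ _ _); apply/funext => z.
rewrite fE psiE big_allpairs_dep mulrCA; congr (_ * _).
rewrite [LHS]mulr_suml; apply: eq_bigr => kap _; rewrite [LHS]mulr_sumr.
by apply: eq_bigr => l _ /=; rewrite cplxD dotDl mulrDr qpowD; ring.
Qed.

Lemma product_expand f (s : seq 'rV[R]_n) (k : 'rV[R]_n -> R[i]) C x z :
  (forall z, f z = \sum_(nu <- s) k nu * e (2 * pr nu z)) -> uniq C ->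
  (forall kap l, kap \in s -> l \in B -> kap + l \in C) ->
  f z * psi x z = e (2 * dot x z) *
     \sum_(l <- C) (\sum_(kap <- s) k kap * cf (l - kap) x) * e (2 * pr l z).
Proof.
move=> fE uC sC; rewrite fE psiE mulrCA; congr (_ * _).
under [RHS]eq_bigr do rewrite mulr_suml.
rewrite exchange_big /= mulr_suml big_seq [RHS]big_seq; apply: eq_bigr => kap kaps.
rewrite -mulrA (shift_sum (F := cf^~ x) z uC).
- by rewrite [LHS]mulr_sumr; apply: eq_bigr => l _; rewrite mulrA.
- by move=> l; exact: cf_supp.
by move=> l lB; exact: sC.
Qed.

(** The unknown [d nu], for coweights [nu] in the hull of the exponents of [f], are found by
    matching the combination of the shifts of psi with [f psi] at the weights [nu + rvee v0] only;
    [wave_vanish] then gives equality of all coefficients. Cramer's rule makes the [d nu] rational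
    in [x]. *)
Lemma eigenoperator_exists f : qi_ring lq Phi m f -> exists D, eigenoperator lq Phi psi f D.
Proof.
move=> [[s [k [sP fE]]] qf].
have [Ks hKs] := pairing_bound s (finmap.enum_fset Phi).
have [QB uQB hQB] := coweight_ball Ks.
pose Q := [seq nu <- QB | `[< forall u, exists2 kap, kap \in s & dot nu u <= dot kap u >]].
have uQ : uniq Q by exact: filter_uniq.
have hQ nu : nu \in Q <-> coweight Phi nu /\
    forall u, exists2 kap, kap \in s & dot nu u <= dot kap u.
  rewrite mem_filter; split=> [/andP[/asboolP h /hQB[]] //|[nuP h]].
  apply/andP; split; first exact/asboolP.
  apply/hQB; split=> // a aP; have bd b : b \in Phi -> dot nu b <= Ks%:R.
    move=> bP; have [kap kaps le] := h b; apply: (le_trans le).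
    by apply: (le_trans (ler_norm _)); exact: hKs.
  by rewrite ler_norml bd // andbT lerNl -dotNr bd ?rootN.
(* A list carrying the weights of both sides of the eigenvalue equation. *)
pose C := undup ([seq kap + l | kap <- s, l <- B] ++ [seq nu + l | nu <- Q, l <- B]).
have uC : uniq C by exact: undup_uniq.
have sBC kap l : kap \in s -> l \in B -> kap + l \in C.
  by move=> h1 h2; rewrite mem_undup mem_cat allpairs_f.
have QBC nu l : nu \in Q -> l \in B -> nu + l \in C.
  by move=> h1 h2; rewrite mem_undup mem_cat orbC allpairs_f.
have [K hK] := pairing_bound C (finmap.enum_fset Phi).
pose phi l x := \sum_(kap <- s) k kap * cf (l - kap) x.
have cf_rat := cf_rational.
have mulrat := trig_rationalM.
have sumrat := trig_rational_sum.
have phi_rat l : trig_rational (phi l).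
  apply: (@sumrat) => kap _ _; apply: (@mulrat); first exact: trig_rational_const.
  exact: cf_rat.
pose Qn (i : 'I_(size Q)) := nth 0 Q i.
have QnQ i : Qn i \in Q by exact: mem_nth.
pose T x := \matrix_(i < size Q, j < size Q) cf (Qn i + rvee v0 - Qn j) (x + cplx (Qn j)).
have T_rat i j : trig_rational (fun x => T x i j).
  have := trig_rational_shift (cplx (Qn j)) (cf_rat (Qn i + rvee v0 - Qn j)).
  by congr Defs.trig_rational; apply/funext => x; rewrite mxE.
have detT x : (forall nu, nu \in Q -> good (x + cplx nu)) -> \det (T x) != 0.
  move=> gx; rewrite -det_tr; apply/negP => /det0P[y y0 yT].
  pose d l := oapp (fun i => y 0 i) 0 (insub (index l Q)).
  have dE i : d (Qn i) = y 0 i by rewrite /d index_uniq // valK.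
  have d0 : forall nu, nu \in Q -> d nu = 0.
    apply: (triangular_system uQ gx) => nu' nu'Q.
    have szn : (index nu' Q < size Q)%N by rewrite index_mem.
    have := congr1 (fun A : 'rV_(size Q) => A 0 (Ordinal szn)) yT; rewrite !mxE => E.
    rewrite -[RHS]E (big_nth 0) big_mkord; apply: eq_bigr => i _.
    by rewrite dE !mxE /Qn /= nth_index.
  by move/eqP: y0; apply; apply/rowP => i; rewrite -dE d0 // mxE.
pose d l x := oapp (fun i => (\det (T x))^-1 *
  \sum_j (\adj (T x)) i j * phi (Qn j + rvee v0) x) 0 (insub (index l Q)).
have genQ := generically_good_shift Q.
have d_rat l : trig_rational (d l).
  rewrite /d; case: insub => [i|]; last exact: trig_rational_const.
  apply: (@mulrat).
    apply: trig_rational_inv.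
      exact: trig_rational_det.
    exact: generically_mono genQ.
  apply: (@sumrat) => j _ _; apply: (@mulrat); last exact: phi_rat.
  exact: trig_rational_adj.
exists (fun F x => \sum_(nu <- Q) d nu x * F (x + cplx nu)).
have dop : difference_operator (fun F x => \sum_(nu <- Q) d nu x * F (x + cplx nu)).
  exists Q, d; by split=> // nu /hQ[].
split; first exact: dop.
have genK : generically (fun x => forall b, b \in finmap.enum_fset Phi -> nondegenerate b K x).
  apply: generically_seq => b bP.
  exact: (generically_nondegenerate K (root_lattice_root bP) (root_nz bP)).
have := generically_and genQ genK.
apply: generically_mono => x [gx ndx] z.
have solve i : \sum_(nu <- Q) d nu x * cf (Qn i + rvee v0 - nu) (x + cplx nu) =
    phi (Qn i + rvee v0) x.
  pose p := \col_j phi (Qn j + rvee v0) x.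
  have : T x *m ((\det (T x))^-1 *: (\adj (T x) *m p)) = p.
    rewrite -scalemxAr mulmxA mul_mx_adj mul_scalar_mx scalerA mulVf ?scale1r //.
    exact: detT.
  move=> /(congr1 (fun A : 'cV_(size Q) => A i 0)); rewrite !mxE => <-.
  rewrite (big_nth 0) big_mkord; apply: eq_bigr => j _; rewrite mulrC.
  congr (_ * _); first by rewrite [RHS]mxE.
  rewrite -/(Qn j) /d index_uniq // valK /= [RHS]mxE [X in _ = _ * X]mxE; congr (_ * _).
  by apply: eq_bigr => j' _; congr (_ * _); rewrite [RHS]mxE.
pose c l := 1 * (\sum_(nu <- Q) d nu x * cf (l - nu) (x + cplx nu)) + (-1) * phi l x.
have suppQ nu : nu \in Q -> supported C (fun l => cf (l - nu) (x + cplx nu)).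
  by move=> nuQ l /cf_supp lB; rewrite -(subrKC nu l); exact: QBC.
have sum_supp (s' : seq 'rV[R]_n) (k' : 'rV[R]_n -> R[i]) (F : 'rV[R]_n -> 'rV[R]_n -> R[i]) :
    (forall nu, nu \in s' -> supported C (F nu)) ->
    supported C (fun l => \sum_(nu <- s') k' nu * F nu l).
  move=> h l; apply: contraNT => lC; rewrite big_seq big1 // => nu nus.
  by rewrite (_ : F nu l = 0) ?mulr0 //; apply/eqP; apply: contraNT lC; exact: h.
have s1 := sum_supp Q (d^~ x) (fun nu l => cf (l - nu) (x + cplx nu)) suppQ.
have s2 : supported C (phi^~ x).
  apply: (sum_supp s k (fun kap l => cf (l - kap) x)) => kap kaps l /cf_supp lB.
  by rewrite -(subrKC kap l); exact: sBC.
have we : wave_eqs x c.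
  apply: (string_eqs_lin s1 s2); last exact: product_wave qf fE.
  apply: (wave_sum (C := C) (k := d^~ x) (ci := fun nu l => cf (l - nu) (x + cplx nu))) => // nu nuQ.
  have nuP : coweight Phi nu by have [] := proj1 (hQ nu) nuQ.
  apply: (wave_shift (c := cf^~ (x + cplx nu)) nuP uB); first by move=> l; exact: cf_supp.
  exact: cf_wave.
have sC : supported C c.
  move=> l; apply: contraNT => lC; rewrite /c.
  have -> : \sum_(nu <- Q) d nu x * cf (l - nu) (x + cplx nu) = 0.
    by apply/eqP; apply: contraNT lC; exact: s1.
  have -> : phi l x = 0 by apply/eqP; apply: contraNT lC; exact: s2.
  by rewrite !mulr0 addr0.
have memC l : l \in C -> exists kap l', [/\ coweight Phi kap, l' \in B, l = kap + l' &
    forall u, exists2 k, k \in s & dot kap u <= dot k u].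
  rewrite mem_undup mem_cat => /orP[] /allpairsP[p [h1 h2 ->]]; exists p.1, p.2; split=> //.
  - exact: sP.
  - by move=> u; exists p.1.
  - by have [] := proj1 (hQ _) h1.
  by have [] := proj1 (hQ _) h1.
have c0 : forall l, c l = 0.
  apply: (wave_vanish (K := K) (L := s) (v := v0) we uC sC) => //.
  - by move=> l /memC[kap [l' [h1 /hB[h2 _] -> _]]]; exact: coweightD.
  - move=> l u /memC[kap [l' [h1 /hB[_ h2] -> h3]]]; have [k' k's hk'] := h3 u.
    by exists k' => //; rewrite dotDl addrC lerD.
  move=> nu nuP nus; have nuQ : nu \in Q by apply/hQ.
  have szn : (index nu Q < size Q)%N by rewrite index_mem.
  have := solve (Ordinal szn); rewrite /Qn /= nth_index // /c addrC => ->.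
  by rewrite mul1r mulN1r subrr.
rewrite (product_expand x z fE uC sBC).
rewrite big_seq (eq_bigr (fun nu => e (2 * dot x z) *
   (d nu x * \sum_(l <- C) cf (l - nu) (x + cplx nu) * e (2 * pr l z)))); last first.
  by move=> nu nuQ; rewrite (psi_shift x z uC) 1?mulrCA // => l lB; exact: QBC.
rewrite -big_seq -mulr_sumr; congr (_ * _).
transitivity (\sum_(l <- C) (\sum_(nu <- Q) d nu x * cf (l - nu) (x + cplx nu)) * e (2 * pr l z)).
  under [RHS]eq_bigr do rewrite mulr_suml.
  rewrite exchange_big; apply: eq_bigr => nu _; rewrite [LHS]mulr_sumr.
  by apply: eq_bigr => l _; rewrite mulrA.
apply: eq_bigr => l _; congr (_ * _); apply/eqP; rewrite -subr_eq0.
by have := c0 l; rewrite /c mul1r mulN1r => ->.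
Qed.

(** * The value of psi at z = rho *)

Section Evaluation.
Local Notation h x := (psi x (cplx (rroot v0))).

(* The reflection of a wall fixes the midpoint of the segment joining the two *)
(* values of rroot, so the quasi-invariance with s = m_a applies there.       *)
Lemma psi_rroot v x : regular v -> psi x (cplx (rroot v)) = h x.
Proof.
move=> rv.
apply: (chamber_ind (P := fun v => psi x (cplx (rroot v)) = h x) _ _ rv0 rv) => //.
  by move=> v1 v2 _ _ hs; rewrite /rroot (half_sum_same _ hs).
move=> v1 v2 a ad <-; have [_ _ aP _ _] := ad.
have [_ uE] := half_sum_adjacent equivariant_id ad.
rewrite /rroot uE -/(rroot v1) /=.
have [->|m0] := eqVneq (m a) 0%N; first by rewrite scale0r subr0.
pose z := cplx (rroot v1 - ((m a)%:R / 2) *: a).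
have cE : (((m a)%:R / 2 : R)%:C) = (m a)%:R / 2 :> R[i].
  by rewrite rmorphM fmorphV !rmorph_nat.
have wall : e (2 * pr (checkv a) z) = 1.
  rewrite dot_cplx dotBr (dotZr _ (checkv a) a) dot_checkv_self ?(root_nz aP) //.
  by rewrite (rroot_wall ad) divfK ?pnatr_eq0 // subrr mulr0 qpow0.
have := @psi_qi x a (m a) z aP _ wall; rewrite lt0n m0 leqnn => /(_ isT).
rewrite /z -cE -cplxZ -cplxD -cplxB subrK => ->; congr (psi x (cplx _)).
by rewrite -addrA -opprD -scalerDl -splitr.
Qed.

Section PsiRay.
Variables (D : 'rV[R[i]]_n -> R[i]) (P : 'rV[R]_n -> 'rV[R[i]]_n -> R[i]) (g : 'rV[R[i]]_n -> R[i]).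
Hypothesis tD : trig_poly D.
Hypothesis tP : forall l, trig_poly (P l).
Hypothesis DP : forall l x, l \in B -> D x * cf l x = P l x.
Hypothesis tg : trig_poly g.
Hypothesis g_good : forall x, g x != 0 -> good x.

(** By [psi_rroot] the evaluation point may be taken to be [rroot y]. The prefactor then contributes
    [w^(pole_order y)], which cancels the pole found in [line_limit]; the constant term is the sum
    of [limit_sum_neq0] up to a nonzero factor. *)
Lemma psi_ray (y : 'rV[R]_n) x0 : coweight Phi y -> regular y -> D x0 != 0 -> g x0 != 0 ->
  (forall (t : R[i]) b b', b \in Phi -> b' \in Phi -> b' != b -> b' != - b ->
    nondegenerate b KB (x0 + t *: cplx y) \/ nondegenerate b' KB (x0 + t *: cplx y)) ->
  exists2 A : {poly R[i]}, A.[0] != 0 &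
    forall t : R[i], D (x0 + t *: cplx y) != 0 -> h (x0 + t *: cplx y) = A.[e t].
Proof.
move=> yP ry Dx gx one_wall.
(* One index type for the denominator, the polynomial [g] and the numerators, so that a single power
   of [w] clears them all. *)
pose F (o : option (option 'rV[R]_n)) (t : R[i]) : R[i] :=
  match o with
  | None => D (x0 + t *: cplx y)
  | Some None => g (x0 + t *: cplx y)
  | Some (Some l) => P l (x0 + t *: cplx y) end.
have [|N [Q QE]] := @laurent_family _ (None :: Some None :: [seq Some (Some l) | l <- B]) F.
  by move=> [[l|]|] _; [exact: laurent_trig (tP l) yP|exact: laurent_trig tg yP|exact: laurent_trig tD yP].
have QN := QE None; have QS := QE (Some None).
have QL l (t : R[i]) : l \in B -> e t ^+ N * P l (x0 + t *: cplx y) = (Q (Some (Some l))).[e t].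
  move=> lB; rewrite -QE // !inE; apply/orP; right; apply/orP; right.
  by apply/mapP; exists l.
have w0 (t : R[i]) : e t ^+ N != 0 by rewrite expf_neq0 ?qpow_neq0.
have ray0 : x0 + 0 *: cplx y = x0 by rewrite scale0r addr0.
have neq0 o : F o 0 != 0 -> o \in None :: Some None :: [seq Some (Some l) | l <- B] -> Q o != 0.
  by move=> F0 oP; apply: contraNneq F0 => Q0; move/eqP: (QE o 0 oP); rewrite Q0 horner0 mulf_eq0 (negbTE (w0 0)).
have QN0 : Q None != 0 by apply: neq0; rewrite ?mem_head //= ray0.
have QS0 : Q (Some None) != 0 by apply: neq0; rewrite ?inE //= ray0.
have good_ray (t : R[i]) : (Q (Some None)).[e t] != 0 -> good (x0 + t *: cplx y).
  by rewrite -QS ?inE // mulf_eq0 negb_or => /andP[_ /g_good].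
have cf_ray l (t : R[i]) : l \in B -> (Q None).[e t] * cf l (x0 + t *: cplx y) = (Q (Some (Some l))).[e t].
  by move=> lB; rewrite -QN ?mem_head // -QL // -DP // mulrA.
have [G [GE Gy le]] := line_limit yP ry one_wall QS0 good_ray QN0 cf_ray.
have yB := rvee_B ry.
exists ((e (2 * dot x0 (cplx (rroot y)))) *:
   \sum_(l <- B) e (2 * pr l (cplx (rroot y))) *: G l).
  rewrite hornerZ mulf_neq0 ?qpow_neq0 // horner_sum.
  have := limit_sum_neq0 ry le _ _.
  rewrite yB => /(_ _ Gy); rewrite (eq_big_seq (fun l => (e (2 * pr l (cplx (rroot y))) *: G l).[0])).
    by apply=> l; case: ifP => //; rewrite eqxx.
  by move=> l lB; rewrite lB hornerZ mulrC.
move=> t Dt; rewrite -(psi_rroot _ ry) psiE hornerZ dotDl mulrDr qpowD -mulrA; congr (_ * _).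
have -> : e (2 * dot (t *: cplx y) (cplx (rroot y))) = e t ^+ pole_order y.
  rewrite -qpowMn (dotZl t) dot_cplx (dotC y) -[2 : R[i]](rmorph_nat (real_complex R) 2) mulrCA -rmorphM.
  have -> : 2 * dot (rroot y) y = (pole_order y)%:R.
    rewrite rroot_dot mulVKf // /pole_order natr_sum big_seq_cond [RHS]big_seq_cond.
    apply: eq_bigr => b /andP[bP by0]; have [k kE] := coweight_pairing yP bP.
    have {}kE : dot b y = k%:~R by rewrite dotC.
    have k0 : 0 < k by rewrite -(ltr0z R) -kE.
    rewrite kE intrKfloor natr_sum big_const_nat iter_addr_0 subn1 /= -[RHS]mulr_natl.
    by rewrite -{1}(gtz0_abs k0) pmulrn.
  by rewrite rmorph_nat mulr_natr.
rewrite horner_sum [LHS]mulr_sumr big_seq [RHS]big_seq; apply: eq_bigr => l lB.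
rewrite hornerZ mulrA [RHS]mulrC; congr (_ * _).
have Qt : (Q None).[e t] != 0 by rewrite -QN ?mem_head // mulf_neq0.
by apply: (mulfI Qt); rewrite -hornerM -GE // hornerM hornerXn -cf_ray // mulrCA.
Qed.

End PsiRay.

(* On the line, h is a polynomial in w = q^t and, by symmetry, in 1/w.         *)
Lemma psi_shift_regular (y : 'rV[R]_n) : coweight Phi y -> regular y ->
  generically (fun x => h x != 0 /\ h (x + cplx y) = h x).
Proof.
move=> yP ry; have Ny : coweight Phi (- y) by exact: coweightN.
have rNy : regular (- y) by move=> a aP; rewrite dotNr oppr_eq0 ry.
have [D [P [tD Dnz tP DP]]] := cf_cramer.
have [g [tg gnz g_good]] := generically_good.
have gD := generically_neq0 tD Dnz.
have gg := generically_neq0 tg gnz.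
have gw := generically_one_wall yP ry.
have := generically_and (generically_and gD gg)
  (generically_and (generically_shift (cplx y) gD) gw).
apply: generically_mono => x [[Dx gx] [Dxy wall]].
have [A A0 AE] := psi_ray tD tP DP tg g_good yP ry Dx gx wall.
have opp (t : R[i]) : (- t) *: cplx (- y) = t *: cplx y by rewrite cplxN scalerN scaleNr opprK.
have [|A' _ A'E] := psi_ray tD tP DP tg g_good Ny rNy Dx gx.
  by move=> t b b' bP b'P h1 h2; rewrite -[t]opprK opp; exact: wall.
have [N [Q QE]] := laurent_trig x tD yP.
have Q0 : Q != 0.
  apply: contraNneq Dx => Q0; move/eqP: (QE 0).
  by rewrite Q0 horner0 scale0r addr0 qpow0 expr1n mul1r.
(* [rA] is [w^k A'(w^-1)], of degree at most [k]; its equality with [A w^k] makes [A] constant. *)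
pose k := size A'; pose rA := \sum_(i < k) A'`_i *: 'X^(k - i).
have rE : A * 'X^k = rA.
  apply/eqP; rewrite -subr_eq0; apply/eqP.
  apply: (poly_generic_eq0 Q0) => t; rewrite -QE => Qt.
  have Dt : D (x + t *: cplx y) != 0 by apply: contraNneq Qt => ->; rewrite mulr0.
  rewrite !(hornerD, hornerN, hornerM, hornerXn) -AE // -opp A'E ?opp // qpowN.
  rewrite horner_coef horner_sum mulr_suml -/k; apply/eqP; rewrite subr_eq0; apply/eqP.
  apply: eq_bigr => i _; rewrite hornerZ hornerXn -mulrA; congr (_ * _).
  have -> : e t ^+ k = e t ^+ (k - i) * e t ^+ i by rewrite -exprD subnK // ltnW.
  by rewrite exprVn mulrCA mulVf ?mulr1 ?expf_neq0 ?qpow_neq0.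
have A_nz : A != 0 by apply: contraNneq A0 => ->; rewrite horner0.
have szA : (size A <= 1)%N.
  have := size_mulXn k A_nz; rewrite rE => szr.
  have : (size rA <= k.+1)%N.
    apply: (leq_trans (size_sum _ _ _)); apply/bigmax_leqP => i _.
    by apply: (leq_trans (size_scale_leq _ _)); rewrite size_polyXn ltnS leq_subr.
  by rewrite szr -addn1 leq_add2l.
have h0 : h x = A.[0].
  by have := AE 0; rewrite scale0r addr0 (size1_polyC szA) !hornerC; apply.
have h1 : h (x + cplx y) = A.[0].
  by have := AE 1; rewrite scale1r (size1_polyC szA) !hornerC; apply.
by rewrite h0 h1.
Qed.

(** Any coweight is the difference of two regular ones, [y2 + y] and [y2]. *)
Lemma psi_shift_coweight (y : 'rV[R]_n) : coweight Phi y ->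
  generically (fun x => h x != 0 /\ h (x + cplx y) = h x).
Proof.
move=> yP; have [y1 /coweight_lattice y1P ry1] := generic_vector (root_neq0 Phi_root).
have [N0 hN0] := generic_comb (finmap.enum_fset Phi) y1 y.
pose y2 := N0.+1%:R *: y1.
have y2P : coweight Phi y2.
  by rewrite /y2 -[N0.+1%:R]/(N0.+1%:Z%:~R) scaler_int; apply: coweightMz => //; exact: y1P.
have ry2 : regular y2 by move=> a aP; rewrite dotZr mulf_neq0 ?pnatr_eq0 // ry1.
have r3 : regular (y2 + y).
  by move=> a aP; apply: hN0 => //; left; exact: ry1.
have g3 := psi_shift_regular (coweightD y2P yP) r3.
have g2 := generically_shift (cplx y) (psi_shift_regular y2P ry2).
have := generically_and g3 g2.
apply: generically_mono => x [[h0 h3] [_ h2]]; split=> //.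
by rewrite -h2 -addrA -cplxD (addrC y) h3.
Qed.

End Evaluation.

(** * Leading coefficients under the Macdonald operator *)

Lemma qbr_telescope (k : nat) (X : R[i]) : br X != 0 ->
  br (X - k%:R) / br X * (\prod_(1 <= j < k.+1) br (j%:R - (X + 1))) =
  \prod_(1 <= j < k.+1) br (j%:R - X).
Proof.
move=> X0; have -> : br (X - k%:R) / br X = br (k%:R - X) / br (0 - X).
  by rewrite sub0r qbrN -[X - _]opprB qbrN invrN mulrN mulNr.
have {}X0 : br (0 - X) != 0 by rewrite sub0r qbrN oppr_eq0.
apply: (mulfI X0); rewrite !mulrA [br (0 - X) * br (k%:R - X)]mulrC mulfK //.
rewrite !big_add1 /= (eq_bigr (fun j : nat => br (j%:R - X))); last first.
  by move=> j _; congr br; rewrite -natr1; ring.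
rewrite mulrC -(big_nat_recr k 0 (fun j : nat => br (j%:R - X))) //=.
by rewrite big_nat_recl.
Qed.

(** Root by root: for [(a,t)] equal to 0, 1 or 2 the coefficient contains exactly as many quotients
    as [qbr_telescope] needs to undo the shift of the bracket product by [(a,t)]. *)
Lemma macdonald_top t v x : small_pairing t ->
  (forall a, a \in Phi -> 0 < dot a t -> 0 < dot a v) ->
  (forall a, a \in Phi -> nondegenerate a 1 x) ->
  macdonald_coef lq Phi m t x * top_coef v (x + cplx t) = top_coef v x.
Proof.
move=> [tP ht] dom nd; rewrite /macdonald_coef /top_coef.
rewrite (big_mkcond (fun a => 0 < dot a t)) (big_mkcond (fun a => dot a t == 2)).
rewrite (big_mkcond (fun a => 0 < dot a v)) [RHS]big_mkcond /= -!big_split /=.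
apply: eq_big_seq => a aP; have a_nz := root_nz aP.
have [k kE] := coweight_pairing tP aP; have kE' : dot a t = k%:~R by rewrite dotC.
have n0 : br (pr a x) != 0 by have := nd a aP 0 isT; rewrite addr0.
have n1 : br (pr a x + 1) != 0 by have := nd a aP 1 isT.
rewrite dotDr dot_cplx kE' real_complex_int.
have [av|av] := boolP (0 < dot a v); last first.
  have -> : (0 < (k%:~R : R)) = false by apply/negP => k0; case/negP: av; apply: dom; rewrite ?kE'.
  have -> : (k%:~R == 2 :> R) = false.
    by apply/eqP => k2; case/negP: av; apply: dom; rewrite // kE' k2.
  by rewrite !mul1r.
have k_ge0 : 0 <= k.
  rewrite leNgt; apply/negP => k0; have NaP : - a \in Phi by rewrite rootN.
  have := dom (- a) NaP; rewrite !pos_negE kE' ltrz0 k0 => /(_ isT) av'.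
  by have := lt_trans av av'; rewrite ltxx.
have k_le2 : k <= 2.
  have [/andP[_]|tE|tE] := ht a aP.
  - by rewrite kE -[1]/(1%:~R) ler_int => h; apply: le_trans h _.
  - by move: kE; rewrite tE dot_checkv_self // -[2]/(2%:~R) => /intr_inj <-.
  move: kE; rewrite tE dotNl dot_checkv_self // -[2]/(2%:~R) -intrN => /intr_inj k2.
  by move: k_ge0; rewrite -k2.
have : k = 0 \/ k = 1 \/ k = 2 by move: k_ge0 k_le2; clear; lia.
move=> [->|[->|->]].
- by rewrite ltxx -[2 : R]/(2%:~R) eqr_int /= !mul1r addr0.
- by rewrite ltr0z -[2 : R]/(2%:~R) eqr_int /= mulr1 qbr_telescope.
rewrite ltr0z -[2 : R]/(2%:~R) eqr_int /= -(qbr_telescope _ n0).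
rewrite -(qbr_telescope (m a) n1) mulrA.
congr (_ * (br _ / _) * _); first by rewrite addrAC.
by apply: eq_bigr => j _; congr br; rewrite -addrA.
Qed.

Lemma trig_rational_macdonald t : trig_rational (macdonald_coef lq Phi m t).
Proof.
have quot a (c d : R[i]) : a \in Phi -> generically (fun x => br (pr a x + d) != 0) ->
    trig_rational (fun x => br (pr a x + c) / br (pr a x + d)).
  move=> aP nz; apply: trig_rationalM.
    exact/trig_rational_poly/trig_poly_qbr/root_lattice_root.
  apply: trig_rational_inv nz.
  exact/trig_rational_poly/trig_poly_qbr/root_lattice_root.
have nz a : a \in Phi -> generically (nondegenerate a 1).
  by move=> aP; apply: generically_nondegenerate (root_nz aP); exact: root_lattice_root.
apply: trig_rationalM;
  apply: trig_rational_prod => a aP _.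
  have := quot a (- (m a)%:R) 0 aP; rewrite (_ : (fun x => _ / br (pr a x + 0)) =
     fun x => br (pr a x - (m a)%:R) / br (pr a x)); last by apply/funext => x; rewrite addr0.
  by apply; apply: generically_mono (nz a aP) => x h; exact: (h 0).
have := quot a (- (m a)%:R + 1) 1 aP; rewrite (_ : (fun x => br (pr a x + (_ + _)) / _) =
     fun x => br (pr a x - (m a)%:R + 1) / br (pr a x + 1)); last by apply/funext => x; rewrite addrA.
by apply; apply: generically_mono (nz a aP) => x h; exact: (h 1).
Qed.

(** * Macdonald operators *)

Section Macdonald.

(* The strings of a wave function lie in cosets of the coroot lattice, so its *)
(* restriction to a coset is again a wave function.                           *)
Lemma cf_coset x l : good x -> cf l x != 0 -> coroot_lattice (l - rvee v0).
Proof.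
move=> gx cl; apply: contrapT => no.
pose c l : R[i] := if `[< coroot_lattice (l - rvee v0) >] then cf l x else 0.
have sc : supported B c by move=> l'; rewrite /c; case: ifP; rewrite ?eqxx // => _ /cf_supp.
have wc : wave_eqs x c.
  apply: (string_eqs_intro uB sc) => a s t aP _ sm tP.
  have same l' : same_string a t l' ->
      `[< coroot_lattice (l' - rvee v0) >] = `[< coroot_lattice (t - rvee v0) >].
    move=> [j ->]; have aj : coroot_lattice (checkv a *~ j).
      by apply: coroot_latticeMz => //; exact: coroot_lattice_root.
    apply/asboolP/asboolP => h; last by rewrite addrAC; exact: coroot_latticeD.
    by have := coroot_latticeB h aj; rewrite addrAC addrK.
  have h := @cf_wave x a s t B aP I sm tP uB (@cf_supp x).
  case: (boolP `[< coroot_lattice (t - rvee v0) >]) => tc.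
    by rewrite -[RHS]h; apply: eq_bigr => l' /asboolP/same; rewrite /c tc => ->.
  by apply: big1 => l' /asboolP/same; rewrite /c (negbTE tc) => ->; rewrite mul0r.
have hl : 1 * cf l x + -1 * c l = 0.
  apply: (cf_unique rv0 gx
    (string_eqs_lin (k1 := 1) (k2 := -1) (@cf_supp x) sc (@cf_wave x) wc)).
    move=> l'; apply: contraNT => lB.
    by rewrite (contraNeq (@cf_supp x l') lB) (contraNeq (@sc l') lB) !mulr0 addr0.
  rewrite /c subrr; case: asboolP => [_|[]]; last exact: coroot_lattice0.
  by rewrite mulN1r mul1r subrr.
move: cl hl; rewrite mul1r {1}/c; case: asboolP => // _ cl.
by rewrite mulr0 addr0 => e0; rewrite e0 eqxx in cl.
Qed.

Variable p : 'rV[R]_n.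
Hypothesis p_small : small_pairing p.
Hypothesis p_neq0 : p <> 0.
Variable T : seq 'rV[R]_n.
Hypothesis uT : uniq T.
Hypothesis hT : forall t, t \in T <-> W_orbit Phi p t.
Local Notation mac := (macdonald_coef lq Phi m).

Lemma orbit_coweight t : t \in T -> coweight Phi t.
Proof. by move=> /hT/(orbit_small p_small)[]. Qed.

Lemma orbit_sum_seq z : orbit_sum lq Phi p z = \sum_(t <- T) e (2 * pr t z).
Proof. exact: (orbit_fsbig uT hT). Qed.

(** The reflection in [a] permutes the orbit and exchanges the two shifted points up to a multiple
    of [2 (a^vee,z)] in the exponent, which the wall condition removes. *)
Lemma orbit_sum_qi : qi_ring lq Phi m (orbit_sum lq Phi p).
Proof.
split.
  exists T, (fun=> 1); split=> [t|z]; first exact: orbit_coweight.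
  by rewrite orbit_sum_seq; apply: eq_bigr => t _; rewrite mul1r.
move=> a s z aP _ Gz; rewrite !orbit_sum_seq.
rewrite -[LHS](orbit_big_refl uT hT _ _ aP) big_seq [RHS]big_seq.
apply: eq_bigr => t tT; have a_nz := root_nz aP.
have [k kE] := coweight_pairing (orbit_coweight tT) aP.
have -> : pr (reflv a t) (z + (s%:R / 2) *: cplx a) =
    pr t (z - (s%:R / 2) *: cplx a) - pr (checkv a) z *~ k.
  rewrite reflvE cplxB cplxZ dotBl dotDr dotBr (dotZl (dot a t)%:C) dotDr !(dotZr (s%:R / 2)).
  rewrite !dot_cplx dot_checkv_self // (dotC a t) kE !real_complex_int rmorph_nat -mulrzr; by field.
by rewrite mulrDr mulrN mulrzAr qpowB qpowMz Gz exp1rz divr1.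
Qed.

Lemma macdonald_seq Pos F x : macdonald lq Phi Pos m p F x =
  \sum_(t <- T) mac t x * (F (x + cplx t) - F x) +
  (\sum_(t <- T) e (2 * (dot (rho Pos m) t)%:C)) * F x.
Proof. by rewrite /macdonald !(orbit_fsbig uT hT). Qed.

Lemma macdonald_difference Pos : difference_operator (macdonald lq Phi Pos m p).
Proof.
pose cst := \sum_(t <- T) e (2 * (dot (rho Pos m) t)%:C).
apply: (@difference_operator_pairs _ (None :: map Some T)
  (fun o => if o is Some t then t else 0)
  (fun o => if o is Some t then mac t else fun x => cst - \sum_(t <- T) mac t x)).
- move=> [t|]; rewrite inE //=; last by move=> _ a aP; rewrite dot0l int_num0.
  by move=> /mapP[t' /orbit_coweight h [->]].
- have tm t := trig_rational_macdonald t.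
  move=> [t|] _; first exact: tm.
  have := trig_rationalD (trig_rational_const cst)
    (trig_rational_sum (s := T) (P := xpredT) (F := fun t x => -1 * mac t x)
      (fun t _ _ => trig_rationalM (trig_rational_const (-1)) (tm t))).
  congr Defs.trig_rational; apply/funext => x; congr (_ + _).
  by rewrite -sumrN; apply: eq_bigr => t _; rewrite mulN1r.
move=> F x; rewrite macdonald_seq -/cst big_cons big_map cplx0 addr0 mulrBl addrC -addrA; congr (_ + _).
rewrite mulr_suml addrC -sumrB; apply: eq_bigr => t _; by rewrite mulrBr.
Qed.

(* The two sides of D^pi psi = f psi have the same coefficients at the extreme *)
(* vertices, so they differ by a multiple of psi.                              *)
Lemma macdonald_proportional : generically (fun x => exists g : R[i], forall z,
  \sum_(t <- T) mac t x * psi (x + cplx t) z + g * psi x z =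
  (\sum_(t <- T) e (2 * pr t z)) * psi x z).
Proof.
pose C := undup (B ++ [seq t + l | t <- T, l <- B]).
have uC : uniq C by exact: undup_uniq.
have BC l : l \in B -> l \in C by move=> lB; rewrite mem_undup mem_cat lB.
have TC t l : t \in T -> l \in B -> t + l \in C.
  by move=> tT lB; rewrite mem_undup mem_cat allpairs_f ?orbT.
have CE l : l \in C -> l \in B \/ exists t l', [/\ t \in T, l' \in B & l = t + l'].
  rewrite mem_undup mem_cat => /orP[|/allpairsP[[t l'] [h1 h2 ->]]]; first by left.
  by right; exists t, l'.
have CP l : l \in C -> coweight Phi l.
  move=> /CE[/hB[]//|[t [l' [tT /hB[l'P _] ->]]]].
  by apply: coweightD => //; exact: orbit_coweight.
have [K CK] := pairing_bound C (finmap.enum_fset Phi).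
have gK : generically (fun x => forall b, b \in finmap.enum_fset Phi -> nondegenerate b (maxn 1 K) x).
  apply: generically_seq => b bP.
  exact: (generically_nondegenerate _ (root_lattice_root bP) (root_nz bP)).
have := generically_and gK
  (generically_good_shift (0 :: T)).
apply: generically_mono => x [ndK gs].
have nd1 b : b \in Phi -> nondegenerate b 1 x.
  by move=> bP k k1; apply: ndK => //; apply: (le_trans k1); rewrite lez_nat leq_maxl.
have nd b : b \in Phi -> nondegenerate b K x.
  by move=> bP k k1; apply: ndK => //; apply: (le_trans k1); rewrite lez_nat leq_maxr.
have gx : good x by have := gs 0 (mem_head _ _); rewrite cplx0 addr0.
have gxt t : t \in T -> good (x + cplx t) by move=> tT; apply: gs; rewrite inE tT orbT.
(* The coefficients of the shift part of [D^pi psi] minus those of [f psi]; the number [g] is chosen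
   so that adding [g psi] clears the weight [rvee v0]. *)
pose F l : R[i] := 1 * (\sum_(t <- T) mac t x * cf (l - t) (x + cplx t)) +
   -1 * (\sum_(t <- T) 1 * cf (l - t) x).
pose g := - F (rvee v0) / cf (rvee v0) x.
pose c l : R[i] := 1 * F l + g * cf l x.
have top0 : cf (rvee v0) x != 0.
  by rewrite cf_top; exact: top_coef_neq0.
have sF : supported C F.
  move=> l; apply: contraNT => lC; rewrite /F !big_seq !big1 ?mulr0 ?addr0 // => t tT; apply/eqP.
    rewrite mulf_eq0; apply/orP; right; apply: contraNT lC => /cf_supp h.
    by have := TC t _ tT h; rewrite addrC subrK.
  rewrite mulf_eq0; apply/orP; right; apply: contraNT lC => /cf_supp h.
  by have := TC t _ tT h; rewrite addrC subrK.
have sx : supported C (cf^~ x) by move=> l /cf_supp/BC.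
have supp1 t x' : t \in T -> supported C (fun l => cf (l - t) x').
  move=> tT l /cf_supp h; by have := TC t _ tT h; rewrite addrC subrK.
have wF : wave_eqs x F.
  have w1 : wave_eqs x (fun l => \sum_(t <- T) mac t x * cf (l - t) (x + cplx t)).
    apply: (wave_sum (C := C) (ci := fun t l => cf (l - t) (x + cplx t))) => t tT; first exact: supp1.
    exact: (wave_shift (c := cf^~ (x + cplx t)) (orbit_coweight tT) uB (@cf_supp _) (@cf_wave _)).
  have w2 : wave_eqs x (fun l => \sum_(t <- T) 1 * cf (l - t) x).
    have fE z : orbit_sum lq Phi p z = \sum_(t <- T) 1 * e (2 * pr t z).
      by rewrite orbit_sum_seq; apply: eq_bigr => t _; rewrite mul1r.
    exact: (product_wave (x := x) orbit_coweight
      (proj2 orbit_sum_qi) fE).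
  have sum_supp (k : 'rV[R]_n -> R[i]) (d : 'rV[R]_n -> 'rV[R[i]]_n) :
      supported C (fun l => \sum_(t <- T) k t * cf (l - t) (d t)).
    move=> l; apply: contraNT => lC; rewrite big_seq big1 // => t tT; apply/eqP.
    rewrite mulf_eq0; apply/orP; right; apply: contraNT lC; exact: (supp1 t (d t) tT).
  exact: (string_eqs_lin (sum_supp _ _) (sum_supp _ (fun=> x)) w1 w2).
have wc : wave_eqs x c by exact: (string_eqs_lin sF sx wF (@cf_wave x)).
have sc : supported C c.
  move=> l; apply: contraNT => lC.
  by rewrite /c (contraNeq (@sF l) lC) (contraNeq (@sx l) lC) !mulr0 addr0.
have rvC : c (rvee v0) = 0 by rewrite /c /g divfK // mul1r subrr.
have support l : c l != 0 -> exists k l', [/\ k = 0 \/ k \in T, l' \in B, l = k + l' &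
    coroot_lattice (l' - rvee v0)].
  move=> cl; apply: contrapT => no.
  have none k x' : good x' -> k = 0 \/ k \in T -> cf (l - k) x' = 0.
    move=> gx' kT; apply/eqP; apply: contraT => h; case: no; exists k, (l - k).
    by split=> //; [exact: cf_supp h|rewrite addrC subrK|exact: (cf_coset gx' h)].
  have F0 : F l = 0.
    rewrite /F !big_seq !big1 ?mulr0 ?addr0 // => t tT; rewrite none ?mulr0 //; try by right.
    exact: gxt.
  have := none 0 x gx (or_introl erefl); rewrite subr0 => cf0.
  by rewrite /c F0 cf0 !mulr0 addr0 eqxx in cl.
(* At the vertex [t + rvee v] only the term of [t] contributes, on either side, and the two
   contributions agree by [macdonald_top]. *)
have extreme t v : t \in T -> regular v -> (forall a, a \in Phi -> 0 < dot a t -> 0 < dot a v) ->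
    (forall t', t' \in T -> t' != t -> dot t' v < dot t v) -> 0 < dot t v -> c (t + rvee v) = 0.
  move=> tT rv dom tmax tv.
  have out k x' : cf (t + rvee v - k) x' != 0 -> dot t v <= dot k v.
    move=> /cf_supp/hB[_ /(_ v)]; rewrite (hN_chamber rv) dotBl dotDl; lra.
  have others t' x' : t' \in T -> t' != t -> cf (t + rvee v - t') x' = 0.
    move=> t'T t't; apply/eqP; apply: contraT => /out h.
    by have := tmax t' t'T t't; rewrite ltNge h.
  have self : cf (t + rvee v) x = 0.
    apply/eqP; apply: contraT; rewrite -[t + _]subr0 => /out.
    by rewrite dot0l leNgt tv.
  rewrite /c self mulr0 addr0 mul1r /F mulN1r mul1r !(bigD1_seq t) //= (_ : t + rvee v - t = rvee v); last by rewrite addrC addKr.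
  rewrite !big1_seq ?addr0; try by move=> t' /andP[t't t'T]; rewrite others // mulr0.
  rewrite !chamber_formula //; last exact: gxt.
  rewrite (macdonald_top _ dom nd1) ?mul1r ?subrr //.
  by have /hT/(orbit_small p_small) := tT.
have c0 l : c l = 0.
  apply/eqP; apply: contraT => cl; pose S := [seq l <- C | c l != 0].
  have S0 : S != [::] by have : l \in S by [rewrite mem_filter cl sc]; case: (S).
  have [|s0] := top_bound rv0 S0.
    move=> b bP; exact: (wave_spread wc uC sc CP
      (fun l lC => CK l b lC bP) bP (nd b bP)).
  rewrite mem_filter => /andP[cs0 s0C] top; pose nu := s0 - rvee v0.
  (* The displacement [nu] of the translate of N lies in the hull of the orbit and 0. If [nu] is an
     orbit point, the same bound in the direction of a chamber adapted to it produces the support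
     point [nu + rvee v], already known to be cleared. *)
  have hull u : exists2 k, k = 0 \/ k \in T & dot nu u <= dot k u /\
      exists2 l', l' \in B & c (k + l') != 0 /\ dot nu u + hN u <= dot k u + dot l' u.
    have [t] := top u; rewrite mem_filter => /andP[ct tC] tu.
    have [k [l' [kT l'B tE _]]] := support t ct; exists k => //; move: tu; rewrite tE (dotDl k) => tu.
    by have /hB[_ /(_ u) l'u] := l'B; split; [rewrite /nu; lra|exists l' => //; rewrite -tE].
  have nuT : nu \in T \/ nu = 0.
    apply: (hull_lattice p_small hT).
      move=> u; have [k [->|kT] [h _]] := hull u; first by left; rewrite -(dot0l u).
      by right; exists k.
    have [k [l' [kT _ tE l'c]]] := support s0 cs0.
    have nuE : nu = k + (l' - rvee v0) by rewrite /nu tE addrA.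
    case: kT => [k0|/hT/(orbit_lattice p_small) kp]; first by right; rewrite nuE k0 add0r.
    by left; rewrite nuE addrAC; exact: coroot_latticeD.
  case: nuT => [nuT|/eqP]; last first.
    by rewrite subr_eq0 => /eqP s0E; rewrite s0E rvC eqxx in cs0.
  have [v [rv dom tmax nuv]] := dominant_chamber p_neq0 hT rv0 nuT.
  have [k kT [h1 [l' l'B [ck h2]]]] := hull v.
  have kE : k = nu.
    case: kT => [k0|kT]; first by move: h1; rewrite k0 dot0l leNgt nuv.
    by apply/eqP; apply: contraT => kn; have := tmax k kT kn; rewrite ltNge h1.
  have l'E : l' = rvee v.
    have /hB[_ l'N] := l'B; apply: (hN_top rv l'N).
    apply/eqP; rewrite eq_le -(hN_chamber rv) l'N /=.
    by move: h2; rewrite kE lerD2l.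
  by move: ck; rewrite kE l'E extreme ?eqxx.
exists g => z.
have E1 : \sum_(t <- T) mac t x * psi (x + cplx t) z =
    e (2 * dot x z) * \sum_(l <- C) (\sum_(t <- T) mac t x * cf (l - t) (x + cplx t)) * e (2 * pr l z).
  rewrite (eq_big_seq (fun t => e (2 * dot x z) *
      (\sum_(l <- C) mac t x * cf (l - t) (x + cplx t) * e (2 * pr l z)))).
    rewrite -[LHS]mulr_sumr; congr (_ * _); rewrite exchange_big; apply: eq_bigr => l _ /=.
    by rewrite mulr_suml.
  move=> t tT; rewrite (psi_shift x z uC (fun l => TC t l tT)) mulrCA.
  by congr (_ * _); rewrite [LHS]mulr_sumr; apply: eq_bigr => l _; rewrite mulrA.
have E2 : (\sum_(t <- T) e (2 * pr t z)) * psi x z =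
    e (2 * dot x z) * \sum_(l <- C) (\sum_(t <- T) 1 * cf (l - t) x) * e (2 * pr l z).
  apply: (product_expand (f := fun z => \sum_(t <- T) e (2 * pr t z)) x z _ uC TC).
  by move=> z'; apply: eq_bigr => t _; rewrite mul1r.
have E3 : psi x z = e (2 * dot x z) * \sum_(l <- C) cf l x * e (2 * pr l z).
  rewrite psiE; congr (_ * _); apply: big_support => // l; rewrite mulf_eq0 negb_or => /andP[].
    by move=> /cf_supp.
  by move=> /sx.
apply/eqP; rewrite -subr_eq0 E1 E2 E3 mulrCA -mulrDr -mulrBr mulf_eq0; apply/orP; right.
rewrite [g * _]mulr_sumr -big_split -sumrB /= big1 // => l _.
rewrite mulrA -mulrDl -mulrBl; set k := (X in X * _).
have -> : k = c l by rewrite /k /c /F; ring.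
by rewrite c0 mul0r.
Qed.

End Macdonald.

(** As psi at [z = rho] is nonzero and invariant under the shifts, [macdonald_proportional]
    evaluated there gives [g = S - A], the coefficient of the identity in the Macdonald operator. *)
Lemma macdonald_eigen Pos p : minuscule_or_quasi Phi p -> rho Pos m = rroot v0 ->
  qi_ring lq Phi m (orbit_sum lq Phi p) /\
  forall D, eigenoperator lq Phi psi (orbit_sum lq Phi p) D ->
    operator_eq lq Phi D (macdonald lq Phi Pos m p).
Proof.
move=> pm rhoE; have ps := minuscule_small pm; have [p0 _] := pm.
have [T uT hT] := orbit_list ps.
split; first exact: (orbit_sum_qi ps uT hT).
move=> D De; apply: (eigenoperator_unique De).
  exact: (macdonald_difference ps uT hT).
have gs : generically (fun x => forall t, t \in T -> psi x (cplx (rroot v0)) != 0 /\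
    psi (x + cplx t) (cplx (rroot v0)) = psi x (cplx (rroot v0))).
  apply: generically_seq => t /hT/(orbit_small ps)[tP _].
  exact: (psi_shift_coweight tP).
have := generically_and gs (macdonald_proportional ps p0 uT hT).
apply: generically_mono => x [hx [g gE]] z.
have pT : p \in T by apply/hT; exact: orbit_self.
have [h0 _] := hx p pT.
pose S := \sum_(t <- T) e (2 * (dot (rho Pos m) t)%:C).
pose A := \sum_(t <- T) macdonald_coef lq Phi m t x.
have gS : A + g = S.
  apply: (mulIf h0); rewrite mulrDl [A * _]mulr_suml.
  rewrite (eq_big_seq (fun t => macdonald_coef lq Phi m t x *
    psi (x + cplx t) (cplx (rroot v0)))) => [|t /hx[_ ->] //].
  rewrite gE; congr (_ * _); apply: eq_bigr => t _.
  by rewrite dot_cplx dotC rhoE.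
rewrite (macdonald_seq uT hT) (orbit_sum_seq uT hT) -gE -/S -gS mulrDl addrA; congr (_ + _).
rewrite [A * _]mulr_suml -big_split; apply: eq_bigr => t _ /=.
by rewrite mulrBr subrK.
Qed.

End Coefficients.

End BakerAkhiezerFunction.

(** * Passage to the data of the theorem *)

Lemma positive_big {R : realType} {n : nat} (Phi Pos : {fset 'rV[R]_n}) (v : 'rV[R]_n)
    (V : Type) (idx : V) (op : Monoid.com_law idx) (F : 'rV[R]_n -> V) :
  (forall a, (a \in Pos) = (a \in Phi) && (0 < dot a v)) ->
  \big[op/idx]_(a <- Pos) F a = \big[op/idx]_(a <- Phi | 0 < dot a v) F a.
Proof.
move=> PosE; rewrite -[RHS]big_filter; apply: perm_big; apply: uniq_perm.
- exact: fset_uniq.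
- exact/filter_uniq/fset_uniq.
by move=> a; rewrite mem_filter PosE andbC.
Qed.

Lemma polytope_hN {R : realType} {n : nat} (Phi Pos : {fset 'rV[R]_n}) (m : 'rV[R]_n -> nat)
    (v l u : 'rV[R]_n) : root_system Phi -> W_invariant Phi m -> regular Phi v ->
  (forall a, (a \in Pos) = (a \in Phi) && (0 < dot a v)) ->
  polytope Pos m l -> dot l u <= hN Phi m u.
Proof.
move=> Phi_root m_inv rv PosE [k kP <-]; rewrite (hN_abs Phi_root m_inv u rv).
rewrite -(positive_big _ _ PosE) /rhov dotBl (dotZl 2^-1) !dot_suml !mulr_sumr -sumrB.
rewrite big_seq [leRHS]big_seq; apply: ler_sum => a aP.
rewrite (dotZl (m a)%:R) (dotZl (k a)); have /andP[k0 km] := kP a aP.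
have h1 := ler_norm (dot (checkv a) u); have h2 := ler_norm (- dot (checkv a) u).
rewrite normrN in h2; have [d|d] := lerP 0 (dot (checkv a) u).
  rewrite ger0_norm //; have := mulr_ge0 k0 d; lra.
by rewrite ltr0_norm //; move: km k0 (ltW d); clear; nra.
Qed.

Theorem theorem5p1 (R : realType) (n : nat)
    (Phi Pos : {fset 'rV[R]_n}) (m : 'rV[R]_n -> nat) (q lq : R[i])
    (psi : 'rV[R[i]]_n -> 'rV[R[i]]_n -> R[i])
    (Phi_root : root_system Phi) (Phi_red : reduced Phi)
    (Phi_irr : irreducible Phi) (Pos_pos : positive_system Phi Pos)
    (m_inv : W_invariant Phi m)
    (q_neq0 : q != 0) (q_nonroot : forall k : nat, (0 < k)%N -> q ^+ k != 1)
    (lq_log : expC lq = q)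
    (psi_BA : normalized_BA lq Phi Pos m psi) :
  [/\ forall f, qi_ring lq Phi m f ->
        exists D, eigenoperator lq Phi psi f D,
      forall f g D E, qi_ring lq Phi m f -> qi_ring lq Phi m g ->
        eigenoperator lq Phi psi f D -> eigenoperator lq Phi psi g E ->
        operator_eq lq Phi (D \o E) (E \o D) &
      forall p, minuscule_or_quasi Phi p ->
        qi_ring lq Phi m (orbit_sum lq Phi p) /\
        forall D, eigenoperator lq Phi psi (orbit_sum lq Phi p) D ->
          operator_eq lq Phi D (macdonald lq Phi Pos m p)].
Proof.
have [v [rv PosE]] := Pos_pos.
have [B uB hB] := hN_list Phi_root m.
have [K hK] := hN_root_bound Phi_root m.
have [psi_ [psi0 psi_qi psi_top]] := psi_BA.
have rvE : rvee Phi m v = rhov Pos m.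
  by rewrite /rhov (positive_big _ _ PosE).
have rhoE : rho Pos m = rroot Phi m v by rewrite /rho (positive_big _ _ PosE).
pose KB := maxn K (\max_(b <- Phi) m b).
have hKB l b : l \in B -> b \in Phi -> `|dot l b| <= KB%:R.
  move=> /hB[_ lN] bP; apply: (le_trans (hK l lN b bP)).
  by rewrite ler_nat leq_maxl.
have hKm b : b \in Phi -> (m b <= KB)%N.
  move=> bP; apply: leq_trans (leq_maxr _ _).
  exact: (@leq_bigmax_seq _ (finmap.enum_fset Phi) xpredT m b bP isT).
(* Extended by 0 off the polytope, the coefficients can be summed over [B], which is cut out by the
   support function. *)
pose cf l x : R[i] := if (l \in B) && `[< polytope Pos m l >] then psi_ l x else 0.
have cf_supp x l : cf l x != 0 -> l \in B.
  by rewrite /cf; case: (l \in B) => //=; rewrite eqxx.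
have psiE x z : psi x z = qpow lq (2 * dot x z) *
    \sum_(l <- B) cf l x * qpow lq (2 * dot (cplx l) z).
  rewrite psi0; congr (_ * _).
  have -> : polytope Pos m `&` coweight Phi = [set` [seq l <- B | `[< polytope Pos m l >]]].
    apply/seteqP; split=> l /=.
      move=> [lN lP]; rewrite mem_filter; apply/andP; split; first exact/asboolP.
      by apply/hB; split=> // u; exact: (polytope_hN u Phi_root m_inv rv PosE lN).
    by rewrite mem_filter => /andP[/asboolP lN /hB[lP _]].
  rewrite -fsbig_seq ?filter_uniq // big_filter big_mkcond /=.
  rewrite big_seq [RHS]big_seq; apply: eq_bigr => l lB.
  by rewrite /cf lB /=; case: ifP => // _; rewrite mul0r.
have cf_wave x : wave_eqs lq Phi m x (cf^~ x).
  have := quasi_invariant_wave q_nonroot lq_log Phi_root (m := m) (s := B) (nu := id) (c := cf^~ x) (x := x).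
  rewrite (_ : (fun l => \sum_(i <- B | id i == l) cf i x) = cf^~ x).
    apply=> [l /hB[]//|]; have := psi_qi x.
    by congr (quasi_invariant _ _ _ _); apply/funext => z; exact: psiE.
  apply/funext => l; have [lB|lB] := boolP (l \in B).
    by rewrite -big_filter filter_pred1_uniq // big_seq1.
  rewrite (contraNeq (@cf_supp x l) lB) big_seq_cond big1 // => k /andP[kB /eqP kl].
  by rewrite -kl kB in lB.
have cf_top x : cf (rvee Phi m v) x = top_coef lq Phi m v x.
  have rB := rvee_B q_nonroot lq_log Phi_root Phi_red m_inv hB rv.
  rewrite /cf rB /=; case: asboolP => [_|[]].
    by rewrite rvE psi_top (positive_big _ _ PosE).
  rewrite rvE; exists (fun=> 0); first by move=> a _; rewrite lexx ler0n.
  by rewrite big1 ?subr0 // => a _; rewrite scale0r.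
have Phi_neq0 : exists a, a \in Phi by apply/fset0Pn; case: Phi_irr.
split.
- exact: (eigenoperator_exists q_nonroot lq_log Phi_root Phi_red m_inv uB hB hKB hKm cf_supp
    cf_wave rv cf_top psiE psi_qi).
- move=> f g D E _ _; exact: (eigenoperators_commute q_nonroot lq_log Phi_root Phi_red m_inv uB hB
    hKm cf_supp rv cf_top psiE).
move=> p pm; exact: (macdonald_eigen q_nonroot lq_log Phi_root Phi_red m_inv uB hB hKB hKm
    cf_supp cf_wave rv cf_top Phi_neq0 psiE psi_qi pm rhoE).
Qed.
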